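(* Let $m>1$ and let $(\boldsymbol M_n)$ be a $p$-dimensional martingale with respect to $(\mathcal{F}_n^{\mathcal{O}})$ of the form $\boldsymbol M_n=\sum_{\ell=1}^n\sum_{k\in\mathbb{G}_\ell^*}\boldsymbol W_k$ with random vectors $\boldsymbol W_k=(w_k^1,\dots,w_k^p)^t$. Write $\Delta\boldsymbol M_{n+1}=\boldsymbol M_{n+1}-\boldsymbol M_n$ (with $\boldsymbol M_0=0$), $\boldsymbol\Gamma_n=\mathbb{E}[\Delta\boldsymbol M_{n+1}\Delta\boldsymbol M_{n+1}^t\mid\mathcal{F}_n^{\mathcal{O}}]$ and let $\langle\boldsymbol M\rangle_n=\sum_{\ell=0}^{n-1}\boldsymbol\Gamma_\ell$ be the predictable quadratic variation of $(\boldsymbol M_n)$. Assume: (A.1) $(\boldsymbol M_n)$ is square-integrable. (A.2) $|\mathbb{T}_{n-1}^*|^{-1}\langle\boldsymbol M\rangle_n$ converges almost surely on $\overline{\mathcal{E}}$ to a positive semi-definite matrix $\boldsymbol\Gamma$. (A.3) The $p\times p$ matrix martingale $\boldsymbol K_n=\sum_{\ell=1}^n|\mathbb{T}_\ell^*|^{-1}\big(\Delta\boldsymbol M_{\ell+1}\Delta\boldsymbol M_{\ell+1}^t-\mathbb{E}[\Delta\boldsymbol M_{\ell+1}\Delta\boldsymbol M_{\ell+1}^t\mid\mathcal{F}_\ell^{\mathcal{O}}]\big)$ is square-integrable and its component-wise predictable quadratic variations are $\mathcal{O}(n)$ a.s. on $\overline{\mathcal{E}}$. Let $(\boldsymbol\Xi_n)_{n\ge0}$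 be a sequence of $p\times p$ invertible symmetric matrices such that (A.4) $|\mathbb{T}_n^*|^{-1}\boldsymbol\Xi_n$ converges a.s. on $\overline{\mathcal{E}}$ to an invertible matrix $\boldsymbol\Xi$; (A.5) there is a constant $\alpha>0$ such that on $\overline{\mathcal{E}}$ and for all $n$, $\alpha(\boldsymbol\Xi_{n-1}^{-1}-\boldsymbol\Xi_n^{-1})-\boldsymbol\Xi_n^{-1}\boldsymbol\Gamma_n\boldsymbol\Xi_n^{-1}$ is positive semi-definite. Then $\boldsymbol M_n^t\boldsymbol\Xi_{n-1}^{-1}\boldsymbol M_n=\mathcal{O}(n)$ a.s., and if $\boldsymbol\Xi$ is positive definite, $\|\boldsymbol M_n\|^2=\mathcal{O}(nm^n)$ a.s. If in addition the entries of $(\boldsymbol M_n)$ satisfy, for every $i\in\{1,\dots,p\}$, (A.6) $\sup_n\mathbb{E}\big[\big(m^{-n/2}\sum_{k\in\mathbb{G}_n^*}w_k^i\big)^4\,\big|\,\mathcal{F}_{n-1}^{\mathcal{O}}\big]<\infty$ almost surely, then for all $\delta>1/2$, $\|\boldsymbol M_n\|^2=o(n^\delta m^n)$ a.s., and $$\lim_{n\to\infty}\mathbf{1}_{\{|\mathbb{G}_n^*|>0\}}\frac1n\sum_{\ell=1}^n\boldsymbol M_\ell^t\boldsymbol\Xi_{\ell-1}^{-1}\boldsymbol M_\ell=\mathrm{tr}(\boldsymbol\Gamma\boldsymbol\Xi^{-1})\,\mathbf{1}_{\overline{\mathcal{E}}}\quad\text{a.s.}$$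
   Context: The positive integers form a binary tree, the offspring of $k$ being $2k$ and $2k+1$; $\mathbb{G}_n=\{2^n,\dots,2^{n+1}-1\}$, $\mathbb{T}_n=\bigcup_{\ell=0}^n\mathbb{G}_\ell$. Galton–Watson tree: $\delta_1=1$, $\delta_{2k}=\delta_k\xi_k^0$, $\delta_{2k+1}=\delta_k\xi_k^1$, where $(\xi_k^0,\xi_k^1)_{k\ge1}$ are i.i.d. in $\{0,1\}^2$ taking the values $(1,0),(0,1),(1,1),(0,0)$ with probabilities $p_0,p_1,p_{01},1-p_0-p_1-p_{01}$. $\mathbb{G}_n^*=\{k\in\mathbb{G}_n:\delta_k=1\}$, $\mathbb{T}_n^*=\{k\in\mathbb{T}_n:\delta_k=1\}$, $|\cdot|$ denotes cardinality, $m=2p_{01}+p_0+p_1$ is the mean of the reproduction law. $\mathcal{E}=\bigcup_{n\ge0}\{|\mathbb{G}_n^*|=0\}$ is the extinction event and $\overline{\mathcal{E}}$ its complement. Filtration: $(X_k)_{k\ge1}$ is the real-valued process given by $X_1$ and, for $k\ge1$, $X_{2k}=(b+\eta_{2k})X_k+a+\varepsilon_{2k}$, $X_{2k+1}=(d+\eta_{2k+1})X_k+c+\varepsilon_{2k+1}$, with $(a,b,c,d)\in\mathbb{R}^4$ and real random noise variables $\varepsilon_j,\eta_j$. $\mathcal{O}=\sigma\{\delta_k,k\ge1\}$ and $\mathcal{F}_n^{\mathcal{O}}=\mathcal{O}\vee\sigma\{\delta_kX_k,k\in\mathbb{T}_n\}$ (so the whole observation process is known at time $0$). The martingale property of $(\boldsymbol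 K_n)$ is with respect to the shifted filtration $(\mathcal{F}_{n+1}^{\mathcal{O}})_n$.
   Formalization: The first conclusion, M_n^t Ξ_{n-1}^{-1} M_n = O(n), is proved a.s. on the non-extinction event only; on extinction Ξ_n is unconstrained (e.g. Ξ_n = e^{-n} I there), so the unrestricted a.s. claim is false. *)

(* Defs.v *)
From HB Require Import structures.
From mathcomp Require Import all_boot all_order all_algebra.
From mathcomp Require Import all_classical all_reals all_analysis.
From mathcomp Require Import measurable_realfun.

Set Implicit Arguments.
Unset Strict Implicit.
Unset Printing Implicit Defensive.

Import Order.TTheory GRing.Theory Num.Theory.
Import numFieldNormedType.Exports.

Local Open Scope classical_set_scope.
Local Open Scope ring_scope.

Section matrices.
Context {R : realType} {p : nat}.

Definition psdmx (A : 'M[R]_p) : Prop :=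
  A^T = A /\ forall v : 'cV[R]_p, 0 <= (v^T *m A *m v) 0 0.

Definition posdefmx (A : 'M[R]_p) : Prop :=
  A^T = A /\ forall v : 'cV[R]_p, v != 0 -> 0 < (v^T *m A *m v) 0 0.

(* The squared Euclidean norm; the library's `|v| is the maximum norm. *)
Definition sqnorm (v : 'cV[R]_p) : R := \sum_(i < p) v i 0 ^+ 2.

End matrices.

Section conditional_expectation.
Context {d : measure_display} {T : measurableType d} {R : realType}.
Variable P : probability T R.

Definition measurable_wrt d' (U : measurableType d') (G : set (set T))
    (Y : T -> U) : Prop :=
  forall B : set U, measurable B -> G (Y @^-1` B).

(* Y is a version of E[Z | G], for an integrable Z; the sigma-algebra G is
   given as a set of subsets of T. *)
Definition is_condexp (G : set (set T)) (Z Y : T -> R) : Prop :=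
  [/\ P.-integrable [set: T] (EFin \o Z), P.-integrable [set: T] (EFin \o Y),
      measurable_wrt G Y &
      forall A, G A -> (\int[P]_(x in A) (Y x)%:E = \int[P]_(x in A) (Z x)%:E)%E].

(* Y is a version of E[Z | G], for a nonnegative, possibly non-integrable Z. *)
Definition is_condexp_ge0 (G : set (set T)) (Z Y : T -> \bar R) : Prop :=
  [/\ measurable_fun [set: T] Z, (forall x, 0 <= Z x)%E,
      measurable_wrt G Y, (forall x, 0 <= Y x)%E &
      forall A, G A -> (\int[P]_(x in A) Y x = \int[P]_(x in A) Z x)%E].

Definition square_integrable (Z : T -> R) : Prop :=
  measurable_fun [set: T] Z /\
  P.-integrable [set: T] (fun x => (Z x ^+ 2)%:E).

(* The increments of the predictable quadratic variation of N with respect to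
   the filtration F, which is then \sum_(0 <= l < n) q l. *)
Definition is_pqv_incr (F : nat -> set (set T)) (N q : nat -> T -> R) : Prop :=
  forall l, is_condexp (F l) (fun x => (N l.+1 x - N l x) ^+ 2) (q l).

Definition random_mx q r (A : T -> 'M[R]_(q, r)) : Prop :=
  forall i j, measurable_fun [set: T] (fun x => A x i j).

Definition is_condexp_mx q r (G : set (set T)) (Z Y : T -> 'M[R]_(q, r)) :=
  forall i j, is_condexp G (fun x => Z x i j) (fun x => Y x i j).

Definition square_integrable_mx q r (Z : T -> 'M[R]_(q, r)) : Prop :=
  forall i j, square_integrable (fun x => Z x i j).

Definition martingale_mx q r (F : nat -> set (set T))
    (N : nat -> T -> 'M[R]_(q, r)) : Prop :=
  forall n, is_condexp_mx (F n) (N n.+1) (N n).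

Definition mutually_independent d' (U : measurableType d') (I : set nat)
    (Y : nat -> T -> U) : Prop :=
  forall J : seq nat, uniq J -> (forall j, j \in J -> I j) ->
  forall B : nat -> set U, (forall j, measurable (B j)) ->
    fine (P (\big[setI/[set: T]]_(j <- J) (Y j @^-1` B j))) =
    \prod_(j <- J) fine (P (Y j @^-1` B j)).

End conditional_expectation.

Section galton_watson.
Context {d : measure_display} {T : measurableType d} {R : realType}.
Variable P : probability T R.

(* xi k = (xi_k^0, xi_k^1); the positive integers index the tree, and the
   values of the sequences at 0 play no role. *)
Definition reproduction (p0 p1 p01 : R)
    (xi : nat -> {mfun T >-> (bool * bool)%type}) : Prop :=
  mutually_independent P [set k | (0 < k)%N] (fun k => xi k : T -> _) /\
  forall k, (0 < k)%N ->
    [/\ P (xi k @^-1` [set (true, false)]) = p0%:E,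
        P (xi k @^-1` [set (false, true)]) = p1%:E,
        P (xi k @^-1` [set (true, true)]) = p01%:E &
        P (xi k @^-1` [set (false, false)]) = (1 - p0 - p1 - p01)%:E].

Definition gw_tree (xi : nat -> {mfun T >-> (bool * bool)%type})
    (delta : nat -> T -> bool) : Prop :=
  (forall x, delta 1%N x = true) /\
  forall k x, (0 < k)%N ->
    delta (2 * k)%N x = delta k x && (xi k x).1 /\
    delta (2 * k).+1 x = delta k x && (xi k x).2.

Variable delta : nat -> T -> bool.

Definition Gen (n : nat) : seq nat := index_iota (2 ^ n) (2 ^ n.+1).

Definition Tree (n : nat) : seq nat := flatten [seq Gen l | l <- iota 0 n.+1].

Definition Gstar (n : nat) (x : T) : seq nat := [seq k <- Gen n | delta k x].

Definition Tstar (n : nat) (x : T) : seq nat := [seq k <- Tree n | delta k x].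

Definition extinction : set T :=
  \bigcup_(n in [set: nat]) [set x | size (Gstar n x) = 0%N].

Definition survival : set T := ~` extinction.

(* A property holding almost surely on the event of non-extinction. *)
Definition as_survival (Q : T -> Prop) : Prop :=
  {ae P, forall x, survival x -> Q x}.

Definition obs_sigma : set (set T) :=
  <<s \bigcup_(k in [set k | (0 < k)%N])
        preimage_set_system [set: T] (delta k) measurable >>.

Definition obs_filtration (X : nat -> T -> R) (n : nat) : set (set T) :=
  <<s obs_sigma `|`
      \bigcup_(k in [set k | k \in Tree n])
        preimage_set_system [set: T] (fun x => (delta k x)%:R * X k x)
          measurable >>.

Definition Mproc p (W : nat -> T -> 'cV[R]_p) (n : nat) (x : T) : 'cV[R]_p :=
  \sum_(1 <= l < n.+1) \sum_(k <- Gstar l x) W k x.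

(* dMproc W n is Delta M_(n+1). *)
Definition dMproc p (W : nat -> T -> 'cV[R]_p) (n : nat) (x : T) : 'cV[R]_p :=
  Mproc W n.+1 x - Mproc W n x.

Definition bracket p (Gam : nat -> T -> 'M[R]_p) (n : nat) (x : T) : 'M[R]_p :=
  \sum_(0 <= l < n) Gam l x.

Definition Kproc p (W : nat -> T -> 'cV[R]_p) (Gam : nat -> T -> 'M[R]_p)
    (n : nat) (x : T) : 'M[R]_p :=
  \sum_(1 <= l < n.+1) (size (Tstar l x))%:R^-1 *:
    (dMproc W l x *m (dMproc W l x)^T - Gam l x).

End galton_watson.

Definition rcbar {d : measure_display} {T : measurableType d} {R : realType}
    (a b c e : R) (X eps eta : nat -> T -> R) : Prop :=
  forall k x, (0 < k)%N ->
    X (2 * k)%N x = (b + eta (2 * k)%N x) * X k x + a + eps (2 * k)%N x /\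
    X (2 * k).+1 x = (e + eta (2 * k).+1 x) * X k x + c + eps (2 * k).+1 x.

(* Main.v *)
Require Import Defs.
From HB Require Import structures.
From mathcomp Require Import all_boot all_order all_algebra.
From mathcomp Require Import all_classical all_reals all_analysis.
From mathcomp Require Import measurable_realfun.
From mathcomp Require Import ring lra.

Set Implicit Arguments.
Unset Strict Implicit.
Unset Printing Implicit Defensive.

Import Order.TTheory GRing.Theory Num.Theory.
Import numFieldNormedType.Exports.

Local Open Scope classical_set_scope.
Local Open Scope ring_scope.

(** The martingale is compared with the size [t n] of the observed tree up to
    generation [n].  Since [Xi n / t n] converges, the quadratic form [V n] is a
    combination, with convergent coefficients, of the normalised products
    [s n = M n i * M n j / t (n-1)], and the conclusions are statements about these.

    On survival, [t n] lies between multiples of [m ^ n], and [t n / t (n+1)] tends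
    to [m^-1] ([gw_growth], [quasi_geometric_growth]).  Indeed, with [Z_n] the size
    of generation [n], the expectation of [u ^ Z_n] on [Z_n > 0] decays
    geometrically (a contraction property of the iterated generating functions,
    [pgf_alive_le]).  By an exponential Markov inequality and Borel-Cantelli the
    population then grows geometrically, after which the relative deviations of
    [Z_(n+1)] from [m Z_n] are summable.

    Expanding the product of two coordinates at time [n+1] gives
    [s (n+1) = (t (n-1) / t n) * s n + (cross terms + D_i * D_j) / t n], where [D]
    is the increment of [M].  The factor tends to [m^-1 < 1], so summing over [n]
    bounds [s n] plus a multiple of [\sum_(l < n) s l] by three terms.
    - The predictable part [\sum_(l < n) Gam l / t l] is linear, because convergence
      of the normalised bracket passes to its increments.
    - The compensated products [D_i * D_j - Gam] sum up to [Kproc], which is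
      [o(n)] as a martingale whose quadratic variation is [O(n)].
    - The cross terms form a martingale whose quadratic variation is at most a
      multiple of [\sum_(l < n) s l] itself.
    Both martingales are controlled by a law of large numbers that is valid
    whatever the growth of the quadratic variation: almost surely, for every
    [eps > 0], the martingale is at most [eps] times its quadratic variation plus a
    constant ([martingale_slln], [martingale_transform_slln]).  For [eps] small
    the cross terms are absorbed, whence [s n = O(n)] and
    [\sum_(l < n) s l = O(n)] ([normalised_square_bound]); this is the first half of
    the theorem.

    Under the fourth moment condition, the conditional Markov inequality and
    Borel-Cantelli bound the increments, and summing them up gives
    [M n i ^ 2 = o(n ^ del * m ^ n)] for [del > 2^-1] ([coordinate_growth]).  With
    [del = 1] this makes [s n] itself [o(n)], so that in the summed recursion only
    [(1 - m^-1) * \sum_(l < n) s l = \sum_(l < n) Gam l / t l + o(n)] remains.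
    As [Gam l / t l] tends to [(1 - m^-1) * GamL], the averages of [s n] tend to the
    entries of [GamL] ([normalised_product_average]), and those of [V n] to the
    trace. *)


(** * Sublinear sequences and summation *)

Section sublinear_sequences.
Context {R : realType}.
Implicit Types (u v w x : nat -> R).

(** This is [u n = o(n)]; with an additive constant in place of a threshold on
    [n], finitely many terms of a sum can be discarded without a case analysis. *)
Definition sublinear u : Prop :=
  forall eps : R, 0 < eps -> exists C : R, forall n, `|u n| <= eps * n%:R + C.

Lemma sublinearD u v : sublinear u -> sublinear v -> sublinear (fun n => u n + v n).
Proof.
move=> hu hv eps e0; have e20 : 0 < eps / 2 by rewrite divr_gt0.
have [C hC] := hu _ e20; have [D hD] := hv _ e20.
exists (C + D) => n; apply: (le_trans (ler_normD _ _)).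
apply: (le_trans (lerD (hC n) (hD n))); lra.
Qed.

Lemma sublinearZ (k : R) u : sublinear u -> sublinear (fun n => k * u n).
Proof.
move=> hu eps e0; have k0 : 0 < `|k| + 1 by rewrite ltr_wpDl.
have [C hC] := hu _ (divr_gt0 e0 k0).
exists ((`|k| + 1) * C) => n; rewrite normrM.
apply: (@le_trans _ _ ((`|k| + 1) * `|u n|)).
  by rewrite ler_wpM2r// lerDl.
apply: (le_trans (ler_wpM2l (ltW k0) (hC n))).
by rewrite mulrDr mulrA mulrCA mulfV ?mulr1// gt_eqF.
Qed.

Lemma sublinear_sum (I : Type) (r : seq I) (u : I -> nat -> R) :
  (forall i, sublinear (u i)) -> sublinear (fun n => \sum_(i <- r) u i n).
Proof.
move=> hu; elim: r => [|i r IH].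
  by move=> eps e0; exists 0 => n; rewrite big_nil normr0 addr0 mulr_ge0// ltW.
have := sublinearD (hu i) IH; congr sublinear; apply/funext => n.
by rewrite big_cons.
Qed.

Lemma eq_sublinear u v : u =1 v -> sublinear u -> sublinear v.
Proof. by move=> /funext ->. Qed.

Lemma cvg0_eps u : u @ \oo --> (0 : R) ->
  forall eps : R, 0 < eps -> exists N, forall n, (N <= n)%N -> `|u n| <= eps.
Proof.
move=> /cvgrPdist_le u0 eps e0; have [N _ hN] := u0 _ e0.
by exists N => n Nn; have := hN n Nn; rewrite /= sub0r normrN.
Qed.

(** The terms in which [u] is not yet small go into the additive constant. *)
Lemma sublinear_weighted u v (C : R) : u @ \oo --> (0 : R) ->
  (forall n, \sum_(0 <= l < n) `|v l| <= C * n.+1%:R) ->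
  sublinear (fun n => \sum_(0 <= l < n) u l * v l).
Proof.
move=> u0 hv eps e0.
have C0 : 0 <= C by have := hv 0%N; rewrite big_geq// mulr1.
have e10 : 0 < eps / (C + 1) by rewrite divr_gt0// ltr_wpDl.
have [N hN] := cvg0_eps u0 e10.
set K := \sum_(0 <= l < N) `|u l * v l|.
have K0 : 0 <= K by apply: sumr_ge0.
have e1C : eps / (C + 1) * C <= eps.
  by rewrite mulrAC ler_pdivrMr ?ltr_wpDl// ler_wpM2l ?(ltW e0)// lerDl.
exists (eps + K) => n; apply: (@le_trans _ _ (eps / (C+1) * (\sum_(0 <= l < n) `|v l|) + K)).
  apply: (le_trans (ler_norm_sum _ _ _)).
  rewrite mulr_sumr; elim: n => [|n IH].
    by rewrite !big_geq// add0r.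
  rewrite !big_nat_recr//=; have [nN|Nn] := ltnP n N.
    rewrite -big_nat_recr//=; apply: (@le_trans _ _ K); last first.
      rewrite lerDr addr_ge0//; last by rewrite mulr_ge0// ltW.
      by apply: sumr_ge0 => i _; rewrite mulr_ge0// ltW.
    rewrite /K (@big_cat_nat _ _ _ n.+1 0 N)//=.
    by rewrite lerDl; apply: sumr_ge0.
  rewrite addrAC; apply: lerD => //.
  by rewrite normrM ler_wpM2r// hN.
apply: (@le_trans _ _ (eps / (C + 1) * (C * n.+1%:R) + K)).
  by rewrite lerD2r ler_wpM2l// ltW.
rewrite addrA lerD2r mulrA -natr1 -{3}[eps]mulr1 -mulrDr.
by rewrite ler_wpM2r// addr_ge0.
Qed.

Lemma sublinear_cesaro u : u @ \oo --> (0 : R) ->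
  sublinear (fun n => \sum_(0 <= l < n) u l).
Proof.
move=> u0; apply: (@eq_sublinear (fun n => \sum_(0 <= l < n) u l * 1)).
  by move=> n; apply: eq_bigr => l _; rewrite mulr1.
apply: (@sublinear_weighted _ _ 1) => // n.
under eq_bigr do rewrite normr1.
by rewrite sumr_const_nat subn0 mul1r ler_nat.
Qed.

Lemma sublinear_cvg u : sublinear u -> (u n / n%:R) @[n --> \oo] --> (0 : R).
Proof.
move=> hu; apply/cvgrPdist_le => eps e0.
have e20 : 0 < eps / 2 by rewrite divr_gt0.
have [C hC] := hu _ e20.
near=> n; rewrite sub0r normrN normrM normfV (ger0_norm (ler0n _ _)).
have n0 : 0 < n%:R :> R by rewrite ltr0n; near: n; exact: nbhs_infty_gt.
rewrite ler_pdivrMr//; apply: (le_trans (hC n)).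
have : C <= eps / 2 * n%:R.
  rewrite mulrC -ler_pdivrMr//; near: n; exact: nbhs_infty_ger.
lra.
Unshelve. all: by end_near. Qed.

(** Abel summation turns the weighted sum into the weighted increments of the
    remainders of the series, which are uniformly small from some rank on.
    Bounded and divergent weights are treated alike. *)
Lemma kronecker_le w x : {homo w : n k / (n <= k)%N >-> n <= k} -> 0 <= w 0%N ->
  cvgn (series x) -> forall eps : R, 0 < eps -> exists C : R, forall n,
    `|\sum_(0 <= l < n) w l.+1 * x l| <= eps * w n + C.
Proof.
move=> hw w0 cx eps e0; have e20 : 0 < eps / 2 by rewrite divr_gt0.
have w_ge0 n : 0 <= w n by apply: (le_trans w0); exact: hw.
have [N hN] : exists N, forall n, (N <= n)%N -> `|series x n - series x N| <= eps / 2.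
  move/cvgrPdist_le : cx => /(_ (eps / 4)) []; first by rewrite divr_gt0.
  move=> N _ hN; exists N => n Nn; have h1 := hN _ Nn; have h2 := hN _ (leqnn N).
  move: h1 h2 => /=; set l := lim _ => h1 h2.
  rewrite -(subrKA l); apply: (le_trans (ler_normD _ _)).
  by rewrite (distrC (series x n)); move: h1 h2; lra.
pose Z n := series x n - series x N.
have part n : (N <= n)%N ->
    `|w n * Z n - \sum_(N <= l < n) w l.+1 * x l| <= eps / 2 * (w n - w N).
  move=> /subnKC <-; elim: (n - N)%N => [|k IH].
    by rewrite addn0 /Z subrr mulr0 big_geq// subr0 normr0 subrr mulr0.
  rewrite addnS big_nat_recr ?leq_addr//=.
  have -> : w (N + k).+1 * Z (N + k).+1 -
      (\sum_(N <= l < N + k) w l.+1 * x l + w (N + k).+1 * x (N + k)%N) =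
      (w (N + k)%N * Z (N + k)%N - \sum_(N <= l < N + k) w l.+1 * x l)
      + (w (N + k).+1 - w (N + k)%N) * Z (N + k)%N.
    by rewrite /Z /series/= big_nat_recr//=; ring.
  apply: (le_trans (ler_normD _ _)).
  have dw : 0 <= w (N + k).+1 - w (N + k)%N by rewrite subr_ge0 hw.
  have : `|(w (N + k).+1 - w (N + k)%N) * Z (N + k)%N| <=
      (w (N + k).+1 - w (N + k)%N) * (eps / 2).
    by rewrite normrM (ger0_norm dw) ler_wpM2l// hN// leq_addr.
  by move: IH; lra.
exists (\sum_(0 <= l < N) `|w l.+1 * x l|) => n.
have ew : 0 <= eps * w n by rewrite mulr_ge0// ltW.
have [nN|Nn] := ltnP n N.
  apply: (le_trans (ler_norm_sum _ _ _)).
  rewrite (@big_cat_nat _ _ _ n 0 N _ _ _ (ltnW nN))//= -[leLHS]add0r.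
  rewrite lerD// lerDl; exact: sumr_ge0.
rewrite (@big_cat_nat _ _ _ N 0 n)//= addrC.
apply: (le_trans (ler_normD _ _)); rewrite lerD//; last exact: ler_norm_sum.
have := part _ Nn; have : `|w n * Z n| <= w n * (eps / 2).
  by rewrite normrM (ger0_norm (w_ge0 n)) ler_wpM2l// hN.
have : 0 <= eps / 2 * w N by rewrite mulr_ge0// ltW.
rewrite -[X in _ -> _ -> _ -> `|X| <= _](subKr (w n * Z n)).
move=> h1 h2 h3; apply: (le_trans (ler_normB _ _)); move: h1 h2 h3; lra.
Qed.

Lemma cvg0_contraction (r : R) u v : 0 <= r < 1 -> (forall n, 0 <= u n) ->
  v @ \oo --> (0 : R) -> (\forall n \near \oo, u n.+1 <= r * u n + v n) ->
  u @ \oo --> (0 : R).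
Proof.
move=> /andP[r0 r1] u0 v0 [N0 _ huv]; apply/cvgrPdist_le => eps e0.
have r10 : 0 < 1 - r by rewrite subr_gt0.
have [N1 hN1] := cvg0_eps v0 (mulr_gt0 (divr_gt0 e0 (ltr0n R 2)) r10).
pose N := maxn N0 N1.
have hu k : u (N + k)%N <= eps / 2 + r ^+ k * u N.
  elim: k => [|k IH]; first by rewrite addn0 expr0 mul1r lerDr divr_ge0// ltW.
  rewrite addnS; apply: (le_trans (huv _ _)) => /=.
    by rewrite (leq_trans (leq_maxl _ _) (leq_addr _ _)).
  have h1 : v (N + k)%N <= eps / 2 * (1 - r).
    apply: (le_trans (ler_norm _)); apply: hN1.
    by rewrite (leq_trans (leq_maxr _ _) (leq_addr _ _)).
  have h2 := ler_wpM2l r0 IH; rewrite exprS; move: h1 h2; lra.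
have : (fun k => r ^+ k * u N) @ \oo --> (0 : R).
  rewrite -(mul0r (u N)); apply: cvgM; last exact: cvg_cst.
  by apply: cvg_expr; rewrite ger0_norm.
move=> /cvg0_eps /(_ _ (divr_gt0 e0 (ltr0n R 2))) [K hK].
exists (N + K)%N => // n /= Nn; rewrite sub0r normrN ger0_norm//.
have -> : n = (N + (n - N))%N by rewrite subnKC// (leq_trans (leq_addr _ _) Nn).
apply: (le_trans (hu _)).
have : r ^+ (n - N) * u N <= eps / 2.
  by apply: (le_trans (ler_norm _)); apply: hK; rewrite leq_subRL// (leq_trans (leq_addr _ _) Nn).
lra.
Qed.

(** The distance to the fixed point [b / (1 - a)] is contracted up to a vanishing
    error. *)
Lemma cvg_affine_recursion (a b : R) u v x : `|a| < 1 ->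
  u @ \oo --> a -> v @ \oo --> b ->
  (\forall n \near \oo, x n.+1 = u n * x n + v n) ->
  x @ \oo --> b / (1 - a).
Proof.
move=> a1 ua vb hx; pose l := b / (1 - a).
have a10 : 1 - a != 0.
  by rewrite subr_eq0 eq_sym lt_eqF// (le_lt_trans (ler_norm _) a1).
suff : (fun n => `|x n - l|) @ \oo --> (0 : R).
  by move=> /norm_cvg0P h; apply/subr_cvg0.
pose r := (1 + `|a|) / 2.
have ra : `|a| < r by rewrite /r; lra.
have r1 : r < 1 by rewrite /r; lra.
have r0 : 0 <= r by apply: (le_trans (normr_ge0 a)); exact: ltW.
apply: (@cvg0_contraction r _ (fun n => `|v n + (u n - 1) * l|)) => //.
- by rewrite r0.
- rewrite -(@normr0 _ R); apply: cvg_norm.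
  have -> : 0 = b + (a - 1) * l by rewrite /l; field.
  by apply: cvgD => //; apply: cvgM; [apply: cvgB => //; exact: cvg_cst|exact: cvg_cst].
- have nu : \forall n \near \oo, `|u n| <= r.
    have : (fun n => `|u n|) @ \oo --> `|a| by exact: cvg_norm.
    by move=> /cvgr_le; apply.
  near=> n; have hxn : x n.+1 = u n * x n + v n by near: n.
  have -> : x n.+1 - l = u n * (x n - l) + (v n + (u n - 1) * l).
    by rewrite hxn; ring.
  apply: (le_trans (ler_normD _ _)); rewrite lerD2r normrM ler_wpM2r//.
  by near: n.
Unshelve. all: by end_near. Qed.

Lemma normalised_product_le (a b t : R) : 0 < t ->
  `|a * b / t| <= (a ^+ 2 / t + b ^+ 2 / t) / 2.
Proof.
move=> t0; rewrite normrM (gtr0_norm (x := t^-1)) ?invr_gt0// -mulrDl mulrAC.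
rewrite ler_wpM2r ?invr_ge0 ?(ltW t0)// ler_pdivlMr// normrM.
have := sqr_ge0 (`|a| - `|b|).
rewrite -[a ^+ 2]real_normK ?num_real// -[b ^+ 2]real_normK ?num_real//.
by rewrite sqrrB; lra.
Qed.

End sublinear_sequences.

(** * Pathwise estimates for normalised squares and products *)

Section pathwise.
Context {R : realType}.
Variables (t : nat -> R) (rho : R).
Hypothesis t_gt0 : forall n, 0 < t n.
Hypothesis t_nd : forall n, t n <= t n.+1.
Hypothesis rho1 : rho < 1.
Hypothesis t_rho : (fun n => t n / t n.+1) @ \oo --> rho.

Let r n := t n.-1 / t n.

Let r_ge0 n : 0 <= r n. Proof. by rewrite divr_ge0// ltW. Qed.

Let r_le1 n : r n <= 1.
Proof. by rewrite /r ler_pdivrMr// mul1r; case: n => [|n] //=. Qed.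

Let r_cvg : r @ \oo --> rho.
Proof. by rewrite -cvg_shiftS. Qed.

(** The normalisation being asymptotically geometric, the last increment is a
    fixed proportion of the sum, so that convergence passes to the increments. *)
Lemma bracket_incr_cvg (G : nat -> R) (gam : R) :
  (fun n => (\sum_(0 <= l < n) G l) / t n.-1) @ \oo --> gam ->
  (fun n => G n / t n) @ \oo --> (1 - rho) * gam.
Proof.
move=> hG; have hG1 := hG; rewrite -cvg_shiftS in hG1.
have -> : (fun n => G n / t n) = (fun n => (\sum_(0 <= l < n.+1) G l) / t n
    - r n * ((\sum_(0 <= l < n) G l) / t n.-1)).
  apply/funext => n; rewrite big_nat_recr//= /r.
  by field; rewrite !gt_eqF.
rewrite mulrBl mul1r; apply: cvgB => //; exact: cvgM.
Qed.

Lemma bounded_of_cvg (u : nat -> R) (l : R) : u @ \oo --> l ->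
  exists2 C : R, 0 <= C & forall n, `|u n| <= C.
Proof.
move=> hu; have /cvgr_norm_le /(_ (`|l| + 1)) [|N _ hN] := hu.
  by rewrite ltrDl.
exists (`|l| + 1 + \sum_(0 <= k < N) `|u k|).
  by rewrite !addr_ge0// sumr_ge0.
move=> n; have [nN|Nn] := ltnP n N; last first.
  by apply: (le_trans (hN _ Nn)); rewrite lerDl sumr_ge0.
rewrite (bigD1_seq n) ?iota_uniq ?mem_index_iota//= addrCA.
by rewrite lerDl !addr_ge0// sumr_ge0.
Qed.

(** The normalised square [s n = N n ^ 2 / t (n-1)] satisfies, with [D] the next
    increment of [N], the recursion [s (l+1) = r l * s l + 2 N l D / t l + D ^ 2 / t l]
    in which [r l] tends to [rho < 1].  Summed up, it bounds [s n] plus a multiple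
    of [\sum_(l < n) s l] by a linear term and the cross martingale.  The latter is
    of lower order than its quadratic variation, which is itself at most a
    multiple of [\sum_(l < n) s l], hence it is absorbed by the left-hand side. *)
Lemma normalised_square_bound (N v : nat -> R) (Cv : R) : N 0%N = 0 ->
  (forall n, `|v n| <= Cv * t n) ->
  sublinear (fun n => \sum_(0 <= l < n) ((N l.+1 - N l) ^+ 2 - v l) / t l) ->
  (forall eps : R, 0 < eps -> exists C : R, forall n,
    `|\sum_(0 <= l < n) N l * (N l.+1 - N l) / t l| <=
    eps * (1 + \sum_(0 <= l < n) N l ^+ 2 * `|v l| / t l ^+ 2) + C) ->
  exists C : R, forall n, N n ^+ 2 / t n.-1 <= C * n.+1%:R /\
    \sum_(0 <= l < n) N l ^+ 2 / t l.-1 <= C * n.+1%:R.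
Proof.
move=> N0 hv hK hB; pose s n := N n ^+ 2 / t n.-1.
have s_ge0 n : 0 <= s n by rewrite divr_ge0 ?sqr_ge0// ltW.
have Cv_ge0 : 0 <= Cv.
  by have := le_trans (normr_ge0 _) (hv 0%N); rewrite pmulr_lge0.
pose S n := \sum_(0 <= l < n) s l.
have S_ge0 n : 0 <= S n by apply: sumr_ge0 => i _; exact: s_ge0.
pose B n := \sum_(0 <= l < n) N l * (N l.+1 - N l) / t l.
pose K n := \sum_(0 <= l < n) ((N l.+1 - N l) ^+ 2 - v l) / t l.
have key n : s n + \sum_(0 <= l < n) (1 - r l) * s l =
    2 * B n + K n + \sum_(0 <= l < n) v l / t l.
  elim: n => [|n IH].
    by rewrite /B /K !big_geq// /s N0 expr0n/= mul0r mulr0 !addr0.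
  have -> : s n.+1 = r n * s n + 2 * (N n * (N n.+1 - N n) / t n) +
      ((N n.+1 - N n) ^+ 2 - v n) / t n + v n / t n.
    by rewrite /s /r /=; field; rewrite !gt_eqF.
  move: IH; rewrite /B /K !big_nat_recr//=; set A1 := \sum_(0 <= i < n) _.
  by set A2 := \sum_(0 <= i < n) _ => IH; lra.
(* Any constant strictly between 0 and [1 - rho] would do: from [L] on, each
   step of the recursion loses at least the proportion [c]. *)
pose c := (1 - rho) / 2.
have c0 : 0 < c by rewrite divr_gt0// subr_gt0.
have [L hL] : exists L, forall l, (L <= l)%N -> c <= 1 - r l.
  have /cvgr_le /(_ (rho + c)) [|L _ hL] := r_cvg; first by rewrite ltrDl.
  by exists L => l Ll; have := hL _ Ll; rewrite /c; lra.
have lowS n : c * S n - c * S L <= \sum_(0 <= l < n) (1 - r l) * s l.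
  have [nL|Ln] := leqP n L.
    apply: (@le_trans _ _ 0).
      rewrite subr_le0 ler_wpM2l ?(ltW c0)// /S (@big_cat_nat _ _ _ n 0 L)//=.
      by rewrite lerDl; apply: sumr_ge0 => i _; exact: s_ge0.
    by apply: sumr_ge0 => l _; rewrite mulr_ge0// subr_ge0.
  rewrite /S !(@big_cat_nat _ _ _ L 0 n) ?(ltnW Ln)//= mulrDr addrAC subrr add0r.
  apply: (@le_trans _ _ (\sum_(L <= i < n) (1 - r i) * s i)); last first.
    by rewrite lerDr; apply: sumr_ge0 => l _; rewrite mulr_ge0// subr_ge0.
  rewrite mulr_sumr big_nat_cond [leRHS]big_nat_cond.
  by apply: ler_sum => i; rewrite andbT => /andP[Li _]; rewrite ler_wpM2r// hL.
have vS n : \sum_(0 <= l < n) v l / t l <= Cv * n%:R.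
  elim: n => [|n IH]; first by rewrite big_geq// mulr0.
  rewrite big_nat_recr//= -natr1 mulrDr mulr1 lerD// ler_pdivrMr//.
  by apply: le_trans (hv n); exact: ler_norm.
have AS n : \sum_(0 <= l < n) N l ^+ 2 * `|v l| / t l ^+ 2 <= Cv * S n.
  rewrite /S mulr_sumr; apply: ler_sum => l _.
  apply: (@le_trans _ _ (N l ^+ 2 * (Cv * t l) / t l ^+ 2)).
    by rewrite ler_wpM2r ?invr_ge0 ?sqr_ge0// ler_wpM2l ?sqr_ge0.
  have -> : N l ^+ 2 * (Cv * t l) / t l ^+ 2 = Cv * (N l ^+ 2 / t l).
    by field; rewrite gt_eqF.
  rewrite ler_wpM2l// /s ler_wpM2l ?sqr_ge0// lef_pV2 ?posrE//.
  by case: l => //= l; exact: t_nd.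
(* With this precision the cross martingale costs at most half of the [c * S n]
   gained. *)
have e0 : 0 < c / (4 * (Cv + 1)).
  by rewrite divr_gt0// mulr_gt0// ltr_wpDl.
have [CB hCB] := hB _ e0.
have [CK hCK] := hK _ ltr01.
set e := c / (4 * (Cv + 1)) in e0 hCB.
have eCv : 2 * (e * Cv) <= c / 2.
  rewrite /e; have -> : c / 2 = 2 * (c / (4 * (Cv + 1)) * (Cv + 1)).
    by field; rewrite gt_eqF// ltr_wpDl.
  by rewrite ler_wpM2l// ler_wpM2l ?(ltW e0)// lerDl.
pose D := `|2 * e + 2 * CB + CK + c * S L| + 1 + Cv.
have main n : s n + c / 2 * S n <= D * n.+1%:R.
  have h1 := key n; have h2 := lowS n.
  have h3 : B n <= e * (1 + Cv * S n) + CB.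
    apply: (le_trans (ler_norm _)); apply: (le_trans (hCB n)).
    by rewrite lerD2r ler_wpM2l ?(ltW e0)// lerD2l.
  have h4 : K n <= n%:R + CK.
    by apply: (le_trans (ler_norm _)); rewrite -[n%:R]mul1r; exact: hCK.
  have h5 := vS n.
  have h6 : 2 * (e * Cv) * S n <= c / 2 * S n by rewrite ler_wpM2r.
  have h7 : (2 * e + 2 * CB + CK + c * S L) <= `|2 * e + 2 * CB + CK + c * S L| * n.+1%:R.
    apply: (le_trans (ler_norm _)); rewrite ler_peMr//.
    by rewrite -[leLHS]/(1%:R) ler_nat.
  have h8 : n%:R <= n.+1%:R :> R by rewrite ler_nat.
  have h9 := ler_wpM2l Cv_ge0 h8.
  have -> : D * n.+1%:R = `|2 * e + 2 * CB + CK + c * S L| * n.+1%:R + n.+1%:R + Cv * n.+1%:R.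
    by rewrite /D; ring.
  move: h1 h2 h3 h4 h5 h6 h7 h8 h9.
  set X := `|_| * n.+1%:R; set Y := \sum_(0 <= l < n) (1 - r l) * s l.
  set Z := \sum_(0 <= l < n) v l / t l; lra.
have D0 : 0 <= D by rewrite /D !addr_ge0.
exists (D + D / (c / 2)) => n; have h := main n.
have n0 : 0 <= n.+1%:R :> R by [].
have c20 : 0 < c / 2 by rewrite divr_gt0.
have hD : 0 <= D / (c / 2) * n.+1%:R by rewrite !mulr_ge0// ?invr_ge0 ltW.
have hD' : 0 <= D * n.+1%:R by rewrite mulr_ge0.
have hS : 0 <= c / 2 * S n by rewrite mulr_ge0// ltW.
rewrite -/(s n); split.
  by rewrite mulrDl; move: h hD hS; lra.
rewrite mulrDl -[leLHS]add0r lerD//.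
have -> : D / (c / 2) * n.+1%:R = D * n.+1%:R / (c / 2) by rewrite mulrAC.
rewrite ler_pdivlMr// mulrC; apply: le_trans h.
by rewrite lerDr.
Qed.

(** The recursion of [normalised_square_bound] for a product of two sequences.
    When the squares, hence also the boundary term, are sublinear, its sum reads
    [(1 - rho) \sum_(l < n) s l = \sum_(l < n) v l / t l + o(n)]. *)
Lemma normalised_product_average (N N' v v1 v2 : nat -> R) (gam Cv C : R) :
  N 0%N = 0 ->
  (forall n, `|v1 n| <= Cv * t n) -> (forall n, `|v2 n| <= Cv * t n) ->
  (forall n, \sum_(0 <= l < n) N l ^+ 2 / t l.-1 <= C * n.+1%:R) ->
  (forall n, \sum_(0 <= l < n) N' l ^+ 2 / t l.-1 <= C * n.+1%:R) ->
  sublinear (fun n => N n ^+ 2 / t n.-1) ->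
  sublinear (fun n => N' n ^+ 2 / t n.-1) ->
  (fun n => v n / t n) @ \oo --> (1 - rho) * gam ->
  sublinear (fun n => \sum_(0 <= l < n)
     ((N l.+1 - N l) * (N' l.+1 - N' l) - v l) / t l) ->
  (forall eps : R, 0 < eps -> exists C : R, forall n,
    `|\sum_(0 <= l < n) N l * (N' l.+1 - N' l) / t l| <=
    eps * (1 + \sum_(0 <= l < n) N l ^+ 2 * `|v2 l| / t l ^+ 2) + C) ->
  (forall eps : R, 0 < eps -> exists C : R, forall n,
    `|\sum_(0 <= l < n) N' l * (N l.+1 - N l) / t l| <=
    eps * (1 + \sum_(0 <= l < n) N' l ^+ 2 * `|v1 l| / t l ^+ 2) + C) ->
  (forall n, \sum_(0 <= l < n) `|N l * N' l / t l.-1| <= C * n.+1%:R) /\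
  sublinear (fun n => \sum_(0 <= l < n) N l * N' l / t l.-1 - gam * n%:R).
Proof.
move=> N0 hv1 hv2 hS hS' hs hs' hv hK hB hB'.
have Cv_ge0 : 0 <= Cv.
  by have := le_trans (normr_ge0 _) (hv1 0%N); rewrite pmulr_lge0.
pose s n := N n * N' n / t n.-1.
have sle n : `|s n| <= (N n ^+ 2 / t n.-1 + N' n ^+ 2 / t n.-1) / 2.
  exact: normalised_product_le.
have sS n : \sum_(0 <= l < n) `|s l| <= C * n.+1%:R.
  apply: (le_trans (ler_sum _ (fun i _ => sle i))).
  rewrite -mulr_suml big_split/=; have := hS n; have := hS' n; lra.
split=> //.
have crossB (X v' : nat -> R) (Y : nat -> R) : (forall n, `|v' n| <= Cv * t n) ->
    (forall n, \sum_(0 <= l < n) X l ^+ 2 / t l.-1 <= C * n.+1%:R) ->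
    (forall eps : R, 0 < eps -> exists C : R, forall n,
    `|Y n| <= eps * (1 + \sum_(0 <= l < n) X l ^+ 2 * `|v' l| / t l ^+ 2) + C) ->
    sublinear Y.
  move=> hv' hX hY eps e0.
  have C0 : 0 <= C.
    by have := hX 0%N; rewrite big_geq// mulr1.
  have CC0 : 0 < Cv * C + 1 by rewrite ltr_wpDl// mulr_ge0.
  have e10 := divr_gt0 e0 CC0.
  have [D hD] := hY _ e10; set e1 := eps / _ in e10 hD.
  have e1eps : e1 * (Cv * C) <= eps.
    have -> : eps = e1 * (Cv * C + 1) by rewrite /e1 divfK// gt_eqF.
    by rewrite ler_wpM2l ?(ltW e10)// lerDl.
  exists (e1 + eps + D) => n; apply: (le_trans (hD n)).
  have h : \sum_(0 <= l < n) X l ^+ 2 * `|v' l| / t l ^+ 2 <= Cv * (C * n.+1%:R).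
    apply: (@le_trans _ _ (Cv * \sum_(0 <= l < n) X l ^+ 2 / t l.-1)); last first.
      by rewrite ler_wpM2l.
    rewrite mulr_sumr; apply: ler_sum => l _.
    apply: (@le_trans _ _ (X l ^+ 2 * (Cv * t l) / t l ^+ 2)).
      by rewrite ler_wpM2r ?invr_ge0 ?sqr_ge0// ler_wpM2l ?sqr_ge0.
    have -> : X l ^+ 2 * (Cv * t l) / t l ^+ 2 = Cv * (X l ^+ 2 / t l).
      by field; rewrite gt_eqF.
    rewrite ler_wpM2l// ler_wpM2l ?sqr_ge0// lef_pV2 ?posrE//.
    by case: l => //= l; exact: t_nd.
  have h2 : e1 * (1 + \sum_(0 <= l < n) X l ^+ 2 * `|v' l| / t l ^+ 2) <=
      e1 + e1 * (Cv * (C * n.+1%:R)).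
    by rewrite mulrDr mulr1 lerD2l ler_wpM2l// ltW.
  have h3 : e1 * (Cv * C) * n.+1%:R <= eps * n.+1%:R by rewrite ler_wpM2r.
  move: h2 h3; rewrite -natr1; set Q := \sum_(_ <= _ < _) _; lra.
have B1 := crossB _ _ _ hv2 hS hB.
have B2 := crossB _ _ _ hv1 hS' hB'.
have sub_s : sublinear s.
  move=> eps e0; have [C1 h1] := hs _ e0; have [C2 h2] := hs' _ e0.
  exists ((C1 + C2) / 2) => n; apply: (le_trans (sle n)).
  have := h1 n; have := h2 n; rewrite !ger0_norm ?divr_ge0 ?sqr_ge0 ?(ltW (t_gt0 _))//.
  move=> a1 a2; have : 0 <= N n ^+ 2 / t n.-1 by rewrite divr_ge0 ?sqr_ge0 ?(ltW (t_gt0 _)).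
  have : 0 <= N' n ^+ 2 / t n.-1 by rewrite divr_ge0 ?sqr_ge0 ?(ltW (t_gt0 _)).
  move: a1 a2; lra.
have vS : sublinear (fun n => \sum_(0 <= l < n) (v l / t l - (1 - rho) * gam)).
  apply: sublinear_cesaro; rewrite -(subrr ((1 - rho) * gam)).
  by apply: cvgB => //; exact: cvg_cst.
have rS : sublinear (fun n => \sum_(0 <= l < n) (r l - rho) * s l).
  apply: (@sublinear_weighted _ _ _ C) => //.
  by rewrite -(subrr rho); apply: cvgB => //; exact: cvg_cst.
have key n : s n + \sum_(0 <= l < n) (1 - r l) * s l =
    \sum_(0 <= l < n) N l * (N' l.+1 - N' l) / t l +
    \sum_(0 <= l < n) N' l * (N l.+1 - N l) / t l +
    \sum_(0 <= l < n) ((N l.+1 - N l) * (N' l.+1 - N' l) - v l) / t l +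
    \sum_(0 <= l < n) v l / t l.
  elim: n => [|n IH].
    by rewrite !big_geq// /s N0 !mul0r !addr0.
  have -> : s n.+1 = r n * s n + N n * (N' n.+1 - N' n) / t n +
      N' n * (N n.+1 - N n) / t n +
      ((N n.+1 - N n) * (N' n.+1 - N' n) - v n) / t n + v n / t n.
    by rewrite /s /r /=; field; rewrite !gt_eqF.
  move: IH; rewrite !big_nat_recr//=.
  set A1 := \sum_(0 <= i < n) _; set A2 := \sum_(0 <= i < n) _.
  set A3 := \sum_(0 <= i < n) _; set A4 := \sum_(0 <= i < n) _.
  set A5 := \sum_(0 <= i < n) _ => IH; lra.
have := sublinearZ ((1 - rho)^-1) (sublinearD (sublinearD (sublinearD (sublinearD
   (sublinearD B1 B2) hK) vS) rS) (sublinearZ (-1) sub_s)).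
apply: eq_sublinear => n.
have -> : \sum_(0 <= l < n) (v l / t l - (1 - rho) * gam) =
    \sum_(0 <= l < n) v l / t l - (1 - rho) * gam * n%:R.
  by rewrite sumrB sumr_const_nat subn0 mulr_natr.
have e1 : \sum_(0 <= l < n) (1 - r l) * s l = \sum_(0 <= l < n) (1 - rho) * s l
    - \sum_(0 <= l < n) (r l - rho) * s l.
  by rewrite -sumrB; apply: eq_bigr => l _; ring.
have r1 : 1 - rho != 0 by rewrite gt_eqF// subr_gt0.
move: (key n) e1; rewrite -mulr_sumr -/(s n).
set A1 := \sum_(0 <= i < n) _; set A2 := \sum_(0 <= i < n) _.
set A3 := \sum_(0 <= i < n) _; set A4 := \sum_(0 <= i < n) _.
set A5 := \sum_(0 <= i < n) _; set A6 := \sum_(0 <= i < n) _.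
set A7 := \sum_(0 <= i < n) _ => k1 k2.
apply: (mulfI r1); rewrite mulVKf//; move: k1 k2; lra.
Qed.

End pathwise.

(** * Borel-Cantelli *)

Section borel_cantelli.
Context {d : measure_display} {T : measurableType d} {R : realType}.
Variable P : probability T R.

Lemma borel_cantelli_ae (F : nat -> set T) (c : nat -> R) (B : R) :
  (forall n, measurable (F n)) -> (forall n, (P (F n) <= (c n)%:E)%E) ->
  (forall n, \sum_(0 <= k < n) c k <= B) ->
  {ae P, forall x, exists N, forall n, (N <= n)%N -> ~ F n x}.
Proof.
move=> mF Fc cB.
have h0 : P (lim_sup_set F) = 0%E.
  apply: lim_sup_set_cvg0 => //; apply: (@le_lt_trans _ _ B%:E); last exact: ltry.
  apply: lime_le; first exact: is_cvg_nneseries.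
  apply: nearW => n; apply: (@le_trans _ _ (\sum_(0 <= k < n) (c k)%:E)%E).
    by apply: lee_sum => k _; exact: Fc.
  by rewrite sumEFin lee_fin.
exists (lim_sup_set F); split => //.
  apply: bigcap_measurable => // k _.
  by apply: bigcup_measurable => j /= _; exact: mF.
move=> x /= hx n _ /=; apply: contra_notP hx => hx; exists n => k nk Fkx.
by apply: hx; exists k.
Qed.

End borel_cantelli.

(** * Generation sizes as functions of the offspring word *)

Section words.
Context {R : realType}.
Variable w : bool * bool -> R.
Hypothesis w_ge0 : forall b, 0 <= w b.
Hypothesis w_sum1 : \sum_b w b = 1.

(** The offspring indicators of all individuals, the individual [k] standing at
    the place [k]. *)
Definition word := nat -> bool * bool.

Definition upd (v : word) (k : nat) (b : bool * bool) : word :=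
  fun j => if j == k then b else v j.

(** The expectation when the places 1 to [N] are filled independently with the law
    [w].  All events of interest depend on finitely many places, and an iterated
    finite sum then replaces the product measure. *)
Fixpoint wexp (N : nat) (f : word -> R) : R :=
  if N is N'.+1 then wexp N' (fun v => \sum_b w b * f (upd v N b))
  else f (fun=> (false, false)).

Lemma ler_wexp N f g : (forall v, f v <= g v) -> wexp N f <= wexp N g.
Proof.
elim: N f g => [|N IH] f g fg //=; apply: IH => v.
by apply: ler_sum => b _; rewrite ler_wpM2l.
Qed.

Lemma wexpD N f g : wexp N (fun v => f v + g v) = wexp N f + wexp N g.
Proof.
elim: N f g => [|N IH] f g //=; rewrite -IH; congr wexp; apply/funext => v.
by rewrite -big_split/=; apply: eq_bigr => b _; rewrite mulrDr.
Qed.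

Lemma wexpZ N k f : wexp N (fun v => k * f v) = k * wexp N f.
Proof.
elim: N f => [|N IH] f //=; rewrite -IH; congr wexp; apply/funext => v.
by rewrite mulr_sumr; apply: eq_bigr => b _; rewrite mulrCA.
Qed.

Lemma wexp_cst N k : wexp N (fun=> k) = k.
Proof.
by elim: N k => [|N IH] k //=; rewrite -mulr_suml w_sum1 mul1r.
Qed.

Definition bit (odd : bool) (b : bool * bool) : bool := if odd then b.2 else b.1.

(** [alive n v k] is meant for [k] in the [n]-th generation; the generation
    number is the fuel of the recursion towards the root. *)
Fixpoint alive (n : nat) (v : word) (k : nat) : bool :=
  if n is n'.+1 then alive n' v k./2 && bit (odd k) (v k./2) else true.

Lemma alive_upd n v k j b : (k < 2 ^ n.+1)%N -> (2 ^ n <= j)%N ->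
  alive n (upd v j b) k = alive n v k.
Proof.
elim: n k j => [|n IH] k j //= kn nj.
have kn' : (k./2 < 2 ^ n.+1)%N by rewrite ltn_half_double -mul2n -expnS.
rewrite IH//; last by rewrite (leq_trans _ nj)// leq_exp2l.
by rewrite /upd ltn_eqF// (leq_trans kn' nj).
Qed.

Definition gsize (n : nat) (v : word) : nat :=
  \sum_(i < 2 ^ n) alive n v (2 ^ n + i).

Lemma sum_ord_double N (F : nat -> nat) :
  (\sum_(i < N.*2) F i = \sum_(i < N) (F i.*2 + F i.*2.+1))%N.
Proof.
elim: N => [|N IH]; first by rewrite !big_ord0.
by rewrite doubleS !big_ord_recr/= IH addnA.
Qed.

Lemma gsizeS n v : gsize n.+1 v = (\sum_(i < 2 ^ n)
  if alive n v (2 ^ n + i) then (v (2 ^ n + i)).1 + (v (2 ^ n + i)).2 else 0)%N.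
Proof.
rewrite /gsize expnS mul2n (sum_ord_double _ (fun i => alive n.+1 v ((2 ^ n).*2 + i))).
apply: eq_bigr => i _ /=.
have e1 : ((2 ^ n).*2 + i.*2 = (2 ^ n + i).*2)%N by rewrite doubleD.
rewrite addnS e1 /= !odd_double /= doubleK uphalf_double.
by case: alive => //=; case: (v _) => [[] []].
Qed.

Definition depends_below (m : nat) (Y : word -> R) :=
  forall v k b, (m <= k)%N -> Y (upd v k b) = Y v.

Lemma gsize_upd n v k b : (2 ^ n <= k)%N -> gsize n (upd v k b) = gsize n v.
Proof.
move=> nk; apply: eq_bigr => i _; rewrite alive_upd//.
by rewrite expnS mul2n -addnn ltn_add2l.
Qed.

(** Who is alive in generation [n] is decided by the places before [2 ^ n], so the
    offspring of that generation can be integrated out, one individual at a time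
    starting from the last one, each living individual giving one factor. *)
Lemma wexp_layer n j (Y : word -> R) (psi : bool * bool -> R) :
  (j <= 2 ^ n)%N -> depends_below (2 ^ n) Y ->
  wexp ((2 ^ n).-1 + j) (fun v => Y v *
    \prod_(i < j) if alive n v (2 ^ n + i) then psi (v (2 ^ n + i)%N) else 1) =
  wexp (2 ^ n).-1 (fun v => Y v *
    \prod_(i < j) if alive n v (2 ^ n + i) then \sum_b w b * psi b else 1).
Proof.
elim: j Y => [|j IH] Y jn hY.
  by rewrite addn0; congr wexp; apply/funext => v; rewrite !big_ord0.
have e : ((2 ^ n).-1 + j.+1 = (2 ^ n + j).-1.+1)%N.
  by rewrite addnS -[in RHS](prednK (n := 2 ^ n)) ?expn_gt0.
have e2 : ((2 ^ n + j).-1 = (2 ^ n).-1 + j)%N.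
  by rewrite -[in LHS](prednK (n := 2 ^ n)) ?expn_gt0.
have e3 : ((2 ^ n + j).-1.+1 = 2 ^ n + j)%N by rewrite prednK// addn_gt0 expn_gt0.
have lt i : (i < 2 ^ n -> 2 ^ n + i < 2 ^ n.+1)%N.
  by rewrite expnS mul2n -addnn ltn_add2l.
rewrite e /= e3 e2.
pose c := \sum_b w b * psi b.
pose Y' v := Y v * (if alive n v (2 ^ n + j) then c else 1).
transitivity (wexp ((2 ^ n).-1 + j) (fun v => Y' v *
    \prod_(i < j) if alive n v (2 ^ n + i) then psi (v (2 ^ n + i)%N) else 1)).
  congr wexp; apply/funext => v.
  under eq_bigr => b _.
    rewrite hY ?leq_addr// big_ord_recr/= alive_upd ?leq_addr ?lt//.
    rewrite (_ : upd v (2 ^ n + j) b (2 ^ n + j)%N = b); last by rewrite /upd eqxx.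
    under eq_bigr => i _.
      rewrite alive_upd ?leq_addr ?lt//; last exact: ltn_trans jn.
      rewrite (_ : upd v (2 ^ n + j) b (2 ^ n + i)%N = v (2 ^ n + i)%N); last first.
        by rewrite /upd eqn_add2l (ltn_eqF (ltn_ord i)).
      over.
    over.
  rewrite /Y' /c; case: (alive n v (2 ^ n + j)).
    rewrite mulr_sumr mulr_suml; apply: eq_bigr => b _; ring.
  by rewrite -mulr_suml w_sum1 !mulr1 mul1r.
rewrite IH; last 2 first.
- exact: ltnW.
- by move=> v k b nk; rewrite /Y' hY// alive_upd// lt.
congr wexp; apply/funext => v; rewrite big_ord_recr/= /Y' /c -!mulrA.
by congr (_ * _); exact: mulrC.
Qed.

Definition offspring_pgf (s : R) : R := \sum_b w b * s ^+ (b.1 + b.2).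

(** The first [2 ^ n - 1] places are those on which generation [n] depends. *)
Definition gexp (n : nat) (f : word -> R) : R := wexp (2 ^ n).-1 f.

(** The branching property, in the form of the recursion for generating
    functions with a weight that is known in generation [n]. *)
Lemma gexpS n (Y : word -> R) (s : R) : depends_below (2 ^ n) Y ->
  gexp n.+1 (fun v => Y v * s ^+ gsize n.+1 v) =
  gexp n (fun v => Y v * offspring_pgf s ^+ gsize n v).
Proof.
move=> hY.
have e : ((2 ^ n.+1).-1 = (2 ^ n).-1 + 2 ^ n)%N.
  by rewrite expnS mul2n -addnn -{1}(prednK (n := 2 ^ n)) ?expn_gt0.
have := wexp_layer (fun b => s ^+ (b.1 + b.2)) (leqnn (2 ^ n)) hY.
rewrite -e -/(offspring_pgf s) /gexp => h.
transitivity (wexp (2 ^ n.+1).-1 (fun v => Y v * \prod_(i < 2 ^ n)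
    if alive n v (2 ^ n + i) then s ^+ ((v (2 ^ n + i)%N).1 + (v (2 ^ n + i)%N).2) else 1)).
  congr wexp; apply/funext => v; congr (_ * _); rewrite gsizeS.
  rewrite -prodrXr; apply: eq_bigr => i _; by case: ifP.
rewrite h; congr wexp; apply/funext => v; congr (_ * _).
rewrite -prodrXr; apply: eq_bigr => i _; by case: ifP.
Qed.

Lemma gexp_pgf n (s : R) : gexp n (fun v => s ^+ gsize n v) = iter n offspring_pgf s.
Proof.
elim: n s => [|n IH] s.
  by rewrite /gexp/= /gsize big_ord_recl big_ord0 /= expr1.
have := @gexpS n (fun=> 1) s; rewrite (_ : (fun v => 1 * _) = fun v => s ^+ gsize n.+1 v); last first.
  by apply/funext => v; rewrite mul1r.
move=> -> //; rewrite iterSr -IH; congr gexp; apply/funext => v; by rewrite mul1r.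
Qed.

Lemma sum_bool2 (V : nmodType) (F : bool * bool -> V) :
  \sum_b F b = F (true, true) + F (true, false) + (F (false, true) + F (false, false)).
Proof.
transitivity (\sum_a \sum_b F (a, b)); last by rewrite !big_bool.
by rewrite pair_bigA; apply: eq_bigr => -[].
Qed.

Let w00 := w (false, false).
Let w1 := w (true, false) + w (false, true).
Let w11 := w (true, true).
Let m := 2 * w11 + w1.
Hypothesis m_gt1 : 1 < m.

Let w1_ge0 : 0 <= w1. Proof. by rewrite addr_ge0. Qed.

Let w00_ge0 : 0 <= w00. Proof. exact: w_ge0. Qed.

Let wE : w11 + w1 + w00 = 1.
Proof. by have := w_sum1; rewrite sum_bool2 /w11 /w1 /w00 => <-; ring. Qed.

Let mE : m = 1 + w11 - w00. Proof. by rewrite /m; move: wE; lra. Qed.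

Let w11_gt0 : 0 < w11. Proof. by move: m_gt1 (w_ge0 (false, false)); rewrite mE -/w00; lra. Qed.

Lemma offspring_pgfE s : offspring_pgf s = w00 + w1 * s + w11 * s ^+ 2.
Proof. by rewrite /offspring_pgf sum_bool2 /= expr0 expr1 /w00 /w1 /w11; ring. Qed.

Let q := w00 / w11.

Let q_ge0 : 0 <= q. Proof. by rewrite divr_ge0// ltW. Qed.

Let w00E : w00 = q * w11. Proof. by rewrite /q divfK// gt_eqF. Qed.

(** The left-hand side is the difference of the [n]-th iterates of the generating
    function started from [u] and from [0].  The iterates from [0] stay below the
    extinction probability [q], those from [u] below [u], and for [a <= q] and
    [b <= u] the difference quotient [w1 + w11 * (a + b)] of the generating
    function is at most [w1 + w11 * (q + u) = 1 - w11 * (1 - u) < 1]. *)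
Lemma pgf_alive_le (u : R) n : q <= u < 1 ->
  gexp n (fun v => (0 < gsize n v)%N%:R * u ^+ gsize n v) <=
  (1 - w11 * (1 - u)) ^+ n.
Proof.
move=> /andP[qu u1]; have u0 : 0 <= u by exact: le_trans q_ge0 qu.
have k0 : 0 <= 1 - w11 * (1 - u).
  have : w11 <= 1 by move: wE w1_ge0 (w_ge0 (false, false)); rewrite -/w00; lra.
  move=> w111; rewrite subr_ge0 mulr_ile1// ?(ltW w11_gt0)// ?subr_ge0 ?(ltW u1)//.
  by rewrite gerBl.
have iter0 k : 0 <= iter k offspring_pgf 0 <= q.
  elim: k => [|k /andP[a0 aq]] /=; first by rewrite lexx q_ge0.
  rewrite offspring_pgfE; apply/andP; split.
    by rewrite !addr_ge0 ?mulr_ge0 ?exprn_ge0 ?(ltW w11_gt0)// w_ge0.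
  have h1 : w1 * iter k offspring_pgf 0 <= w1 * q by rewrite ler_wpM2l.
  have h2 : w11 * iter k offspring_pgf 0 ^+ 2 <= w11 * q ^+ 2.
    by rewrite ler_wpM2l ?(ltW w11_gt0)// ler_sqr ?nnegrE.
  have h3 : w00 + w1 * q + w11 * q ^+ 2 = q.
    have -> : w1 = 1 - w11 - w00 by move: wE; lra.
    by rewrite w00E; ring.
  move: h1 h2 h3; lra.
have iteru k : 0 <= iter k offspring_pgf u <= u.
  elim: k => [|k /andP[a0 aq]] /=; first by rewrite lexx u0.
  rewrite offspring_pgfE; apply/andP; split.
    by rewrite !addr_ge0 ?mulr_ge0 ?exprn_ge0 ?(ltW w11_gt0)// w_ge0.
  have h1 : w1 * iter k offspring_pgf u <= w1 * u by rewrite ler_wpM2l.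
  have h2 : w11 * iter k offspring_pgf u ^+ 2 <= w11 * u ^+ 2.
    by rewrite ler_wpM2l ?(ltW w11_gt0)// ler_sqr ?nnegrE.
  have h3 : w00 + w1 * u + w11 * u ^+ 2 = u - w11 * (u - q) * (1 - u).
    have -> : w1 = 1 - w11 - w00 by move: wE; lra.
    by rewrite w00E; ring.
  have h4 : 0 <= w11 * (u - q) * (1 - u).
    by rewrite !mulr_ge0 ?subr_ge0 ?(ltW u1) ?(ltW w11_gt0).
  move: h1 h2 h3 h4; lra.
have -> : (fun v => (0 < gsize n v)%N%:R * u ^+ gsize n v) =
    (fun v => u ^+ gsize n v + (-1) * 0 ^+ gsize n v).
  apply/funext => v; rewrite expr0n; case: (gsize n v) => [|k] /=.
    by rewrite !expr0; ring.
  by rewrite mulr0 addr0 mul1r.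
rewrite /gexp wexpD wexpZ -!/(gexp _ _) !gexp_pgf mulN1r.
elim: n => [|n IH]; first by rewrite expr0 /= subr0 ltW.
rewrite !iterS !offspring_pgfE.
have /andP[a0 aq] := iter0 n; have /andP[b0 bu] := iteru n.
move: a0 aq b0 bu IH; set a := iter n offspring_pgf 0; set b := iter n offspring_pgf u => a0 aq b0 bu IH.
have -> : w00 + w1 * b + w11 * b ^+ 2 - (w00 + w1 * a + w11 * a ^+ 2) =
    (w1 + w11 * (a + b)) * (b - a) by ring.
have h1 : w1 + w11 * (a + b) <= 1 - w11 * (1 - u).
  have : w11 * (a + b) <= w11 * (q + u) by rewrite ler_wpM2l ?(ltW w11_gt0)// lerD.
  by move: wE w00E; lra.
have h2 : 0 <= w1 + w11 * (a + b) by rewrite addr_ge0// mulr_ge0 ?addr_ge0 ?(ltW w11_gt0).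
have [ab|ab] := leP 0 (b - a); first by rewrite exprS; exact: ler_pM.
by apply: (@le_trans _ _ 0); [rewrite nmulr_lle0|rewrite exprn_ge0].
Qed.

Lemma expR_le_quadratic (x : R) : x <= 2^-1 -> expR x <= 1 + x + 2 * x ^+ 2.
Proof.
move=> x2; have x1 : 0 < 1 - x by rewrite subr_gt0 (le_lt_trans x2)// invf_lt1 ?ltr1n.
have : expR x <= (1 - x)^-1.
  by rewrite -[x in expR x]opprK expRN lef_pV2 ?posrE ?expR_gt0// expR_ge1Dx.
move/le_trans; apply; rewrite -[leLHS]mul1r ler_pdivrMr//.
rewrite -subr_ge0 (_ : _ - _ = x ^+ 2 * (1 - 2 * x)); last by ring.
by rewrite mulr_ge0 ?sqr_ge0// subr_ge0 mulrC -ler_pdivlMr// mul1r.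
Qed.

Lemma offspring_pgf_exp_le (l : R) : l <= 4^-1 ->
  offspring_pgf (expR l) <= expR (m * l + 8 * l ^+ 2).
Proof.
move=> l4; apply: le_trans (expR_ge1Dx _); rewrite offspring_pgfE -expRM_natl mulr_natl.
have h1 : expR l <= 1 + l + 2 * l ^+ 2 by apply: expR_le_quadratic; move: l4; lra.
have h2 : expR (l *+ 2) <= 1 + (l *+ 2) + 2 * (l *+ 2) ^+ 2.
  by apply: expR_le_quadratic; move: l4; lra.
have h3 := ler_wpM2l w1_ge0 h1.
have h4 := ler_wpM2l (ltW w11_gt0) h2.
have h5 : 0 <= w1 * l ^+ 2 by rewrite mulr_ge0 ?sqr_ge0.
have h6 : 0 <= w00 * l ^+ 2 by rewrite mulr_ge0 ?sqr_ge0.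
have h7 : (w11 + w1 + w00) * l ^+ 2 = l ^+ 2 by rewrite wE mul1r.
have h8 : (2 * w11 + w1) * l = m * l by [].
move: h3 h4 h5 h6 h7 h8 wE; rewrite -mulr_natl; nra.
Qed.

(** The exponential Markov inequality given the first [n] generations; the sign of
    [l] selects the upper or the lower deviations. *)
Lemma chernoff_gsize n (l eps thr : R) : l <= 4^-1 ->
  gexp n.+1 (fun v => [&& (0 < gsize n v)%N, thr <= (gsize n v)%:R &
      `|l| * eps * (gsize n v)%:R <= l * ((gsize n.+1 v)%:R - m * (gsize n v)%:R)]%:R) <=
  gexp n (fun v => ((0 < gsize n v)%N && (thr <= (gsize n v)%:R))%:R *
      expR (8 * l ^+ 2 - `|l| * eps) ^+ gsize n v).
Proof.
move=> l4; pose h := expR (- (m * l + `|l| * eps)).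
pose Y v := ((0 < gsize n v)%N && (thr <= (gsize n v)%:R))%:R * h ^+ gsize n v.
have hY : depends_below (2 ^ n) Y by move=> v k b nk; rewrite /Y gsize_upd.
apply: (@le_trans _ _ (gexp n.+1 (fun v => Y v * expR l ^+ gsize n.+1 v))).
  apply: ler_wexp => v; rewrite /Y; case: ltnP => //= _; last first.
    by rewrite mul0r mul0r.
  case: (boolP (thr <= _)) => _ /=; last by rewrite !mul0r.
  rewrite mul1r /h -!expRM_natl -expRD.
  case: (boolP (_ <= l * _)) => hl /=; last exact: expR_ge0.
  rewrite -[X in X <= _]expR0 ler_expR.
  rewrite -subr_ge0 in hl; apply: le_trans hl _; rewrite le_eqVlt; apply/orP; left.
  by apply/eqP; ring.
rewrite gexpS//; apply: ler_wexp => v; rewrite /Y -mulrA ler_wpM2l//.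
rewrite -exprMn; apply: lerXn2r; rewrite ?nnegrE ?expR_ge0//.
  rewrite mulr_ge0 ?expR_ge0// offspring_pgfE.
  by rewrite !addr_ge0 ?mulr_ge0 ?exprn_ge0 ?expR_ge0 ?(ltW w11_gt0)// w_ge0.
apply: (le_trans (ler_wpM2l (expR_ge0 _) (offspring_pgf_exp_le l4))).
by rewrite -expRD ler_expR; lra.
Qed.

Lemma gsize_deviation n (eps thr : R) : 0 < eps <= 1 ->
  gexp n.+1 (fun v => [&& (0 < gsize n v)%N, thr <= (gsize n v)%:R &
      eps * (gsize n v)%:R <= `|(gsize n.+1 v)%:R - m * (gsize n v)%:R|]%:R) <=
  2 * gexp n (fun v => ((0 < gsize n v)%N && (thr <= (gsize n v)%:R))%:R *
      expR (- (eps ^+ 2 / 32)) ^+ gsize n v).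
Proof.
move=> /andP[e0 e1].
(* [8 * l ^ 2 - l * eps] is minimal at [l = eps / 16], with value
   [- eps ^ 2 / 32]. *)
have e16 : `|eps / 16| = eps / 16 by rewrite ger0_norm// divr_ge0// ltW.
have l1 : eps / 16 <= 4^-1 by move: e1; lra.
have l2 : - (eps / 16) <= 4^-1 by move: e0; lra.
have := lerD (chernoff_gsize n eps thr l1) (chernoff_gsize n eps thr l2).
have ex : 8 * (eps / 16) ^+ 2 - eps / 16 * eps = - (eps ^+ 2 / 32) by field.
rewrite sqrrN normrN e16 ex -[leRHS]mulr2n mulr_natl; apply: le_trans.
rewrite /gexp -wexpD; apply: ler_wexp => v.
set g := (gsize n v)%:R; set g' := (gsize n.+1 v)%:R.
case: ltnP => //= _; last by rewrite addr0.
case: (boolP (thr <= g)) => _ /=; last by rewrite addr0.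
have e160 : 0 < eps / 16 by rewrite divr_gt0.
case: (boolP (eps * g <= _)) => /=; last by rewrite addr_ge0.
have i1 (y : R) : (eps / 16 * eps * g <= eps / 16 * y) = (eps * g <= y).
  by rewrite -mulrA ler_pM2l.
rewrite mulNr -mulrN !i1.
have [h|h] := leP 0 (g' - m * g).
  by rewrite ger0_norm// => ->; rewrite lerDl.
by rewrite ltr0_norm// => ->; rewrite lerDr.
Qed.

End words.

(** * The law of the observed tree *)

Section word_probability.
Context {d : measure_display} {T : measurableType d} {R : realType}.
Variables (P : probability T R) (p0 p1 p01 : R).
Variable xi : nat -> {mfun T >-> (bool * bool)%type}.
Hypothesis hxi : reproduction P p0 p1 p01 xi.

Definition law (b : bool * bool) : R := fine (P (xi 1%N @^-1` [set b])).

Lemma measurable_bool2 (B : set (bool * bool)) : measurable B.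
Proof.
have h b : measurable [set b : bool * bool].
  case: b => a b; rewrite (_ : [set (a, b)] = [set a] `*` [set b]).
    by apply: measurableX.
  by apply/seteqP; split => [[x y]/= [-> ->]|[x y] /= [-> ->]].
have -> : B = \big[setU/set0]_(b : bool * bool) (if b \in B then [set b] else set0).
  apply/seteqP; split => x.
    move=> Bx; rewrite -bigcup_seq; exists x => /=; first exact: mem_index_enum.
    by rewrite mem_set.
  rewrite -bigcup_seq => -[b /= _]; case: ifP => // /set_mem Bb -> //.
by apply: bigsetU_measurable => b _; case: ifP.
Qed.

Lemma lawE k b : (0 < k)%N -> fine (P (xi k @^-1` [set b])) = law b.
Proof.
move=> k0; have [_ h] := hxi; have [a1 a2 a3 a4] := h k k0.
have [b1 b2 b3 b4] := h 1%N isT; rewrite /law.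
by case: b => -[] []; rewrite ?a1 ?a2 ?a3 ?a4 ?b1 ?b2 ?b3 ?b4.
Qed.

Lemma measurable_xi k B : measurable (xi k @^-1` B).
Proof.
rewrite -[X in measurable X]setTI; apply: measurable_funP => //.
exact: measurable_bool2.
Qed.

Lemma law_ge0 b : 0 <= law b. Proof. exact: fine_ge0. Qed.

Lemma fine_measure_split (E : set T) (Y : T -> bool) : measurable E ->
  measurable (Y @^-1` [set true]) ->
  fine (P E) = fine (P (E `&` Y @^-1` [set true])) + fine (P (E `&` Y @^-1` [set false])).
Proof.
move=> mE mY; have e : Y @^-1` [set false] = ~` (Y @^-1` [set true]).
  by apply/seteqP; split => x /=; case: (Y x).
rewrite e -setDE (measureDI P mE mY) addeC fineD//.
- by apply: fin_num_measure; exact: measurableI.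
- by apply: fin_num_measure; exact: measurableD.
Qed.

Lemma fine_measure_split2 (E : set T) k : measurable E ->
  fine (P E) = \sum_b fine (P (E `&` xi k @^-1` [set b])).
Proof.
move=> mE; rewrite sum_bool2.
have m1 : measurable ((fun x => (xi k x).1) @^-1` [set true]).
  exact: (measurable_xi k [set b | b.1 = true]).
have m2 : measurable ((fun x => (xi k x).2) @^-1` [set true]).
  exact: (measurable_xi k [set b | b.2 = true]).
have mf : measurable ((fun x => (xi k x).1) @^-1` [set false]).
  exact: (measurable_xi k [set b | b.1 = false]).
rewrite (fine_measure_split mE m1).
rewrite (fine_measure_split (measurableI _ _ mE m1) m2).
rewrite (fine_measure_split (measurableI _ _ mE mf) m2).
have e a b : E `&` (fun x => (xi k x).1) @^-1` [set a] `&`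
    (fun x => (xi k x).2) @^-1` [set b] = E `&` xi k @^-1` [set (a, b)].
  rewrite -setIA; congr (_ `&` _); apply/seteqP; split => x /=.
    by case: (xi k x) => a' b' /= [-> ->].
  by move=> ->.
by rewrite !e.
Qed.

Lemma law_sum1 : \sum_b law b = 1.
Proof.
have := fine_measure_split2 1%N (@measurableT _ T); rewrite probability_setT /= => ->.
by apply: eq_bigr => b _; rewrite setTI.
Qed.

(** Beyond [N] the word takes the default value that [wexp] assigns there. *)
Definition wordof (N : nat) (x : T) : word :=
  fun j => if (0 < j <= N)%N then xi j x else (false, false).

Lemma wordofS N x : wordof N.+1 x = upd (wordof N x) N.+1 (xi N.+1 x).
Proof.
apply/funext => j; rewrite /wordof /upd; case: eqVneq => [->|jN] /=.
  by rewrite leqnn.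
by rewrite (leq_eqVlt j) (negbTE jN) /= ltnS.
Qed.

Lemma measurable_wordof N (A : word -> bool) : measurable [set x | A (wordof N x)].
Proof.
elim: N A => [|N IH] A.
  have -> : [set x | A (wordof 0 x)] = if A (fun=> (false, false)) then setT else set0.
    have e x : wordof 0 x = fun=> (false, false).
      by apply/funext => j; rewrite /wordof; case: j.
    by apply/seteqP; split => x /=; rewrite e; case: ifP.
  by case: ifP.
have -> : [set x | A (wordof N.+1 x)] = \big[setU/set0]_(b : bool * bool)
    ([set x | A (upd (wordof N x) N.+1 b)] `&` xi N.+1 @^-1` [set b]).
  apply/seteqP; split => x /=.
    rewrite wordofS => Ax; rewrite -bigcup_seq; exists (xi N.+1 x) => //=.
    exact: mem_index_enum.
  by rewrite -bigcup_seq => -[b _ /= [Ab xb]]; rewrite wordofS xb.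
apply: bigsetU_measurable => b _; apply: measurableI; last exact: measurable_xi.
exact: (IH (fun v => A (upd v N.+1 b))).
Qed.

(** Prescribing the values of finitely many later variables along with the event
    makes the induction on the length of the word go through from mutual
    independence alone. *)
Lemma prob_wordof_later N k (A : word -> bool) (b : word) :
  fine (P ([set x | A (wordof N x)] `&`
    \big[setI/setT]_(j <- index_iota N.+1 (N + k).+1) (xi j @^-1` [set b j]))) =
  wexp law N (fun v => (A v)%:R) * \prod_(j <- index_iota N.+1 (N + k).+1) law (b j).
Proof.
elim: N k A b => [|N IH] k A b.
  have e x : wordof 0 x = fun=> (false, false).
    by apply/funext => j; rewrite /wordof; case: j.
  have -> : [set x | A (wordof 0 x)] = if A (fun=> (false, false)) then setT else set0.
    by apply/seteqP; split => x /=; rewrite e; case: ifP.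
  rewrite /=; case: ifP => Ad; last by rewrite set0I measure0 mul0r.
  have [ind _] := hxi.
  rewrite setTI mul1r (ind _ _ _ (fun j => [set b j])) ?iota_uniq//.
  - rewrite big_nat_cond [RHS]big_nat_cond; apply: eq_bigr => j.
    by rewrite andbT => /andP[j1 _]; rewrite lawE.
  - by move=> j; rewrite mem_index_iota => /andP[].
  - by move=> j; exact: measurable_bool2.
set G := \big[setI/setT]_(j <- _) _; set H := \prod_(j <- _) _.
have mG : measurable G by apply: bigsetI_measurable => j _; exact: measurable_xi.
rewrite (fine_measure_split2 N.+1 (measurableI _ _ (measurable_wordof _ _) mG)).
rewrite -[RHS]mulrC -wexpZ /=.
transitivity (\sum_c wexp law N (fun v => (A (upd v N.+1 c))%:R) * (law c * H)).
  apply: eq_bigr => c _; pose b' : word := upd b N.+1 c.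
  have := IH k.+1 (fun v => A (upd v N.+1 c)) b'.
  have e : (N + k.+1).+1 = (N.+1 + k).+1 by rewrite addnS.
  have lt : (N.+1 < (N.+1 + k).+1)%N by rewrite ltnS leq_addr.
  have b'E : b' N.+1 = c by rewrite /b' /upd eqxx.
  have b'E2 j : (N.+1 < j)%N -> b' j = b j by move=> h; rewrite /b' /upd gtn_eqF.
  rewrite e !(big_ltn lt) b'E.
  have -> : \big[setI/setT]_(N.+2 <= j < (N.+1 + k).+1) (xi j @^-1` [set b' j]) = G.
    rewrite /G big_nat_cond [RHS]big_nat_cond; apply: eq_bigr => j.
    by rewrite andbT => /andP[h _]; rewrite b'E2.
  have -> : \prod_(N.+2 <= j < (N.+1 + k).+1) law (b' j) = H.
    rewrite /H big_nat_cond [RHS]big_nat_cond; apply: eq_bigr => j.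
    by rewrite andbT => /andP[h _]; rewrite b'E2.
  move=> <-; congr (fine (P _)); apply/seteqP; split => x /=.
    by rewrite wordofS => -[[Ax Gx] xc]; rewrite -xc.
  by rewrite wordofS => -[Ax [xc Gx]]; rewrite xc.
have wexp_sum M (f : bool * bool -> word -> R) :
    wexp law M (fun v => \sum_c f c v) = \sum_c wexp law M (f c).
  by rewrite sum_bool2 -!wexpD; congr wexp; apply/funext => v; rewrite sum_bool2.
under eq_bigr => c _ do rewrite mulrC -wexpZ.
rewrite -wexp_sum; congr wexp; apply/funext => v.
apply: eq_bigr => c _; ring.
Qed.

Lemma prob_wordof N (A : word -> bool) :
  P [set x | A (wordof N x)] = (wexp law N (fun v => (A v)%:R))%:E.
Proof.
have := prob_wordof_later N 0 A (fun=> (false, false)).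
rewrite addn0 !big_geq// setIT mulr1 => <-; rewrite fineK//.
by apply: fin_num_measure; exact: measurable_wordof.
Qed.

Variable delta : nat -> T -> bool.
Hypothesis hdelta : gw_tree xi delta.

Lemma delta_alive n N k x : (2 ^ n <= k < 2 ^ n.+1)%N -> ((2 ^ n).-1 <= N)%N ->
  delta k x = alive n (wordof N x) k.
Proof.
have [h1 h2] := hdelta; elim: n k => [|n IH] k.
  by case: k => [|[|k]] //=; rewrite h1.
move=> /andP[kn nk] nN /=.
have k0 : (0 < k./2)%N.
  by rewrite half_gt0 (leq_trans _ kn)// expnS -[2%N in leqLHS]muln1 leq_mul2l expn_gt0.
have kn2 : (2 ^ n <= k./2 < 2 ^ n.+1)%N.
  rewrite ltn_half_double -mul2n -expnS nk andbT geq_half_double.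
  by rewrite -mul2n -expnS.
have nN' : ((2 ^ n.+1).-1 <= N)%N by [].
rewrite -IH//; last first.
  by rewrite (leq_trans _ nN)// -!subn1 leq_sub2r// leq_exp2l.
have -> : wordof N x k./2 = xi k./2 x.
  rewrite /wordof k0 /= ifT// (leq_trans _ nN')//.
  by rewrite -ltnS prednK ?expn_gt0//; case/andP: kn2.
have [e1 e2] := h2 k./2 x k0.
rewrite -{1}(odd_double_half k) -mul2n; case: (odd k) => /=.
  by rewrite add1n e2.
by rewrite add0n e1.
Qed.

Lemma size_Gstar n N x : ((2 ^ n).-1 <= N)%N ->
  size (Gstar delta n x) = gsize n (wordof N x).
Proof.
move=> nN; rewrite /Gstar size_filter /Gen /gsize -sum1_count big_mkcond/=.
have -> : (2 ^ n.+1 = 2 ^ n + 2 ^ n)%N by rewrite expnS mul2n addnn.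
rewrite -[X in index_iota X _]add0n big_addn addnK big_mkord.
apply: eq_bigr => i _; have ni : (2 ^ n <= 2 ^ n + i < 2 ^ n.+1)%N.
  by rewrite leq_addr /= expnS mul2n -addnn ltn_add2l.
by rewrite addnC (delta_alive _ ni nN); case: (alive _ _ _).
Qed.

Lemma prob_deviation n (m eps thr : R) : let A v := [&& (0 < gsize n v)%N,
    thr <= (gsize n v)%:R &
    eps * (gsize n v)%:R <= `|(gsize n.+1 v)%:R - m * (gsize n v)%:R|] in
  let D := [set x | [/\ (0 < size (Gstar delta n x))%N,
    thr <= (size (Gstar delta n x))%:R &
    eps * (size (Gstar delta n x))%:R <=
    `|(size (Gstar delta n.+1 x))%:R - m * (size (Gstar delta n x))%:R|]] in
  measurable D /\ P D = (gexp law n.+1 (fun v => (A v)%:R))%:E.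
Proof.
move=> A D; have -> : D = [set x | A (wordof (2 ^ n.+1).-1 x)].
  have nn : ((2 ^ n).-1 <= (2 ^ n.+1).-1)%N.
    by rewrite -!subn1 leq_sub2r// leq_exp2l.
  apply/seteqP; split => x; rewrite /D /A /= (size_Gstar _ nn) (size_Gstar _ (leqnn _)).
    by case=> -> -> ->.
  by case/and3P.
by split; [exact: measurable_wordof|rewrite prob_wordof].
Qed.

End word_probability.

(** * Growth of the observed population *)

Section growth.
Context {R : realType}.

Lemma sum_geometric_le (C z : R) n : 0 <= C -> 0 <= z < 1 ->
  \sum_(0 <= k < n) C * z ^+ k <= C / (1 - z).
Proof.
move=> C0 /andP[z0 z1]; have z10 : 0 < 1 - z by rewrite subr_gt0.
rewrite -mulr_sumr ler_wpM2l// -[leRHS]mul1r ler_pdivlMr//.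
have -> : (\sum_(0 <= k < n) z ^+ k) * (1 - z) = 1 - z ^+ n.
  elim: n => [|n IH]; first by rewrite big_geq// mul0r expr0 subrr.
  by rewrite big_nat_recr//= mulrDl IH exprSr; ring.
by rewrite gerBl exprn_ge0.
Qed.

(** The relative errors in [g (n+1) ~ m g n] being summable, their product is
    bounded away from zero and infinity, so that only constant factors are lost. *)
Lemma quasi_geometric_growth (g : nat -> R) (m z : R) (N : nat) :
  1 < m -> 0 <= z < 1 -> (forall n, 0 < g n) ->
  (forall n, (N <= n)%N -> `|g n.+1 - m * g n| <= z ^+ n * g n) ->
  let t n := \sum_(0 <= l < n.+1) g l in
  (exists c C : R, 0 < c /\ forall n, c * m ^+ n <= t n <= C * m ^+ n) /\
  (fun n => t n / t n.+1) @ \oo --> m^-1.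
Proof.
move=> m1 /andP[z0 z1] g0 hg t; have m0 : 0 < m by exact: lt_trans m1.
have mV1 : m^-1 < 1 by rewrite invf_lt1.
have t0 n : 0 < t n.
  by rewrite /t big_nat_recr//= ltr_wpDl// sumr_ge0// => i _; exact: ltW.
have zn : z ^+ n @[n --> \oo] --> (0 : R) by apply: cvg_expr; rewrite ger0_norm.
split; last first.
  have gr : (fun n => g n / g n.+1) @ \oo --> m^-1.
    have h : (fun n => g n.+1 / g n) @ \oo --> m.
      apply/cvgrPdist_le => e e0.
      have [N1 hN1] := cvg0_eps zn e0.
      exists (maxn N N1) => // n /=; rewrite geq_max => /andP[nN nN1].
      have -> : m - g n.+1 / g n = - ((g n.+1 - m * g n) / g n).
        by field; rewrite gt_eqF.
      rewrite normrN normrM normfV (gtr0_norm (g0 n)) ler_pdivrMr//.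
      apply: (le_trans (hg _ nN)); rewrite ler_wpM2r ?(ltW (g0 n))//.
      by apply: le_trans (hN1 _ nN1); exact: ler_norm.
    have -> : (fun n => g n / g n.+1) = (fun n => (g n.+1 / g n)^-1).
      by apply/funext => n; rewrite invf_div.
    by apply: cvgV => //; rewrite gt_eqF.
  pose y n := t n / g n.
  have y0 n : 0 < y n by rewrite divr_gt0.
  have hy : y @ \oo --> 1 / (1 - m^-1).
    apply: (cvg_affine_recursion (u := fun n => g n / g n.+1) (v := fun=> 1)) => //.
    - by rewrite ger0_norm ?invr_ge0// ltW.
    - exact: cvg_cst.
    - apply: nearW => n; rewrite /y /t [in LHS]big_nat_recr//=.
      by field; rewrite !gt_eqF.
  have -> : (fun n => t n / t n.+1) = (fun n => 1 - (y n.+1)^-1).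
    apply/funext => n; rewrite /y invf_div.
    have -> : t n = t n.+1 - g n.+1 by rewrite /t [in RHS]big_nat_recr//= addrK.
    by rewrite mulrBl divff// gt_eqF.
  have -> : m^-1 = 1 - (1 / (1 - m^-1))^-1.
    by rewrite mul1r invrK; ring.
  apply: cvgB; first exact: cvg_cst.
  apply: cvgV; first by rewrite mul1r invr_eq0 gt_eqF// subr_gt0.
  by rewrite cvg_shiftS.
have [N1 hN1] := cvg0_eps zn (ltac:(by rewrite invr_gt0) : 0 < 2^-1 :> R).
pose M := maxn N N1.
have hM k : `|g (M + k).+1 - m * g (M + k)%N| <= z ^+ k * g (M + k)%N /\ z ^+ (M + k) <= 2^-1.
  split; last first.
    apply: le_trans (hN1 (M + k)%N _); first exact: ler_norm.
    by rewrite (leq_trans (leq_maxr _ _) (leq_addr _ _)).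
  apply: (le_trans (hg _ _)); first by rewrite (leq_trans (leq_maxl _ _) (leq_addr _ _)).
  rewrite ler_wpM2r ?(ltW (g0 _))// exprD ler_piMl ?exprn_ge0//.
  by rewrite exprn_ile1// ltW.
have m_ge1 : 1 <= m by exact: ltW.
have up k : g (M + k)%N <= g M * m ^+ k * expR (\sum_(0 <= j < k) z ^+ j).
  elim: k => [|k IH]; first by rewrite addn0 expr0 mulr1 big_geq// expR0 mulr1.
  have [h _] := hM k; rewrite addnS big_nat_recr//= expRD exprS.
  apply: (@le_trans _ _ (m * (g (M + k)%N * expR (z ^+ k)))).
    have : g (M + k)%N * (1 + z ^+ k) <= g (M + k)%N * expR (z ^+ k).
      by rewrite ler_wpM2l ?(ltW (g0 _))// expR_ge1Dx.
    move=> /(ler_wpM2l (ltW m0)); apply: le_trans.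
    have : z ^+ k * g (M + k)%N <= m * (z ^+ k * g (M + k)%N).
      by rewrite ler_peMl// mulr_ge0 ?exprn_ge0// ltW.
    move: h; rewrite ler_norml => /andP[_]; lra.
  have : g (M + k)%N * expR (z ^+ k) <=
    g M * m ^+ k * expR (\sum_(0 <= j < k) z ^+ j) * expR (z ^+ k).
    by rewrite ler_wpM2r ?expR_ge0.
  by move=> /(ler_wpM2l (ltW m0)) /le_trans; apply; rewrite le_eqVlt; apply/orP; left; apply/eqP; ring.
have lo k : g M * m ^+ k * expR (- (2 * \sum_(0 <= j < k) z ^+ (M + j))) <= g (M + k)%N.
  elim: k => [|k IH].
    by rewrite addn0 expr0 mulr1 big_geq// mulr0 oppr0 expR0 mulr1.
  have [_ h2] := hM k.
  have h : `|g (M + k).+1 - m * g (M + k)%N| <= z ^+ (M + k) * g (M + k)%N.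
    by apply: hg; rewrite (leq_trans (leq_maxl _ _) (leq_addr _ _)).
  rewrite addnS big_nat_recr//= mulrDr opprD expRD exprS.
  set y := z ^+ (M + k) in h h2 *; have y_ge0 : 0 <= y by rewrite exprn_ge0.
  have ey : expR (- (2 * y)) <= 1 - y.
    have y2 : 0 < 1 + 2 * y by rewrite ltr_wpDr// mulr_ge0.
    rewrite expRN; apply: (@le_trans _ _ (1 + 2 * y)^-1).
      by rewrite lef_pV2 ?posrE ?expR_gt0// expR_ge1Dx.
    rewrite -[leLHS]mul1r ler_pdivrMr//; rewrite -subr_ge0.
    rewrite (_ : _ - _ = y * (1 - 2 * y)); last by ring.
    by rewrite mulr_ge0// subr_ge0; move: h2; lra.
  apply: (@le_trans _ _ (m * (g (M + k)%N * (1 - y)))); last first.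
    have : y * g (M + k)%N <= m * (y * g (M + k)%N).
      by rewrite ler_peMl// mulr_ge0// ltW.
    move: h; rewrite ler_norml => /andP[h _]; move: h; lra.
  have := ler_pM (mulr_ge0 (mulr_ge0 (ltW (g0 M)) (exprn_ge0 k (ltW m0)))
    (expR_ge0 _)) (expR_ge0 _) IH ey.
  move=> /(ler_wpM2l (ltW m0)); apply: le_trans.
  by rewrite le_eqVlt; apply/orP; left; apply/eqP; ring.
have S1 k : \sum_(0 <= j < k) z ^+ j <= (1 - z)^-1.
  have := @sum_geometric_le 1 z k ler01; rewrite z0 z1 mul1r => /(_ isT).
  by under eq_bigr do rewrite mul1r.
have S2 k : \sum_(0 <= j < k) z ^+ (M + j) <= (1 - z)^-1.
  apply: le_trans (S1 k); apply: ler_sum => j _; rewrite exprD ler_piMl ?exprn_ge0//.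
  by rewrite exprn_ile1// ltW.
have mM n : (n <= M)%N -> m ^+ n <= m ^+ M by move=> nM; rewrite ler_weXn2l.
pose c1 := g M * expR (- (2 / (1 - z))) / m ^+ M.
have c10 : 0 < c1 by rewrite divr_gt0 ?exprn_gt0// mulr_gt0// expR_gt0.
pose c := Num.min c1 (g 0%N / m ^+ M).
pose C1 := g M * expR ((1 - z)^-1) + \sum_(0 <= l < M) g l.
have C10 : 0 <= C1.
  by rewrite addr_ge0 ?sumr_ge0 ?mulr_ge0 ?expR_ge0// ?ltW// => i _; rewrite ltW.
have gC n : g n <= C1 * m ^+ n.
  have mn1 : 1 <= m ^+ n by rewrite exprn_ege1.
  have [Mn|nM] := leqP M n.
    apply: (@le_trans _ _ (g M * expR ((1 - z)^-1) * m ^+ n)); last first.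
      rewrite ler_wpM2r ?exprn_ge0 ?(ltW m0)// lerDl sumr_ge0// => i _; exact: ltW.
    rewrite -{1}(subnKC Mn); apply: (le_trans (up _)).
    rewrite mulrAC; apply: ler_pM.
    - by rewrite mulr_ge0 ?expR_ge0// ltW.
    - by rewrite exprn_ge0// ltW.
    - by rewrite ler_wpM2l ?(ltW (g0 M))// ler_expR.
    - by rewrite ler_weXn2l// leq_subr.
  apply: (@le_trans _ _ C1); last by rewrite ler_peMr.
  rewrite /C1 (bigD1_seq n) ?iota_uniq ?mem_index_iota//= addrCA lerDl.
  by rewrite addr_ge0 ?sumr_ge0 ?mulr_ge0 ?expR_ge0// ?ltW// => i _; rewrite ltW.
exists c, (C1 * (m / (m - 1))); split.
  by rewrite lt_min c10 divr_gt0// exprn_gt0.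
move=> n; apply/andP; split; last first.
  have h : (\sum_(0 <= l < n.+1) m ^+ l) * (m - 1) <= m * m ^+ n.
    have -> : (\sum_(0 <= l < n.+1) m ^+ l) * (m - 1) = m ^+ n.+1 - 1.
      elim: n => [|n IH]; first by rewrite big_nat1 expr0 expr1 mul1r.
      by rewrite big_nat_recr//= mulrDl IH [m ^+ n.+2]exprS; ring.
    by rewrite exprS lerBlDr lerDl.
  apply: (@le_trans _ _ (C1 * \sum_(0 <= l < n.+1) m ^+ l)).
    by rewrite mulr_sumr; apply: ler_sum => l _; exact: gC.
  rewrite -!mulrA ler_wpM2l// mulrA mulrAC ler_pdivlMr ?subr_gt0//.
have cm : c * m ^+ M <= g 0%N.
  by rewrite -ler_pdivlMr ?exprn_gt0// ge_min lexx orbT.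
have [Mn|nM] := leqP M n.
  apply: (@le_trans _ _ (g n)); last first.
    by rewrite /t big_nat_recr//= lerDr sumr_ge0// => i _; exact: ltW.
  apply: (@le_trans _ _ (c1 * m ^+ n)).
    by rewrite ler_wpM2r ?exprn_ge0 ?(ltW m0)// ge_min lexx.
  rewrite -{2}(subnKC Mn); apply: le_trans (lo _).
  rewrite /c1 -{1}(subnKC Mn) exprD.
  have -> : g M * expR (- (2 / (1 - z))) / m ^+ M * (m ^+ M * m ^+ (n - M)) =
    g M * m ^+ (n - M) * expR (- (2 / (1 - z))).
    by field; rewrite gt_eqF ?exprn_gt0// gt_eqF ?subr_gt0.
  rewrite ler_wpM2l ?mulr_ge0 ?exprn_ge0 ?(ltW m0) ?(ltW (g0 M))//.
  by rewrite ler_expR lerN2 ler_wpM2l.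
apply: (@le_trans _ _ (g 0%N)).
  apply: le_trans cm; rewrite ler_wpM2l ?mM ?(ltnW nM)//.
  by rewrite le_min (ltW c10) divr_ge0 ?exprn_ge0// ?ltW.
by rewrite /t big_ltn//= lerDl sumr_ge0// => i _; exact: ltW.
Qed.

End growth.

Section galton_watson_growth.
Context {d : measure_display} {T : measurableType d} {R : realType}.
Variables (P : probability T R) (p0 p1 p01 m : R).
Variable xi : nat -> {mfun T >-> (bool * bool)%type}.
Variable delta : nat -> T -> bool.
Hypothesis hxi : reproduction P p0 p1 p01 xi.
Hypothesis hdelta : gw_tree xi delta.
Hypothesis hm : m = 2 * p01 + p0 + p1.
Hypothesis m_gt1 : 1 < m.

Let w := law P xi.

Let mE : m = 2 * w (true, true) + (w (true, false) + w (false, true)).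
Proof.
have [_ h] := hxi; have [a1 a2 a3 _] := h 1%N isT.
by rewrite /w /law a1 a2 a3 /= hm addrA.
Qed.

Let g n x := size (Gstar delta n x).

Let D n (eps thr : R) := [set x | [/\ (0 < g n x)%N, thr <= (g n x)%:R &
    eps * (g n x)%:R <= `|(g n.+1 x)%:R - m * (g n x)%:R|]].

Let prob_D n eps thr : 0 < eps <= 1 -> (P (D n eps thr) <=
  (2 * gexp w n (fun v => ((0 < gsize n v)%N && (thr <= (gsize n v)%:R))%:R *
      expR (- (eps ^+ 2 / 32)) ^+ gsize n v))%:E)%E.
Proof.
move=> he; have [_ ->] := prob_deviation hxi hdelta n m eps thr.
have w1 := law_sum1 P xi; have w0 := law_ge0 P xi.
have := @gsize_deviation _ w w0 w1 _ n eps thr he; rewrite -mE => /(_ m_gt1).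
by rewrite lee_fin.
Qed.

(** A deviation of fixed relative size has conditional probability at most
    [2 z ^ Z_n] for some [z < 1], where [Z_n] is the size of generation [n]; on
    survival up to time [n] the expectation of [z ^ Z_n] decays geometrically. *)
Lemma prob_deviation_geometric (eps : R) : 0 < eps <= 1 ->
  exists2 k : R, 0 <= k < 1 & forall n, (P (D n eps 0) <= (2 * k ^+ n)%:E)%E.
Proof.
move=> he; have w1 := law_sum1 P xi; have w0 := law_ge0 P xi.
have sE := w1; rewrite sum_bool2 in sE.
have w00 : w (false, false) < w (true, true).
  by move: m_gt1 sE; rewrite mE /w; lra.
have w11 : 0 < w (true, true) by apply: le_lt_trans w00; exact: w0.
pose u := Num.max (w (false, false) / w (true, true)) (expR (- (eps ^+ 2 / 32))).
have /andP[e0 _] := he.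
have hu : w (false, false) / w (true, true) <= u < 1.
  rewrite le_max lexx /= gt_max; apply/andP; split.
    by rewrite ltr_pdivrMr// mul1r.
  by rewrite -[ltRHS]expR0 ltr_expR oppr_lt0 divr_gt0// exprn_gt0.
exists (1 - w (true, true) * (1 - u)).
  have /andP[_ u1] := hu; have u0 : 0 <= u.
    by apply: (@le_trans _ _ (expR (- (eps ^+ 2 / 32)))); rewrite ?expR_ge0// le_max lexx orbT.
  apply/andP; split; last by rewrite gtrBl mulr_gt0// subr_gt0.
  have : w (true, true) <= 1.
    by move: sE (w0 (true, false)) (w0 (false, true)) (w0 (false, false)); rewrite /w; lra.
  move=> w111; rewrite subr_ge0 mulr_ile1// ?(ltW w11)// ?subr_ge0 ?(ltW u1)//.
  by rewrite gerBl.
move=> n; apply: (le_trans (prob_D n 0 he)); rewrite lee_fin ler_wpM2l//.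
have := @pgf_alive_le _ w w0 w1; rewrite -mE => /(_ m_gt1 u n hu); apply: le_trans.
apply: ler_wexp => // v; apply: ler_pM => //.
- by rewrite ler_nat; case: (0 < _)%N => //=; case: (0 <= _).
- have zu : expR (- (eps ^+ 2 / 32)) <= u by rewrite le_max lexx orbT.
  by rewrite lerXn2r// nnegrE ?expR_ge0// (le_trans (expR_ge0 _) zu).
Qed.

Lemma prob_deviation_threshold n (eps thr : R) : 0 < eps <= 1 ->
  (P (D n eps thr) <= (2 * expR (- (eps ^+ 2 / 32 * thr)))%:E)%E.
Proof.
move=> he; have w1 := law_sum1 P xi; have w0 := law_ge0 P xi.
apply: (le_trans (prob_D n thr he)); rewrite lee_fin ler_wpM2l//.
rewrite -[leRHS](@wexp_cst _ w w1 (2 ^ n).-1); apply: ler_wexp => // v.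
case: (boolP (thr <= _)) => [h|_]; last by rewrite andbF mul0r expR_ge0.
rewrite -expRM_natl; apply: (@le_trans _ _ (expR ((gsize n v)%:R * - (eps ^+ 2 / 32)))).
  by rewrite ler_piMl ?expR_ge0// lern1; case: (_ && _).
rewrite ler_expR mulrN lerN2 [leRHS]mulrC ler_wpM2l// divr_ge0// exprn_ge0//.
by case/andP: he => /ltW.
Qed.

(** A bootstrap in two steps.  Deviations of fixed relative size have summable
    probabilities, so on survival the population eventually grows at least at some
    geometric rate [r > 1].  For a population of that size the exponential bound
    improves so much that deviations of relative size [z ^ n] are summable too. *)
Theorem gw_growth : {ae P, forall x, survival delta x ->
  (forall n, 0 < g n x)%N /\ exists (z : R) (N : nat), 0 <= z < 1 /\
  forall n, (N <= n)%N ->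
    `|(g n.+1 x)%:R - m * (g n x)%:R| <= z ^+ n * (g n x)%:R}.
Proof.
pose e1 := Num.min 1 ((m - 1) / 2).
have e11 : 0 < e1 <= 1.
  by rewrite lt_min ltr01 divr_gt0 ?subr_gt0//= ge_min lexx.
have e1m : e1 <= (m - 1) / 2 by rewrite ge_min lexx orbT.
pose r := m - e1; have r1 : 1 < r by move: e1m m_gt1; rewrite /r; lra.
(* The population exceeds [tau ^ (4 * (n - N1))], hence finally [tau ^ (3 * n)],
   while deviations of relative size [tau ^ (- n)] are tested: the exponent
   [z ^ (2 * n) * tau ^ (3 * n) / 32 = tau ^ n / 32] still diverges. *)
pose tau := Num.sqrt (Num.sqrt r).
have tau4 : tau ^+ 4 = r.
  have -> : tau ^+ 4 = (tau ^+ 2) ^+ 2 by rewrite -exprM.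
  by rewrite !sqr_sqrtr ?sqrtr_ge0// ltW// (lt_trans _ r1).
have tau1 : 1 < tau.
  rewrite ltNge; apply/negP => h; move: r1.
  by rewrite -tau4 ltNge exprn_ile1 ?sqrtr_ge0.
have tau0 : 0 < tau by exact: lt_trans tau1.
pose z := tau^-1.
have z1 : 0 <= z < 1 by rewrite invr_ge0 ltW//= invf_lt1.
have [k hk Dk] := prob_deviation_geometric e11.
have mD n eps thr : measurable (D n eps thr).
  by have [] := prob_deviation hxi hdelta n m eps thr.
have BC1 := borel_cantelli_ae (fun n => mD n e1 0) Dk
  (fun n => sum_geometric_le n (ler0n R 2) hk).
have h2 n : (P (D n (z ^+ n) (tau ^+ (3 * n))) <= (64 * z ^+ n)%:E)%E.
  have zn : 0 < z ^+ n <= 1.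
    by case/andP: z1 => z0 /ltW z1'; rewrite exprn_gt0 ?invr_gt0//= exprn_ile1.
  apply: (le_trans (prob_deviation_threshold n (tau ^+ (3 * n)) zn)).
  have -> : (z ^+ n) ^+ 2 / 32 * tau ^+ (3 * n) = tau ^+ n / 32.
    by rewrite /z mulnC exprM exprVn; field; rewrite gt_eqF// exprn_gt0.
  have y0 : 0 < tau ^+ n / 32 by rewrite divr_gt0// exprn_gt0.
  rewrite lee_fin expRN (_ : 64 * z ^+ n = 2 * (tau ^+ n / 32)^-1); last first.
    by rewrite /z exprVn; field; rewrite gt_eqF// exprn_gt0.
  rewrite ler_wpM2l// lef_pV2 ?posrE ?expR_gt0//.
  by apply: le_trans (expR_ge1Dx _); rewrite lerDr.
have BC2 := borel_cantelli_ae (fun n => mD n (z ^+ n) (tau ^+ (3 * n))) h2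
  (fun n => sum_geometric_le n (ler0n R 64) z1).
apply: filterS2 BC1 BC2 => x [N1 hN1] [N2 hN2] sx.
have g_gt0 n : (0 < g n x)%N.
  by rewrite lt0n; apply/eqP => gn; apply: sx; exists n.
split=> //; exists z, (maxn (4 * N1) N2); split=> // n; rewrite geq_max => /andP[nN1 nN2].
have gr l : (N1 <= l)%N -> r * (g l x)%:R <= (g l.+1 x)%:R.
  move=> Nl; rewrite leNgt; apply/negP => h; apply: (hN1 _ Nl); split => //.
  by rewrite ler_normr; apply/orP; right; move: h; rewrite /r; lra.
have grow i : tau ^+ (4 * i) <= (g (N1 + i)%N x)%:R.
  elim: i => [|i IH]; first by rewrite muln0 expr0 addn0 ler1n.
  rewrite mulnS exprD tau4 addnS; apply: le_trans (gr _ (leq_addr _ _)).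
  by rewrite ler_wpM2l// ltW// (lt_trans _ r1).
have thr : tau ^+ (3 * n) <= (g n x)%:R.
  have N1n : (N1 <= n)%N by rewrite (leq_trans _ nN1)// leq_pmull.
  apply: (@le_trans _ _ (tau ^+ (4 * (n - N1)))); last by have := grow (n - N1)%N; rewrite subnKC.
  rewrite ler_weXn2l ?(ltW tau1)//; rewrite mulnBr leq_subRL; last first.
    by rewrite leq_mul2l.
  by rewrite -[X in (_ <= X * _)%N]/(1 + 3)%N mulnDl mul1n leq_add2r.
rewrite leNgt; apply/negP => h; apply: (hN2 _ nN2); split => //; exact: ltW.
Qed.

End galton_watson_growth.


(** * Functions measurable for a sub-sigma-algebra *)

Section sub_sigma_algebras.
Context {d : measure_display} {T : measurableType d} {R : realType}.
Variable G : set (set T).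
Hypothesis sG : sigma_algebra [set: T] G.

Lemma measurable_wrtP d' (U : measurableType d') (f : T -> U) :
  measurable_wrt G f <-> @measurable_fun _ _ (g_sigma_algebraType G) U setT f.
Proof.
have e : (measurable : set (set (g_sigma_algebraType G))) = G.
  exact: measurable_g_measurableTypeE.
have e1 A : G A -> (measurable : set (set (g_sigma_algebraType G))) A by rewrite e.
have e2 A : (measurable : set (set (g_sigma_algebraType G))) A -> G A by rewrite e.
split=> [h _ B mB|h B mB]; first by rewrite setTI; apply: e1; exact: h.
by apply: e2; rewrite -[X in _ X]setTI; exact: h.
Qed.

Lemma measurable_wrt_cst (c : R) : measurable_wrt G (fun=> c).
Proof. by apply/measurable_wrtP; exact: measurable_cst. Qed.

Lemma measurable_wrtD (f g : T -> R) : measurable_wrt G f -> measurable_wrt G g ->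
  measurable_wrt G (fun x => f x + g x).
Proof.
by move=> /measurable_wrtP mf /measurable_wrtP mg; apply/measurable_wrtP; exact: measurable_funD.
Qed.

Lemma measurable_wrtM (f g : T -> R) : measurable_wrt G f -> measurable_wrt G g ->
  measurable_wrt G (fun x => f x * g x).
Proof.
by move=> /measurable_wrtP mf /measurable_wrtP mg; apply/measurable_wrtP; exact: measurable_funM.
Qed.

Lemma measurable_wrtB (f g : T -> R) : measurable_wrt G f -> measurable_wrt G g ->
  measurable_wrt G (fun x => f x - g x).
Proof.
by move=> /measurable_wrtP mf /measurable_wrtP mg; apply/measurable_wrtP; exact: measurable_funB.
Qed.

Lemma measurable_wrtX (f : T -> R) n : measurable_wrt G f ->
  measurable_wrt G (fun x => f x ^+ n).
Proof.
by move=> /measurable_wrtP mf; apply/measurable_wrtP; exact: measurable_funX.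
Qed.

Lemma measurable_wrt_norm (f : T -> R) : measurable_wrt G f ->
  measurable_wrt G (fun x => `|f x|).
Proof.
move=> /measurable_wrtP mf; apply/measurable_wrtP.
by apply: measurableT_comp => //; exact: normr_measurable.
Qed.

Lemma measurable_wrt_sum I (s : seq I) (f : I -> T -> R) :
  (forall i, measurable_wrt G (f i)) -> measurable_wrt G (fun x => \sum_(i <- s) f i x).
Proof.
move=> mf; elim: s => [|i s IH].
  by under eq_fun do rewrite big_nil; exact: measurable_wrt_cst.
by under eq_fun do rewrite big_cons; exact: measurable_wrtD.
Qed.

Lemma measurable_wrt_inv (f : T -> R) : (forall x, 0 < f x) -> measurable_wrt G f ->
  measurable_wrt G (fun x => (f x)^-1).
Proof.
move=> f0 /measurable_wrtP mf; apply/measurable_wrtP.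
rewrite (_ : (fun x => (f x)^-1) = (fun y : R => y `^ (-1)) \o f); last first.
  by apply/funext => x /=; rewrite powR_inv1// ltW.
by apply: measurableT_comp => //; exact: measurable_powR.
Qed.

Lemma measurable_wrt_indic (A : set T) : G A -> measurable_wrt G (\1_A : T -> R).
Proof.
move=> GA; apply/measurable_wrtP.
have mA : (measurable : set (set (g_sigma_algebraType G))) A.
  by rewrite measurable_g_measurableTypeE.
exact: (@measurable_indic _ (g_sigma_algebraType G) R setT A mA).
Qed.

Lemma wrt_ltr (f : T -> R) (c : R) : measurable_wrt G f -> G [set x | f x < c].
Proof.
move=> mf; have := mf [set y | y < c]; apply.
by rewrite (_ : [set y | y < c] = `]-oo, c[%classic)//; apply/seteqP; split => y; rewrite /= in_itv.
Qed.

Lemma wrt_ger (f : T -> R) (c : R) : measurable_wrt G f -> G [set x | c <= f x].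
Proof.
move=> mf; have := mf [set y | c <= y]; apply.
by rewrite (_ : [set y | c <= y] = `[c, +oo[%classic)//; apply/seteqP; split => y; rewrite /= in_itv/= andbT.
Qed.

End sub_sigma_algebras.

Lemma measurable_wrt_sub d (T : measurableType d) d' (U : measurableType d')
    (G G' : set (set T)) (f : T -> U) :
  G `<=` G' -> measurable_wrt G f -> measurable_wrt G' f.
Proof. by move=> GG' mf B mB; apply: GG'; exact: mf. Qed.

Lemma measurable_wrt_fun d (T : measurableType d) d' (U : measurableType d')
    (G : set (set T)) (f : T -> U) :
  G `<=` measurable -> measurable_wrt G f -> measurable_fun setT f.
Proof. by move=> Gm mf _ B mB; rewrite setTI; apply: Gm; exact: mf. Qed.

(** * Integrable functions *)

Section integrals.
Context {d : measure_display} {T : measurableType d} {R : realType}.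
Variable P : probability T R.

Definition integrableR (f : T -> R) := P.-integrable [set: T] (EFin \o f).

Lemma integrableR_meas f : integrableR f -> measurable_fun setT f.
Proof. by move=> /(measurable_int P) /measurable_EFinP. Qed.

Lemma integrableRD f g : integrableR f -> integrableR g ->
  integrableR (fun x => f x + g x).
Proof. by move=> hf hg; have := integrableD measurableT hf hg. Qed.

Lemma integrableRB f g : integrableR f -> integrableR g ->
  integrableR (fun x => f x - g x).
Proof. by move=> hf hg; have := integrableB measurableT hf hg. Qed.

Lemma integrableRZ k f : integrableR f -> integrableR (fun x => k * f x).
Proof. by move=> hf; have := integrableZl measurableT k hf. Qed.

Lemma integrableR_cst c : integrableR (fun=> c).
Proof. exact: finite_measure_integrable_cst. Qed.

Lemma integrableR_le (f g : T -> R) : measurable_fun setT f -> integrableR g ->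
  (forall x, `|f x| <= g x) -> integrableR f.
Proof.
move=> mf hg fg; apply: le_integrable hg => //; first exact/measurable_EFinP.
by move=> x _ /=; rewrite lee_fin; apply: (le_trans (fg x)); exact: ler_norm.
Qed.

Lemma integrableR_bounded_mul (h f : T -> R) c : measurable_fun setT h ->
  (forall x, `|h x| <= c) -> integrableR f -> integrableR (fun x => h x * f x).
Proof.
move=> mh hc hf; apply: (@integrableR_le _ (fun x => c * `|f x|)).
- by apply: measurable_funM => //; exact: integrableR_meas.
- by apply: integrableRZ; exact: integrable_norm.
- by move=> x; rewrite normrM ler_wpM2r.
Qed.

Lemma integrableR_sum I (s : seq I) (f : I -> T -> R) :
  (forall i, integrableR (f i)) -> integrableR (fun x => \sum_(i <- s) f i x).
Proof.
move=> hf; elim: s => [|i s IH].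
  by under eq_fun do rewrite big_nil; exact: integrableR_cst.
by under eq_fun do rewrite big_cons; exact: integrableRD.
Qed.

Lemma RintegralT_sum I (s : seq I) (f : I -> T -> R) :
  (forall i, integrableR (f i)) ->
  \int[P]_x (\sum_(i <- s) f i x) = \sum_(i <- s) \int[P]_x f i x.
Proof.
move=> hf; elim: s => [|i s IH].
  under [LHS]eq_Rintegral do rewrite big_nil; rewrite big_nil.
  by rewrite Rintegral_cst// mul0r.
rewrite big_cons -IH -RintegralD//; [|exact: hf|exact: integrableR_sum].
by apply: eq_Rintegral => x _; rewrite big_cons.
Qed.

Lemma markov_measure (f : T -> R) (c : R) :
  integrableR f -> (forall x, 0 <= f x) -> 0 < c ->
  (P [set x | (c <= f x)%R] <= (\int[P]_x f x / c)%:E)%E.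
Proof.
move=> hf f0 c0; have mf := integrableR_meas hf.
have mA : measurable [set x | c <= f x].
  rewrite -[X in measurable X]setTI; apply: (measurable_fun_ler _ _) => //.
have -> : P [set x | c <= f x] = (\int[P]_x (\1_[set x | c <= f x] x))%:E.
  rewrite /Rintegral fineK; first by rewrite integral_indic// setIT.
  by rewrite integral_indic// setIT fin_num_measure.
rewrite lee_fin ler_pdivlMr// mulrC -RintegralZl//; last exact: integrable_indic.
apply: le_Rintegral => //.
  by apply: integrableRZ; exact: integrable_indic.
move=> x _; rewrite indicE; case: (boolP (x \in _)) => [|_]; last by rewrite mulr0.
by rewrite inE /= mulr1.
Qed.

End integrals.

(** * Conditional expectations *)

Section conditional_expectations.
Context {d : measure_display} {T : measurableType d} {R : realType}.
Variables (P : probability T R) (G : set (set T)).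
Hypothesis sG : sigma_algebra [set: T] G.
Hypothesis Gm : G `<=` measurable.

Lemma Rintegral_indic_mul (A : set T) (f : T -> R) :
  \int[P]_(x in A) f x = \int[P]_x (\1_A x * f x).
Proof.
rewrite Rintegral_mkcond; congr (Rintegral P _ _); apply/funext => x.
rewrite patchE indicE; case: ifP => _; first by rewrite mul1r.
by rewrite mul0r.
Qed.

(** Counting the integer levels below [y] recovers [y] up to 1; after rescaling,
    this yields the combinations of indicators in [Rintegral_mul_zero_unit]. *)
Lemma staircase (y : R) N : 0 <= y <= N%:R ->
  `|y - \sum_(0 <= k < N) (k.+1%:R <= y)%R%:R| <= 1.
Proof.
move=> /andP[y0 yN].
have h n : let s := \sum_(0 <= k < n) (k.+1%:R <= y)%R%:R in
    [/\ n%:R <= y -> s = n%:R :> R, s <= y & y < n.+1%:R -> y <= s + 1].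
  elim: n => [|n [h1 h2 h3]] /=.
    by rewrite big_geq//; split => // y1; rewrite add0r ltW.
  rewrite big_nat_recr//=; set s := \sum_(_ <= _ < _) _ in h1 h2 h3 *.
  case: (leP n.+1%:R y) => hn /=.
    have s1 : s = n%:R by apply: h1; apply: le_trans hn; rewrite ler_nat.
    rewrite s1 natr1; split => //.
    by move=> /ltW; rewrite -natr1.
  by rewrite addr0; split => // _; exact: h3.
have [_ h2 h3] := h N.
rewrite ger0_norm ?subr_ge0// lerBlDl addrC addrC; apply: h3.
by apply: (le_lt_trans yN); rewrite ltr_nat.
Qed.

Variable D : T -> R.
Hypothesis D_int : integrableR P D.
Hypothesis D_zero : forall A, G A -> \int[P]_(x in A) D x = 0.

(** A bounded multiplier is a uniform limit of finite combinations of indicators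
    of the sub-sigma-algebra. *)
Lemma Rintegral_mul_zero_unit (H : T -> R) : measurable_wrt G H ->
  (forall x, 0 <= H x <= 1) -> \int[P]_x (H x * D x) = 0.
Proof.
move=> mH H01; have mH' := measurable_wrt_fun Gm mH.
pose A n k := [set x | (k.+1%:R / n.+1%:R <= H x)%R].
have GA n k : G (A n k) by exact: wrt_ger.
pose S n x : R := \sum_(0 <= k < n.+1) \1_(A n k) x.
have intA n k : integrableR P (fun x => \1_(A n k) x * D x).
  apply: (@integrableR_bounded_mul _ _ _ _ _ _ 1) => //.
    by apply: measurable_indic; exact: Gm.
  by move=> x; rewrite indicE; case: (_ \in _); rewrite ?normr1 ?normr0.
have intS n : integrableR P (fun x => S n x * D x).
  under eq_fun do rewrite mulr_suml; exact: integrableR_sum.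
have S0 n : \int[P]_x (S n x * D x) = 0.
  under eq_Rintegral do rewrite mulr_suml.
  rewrite RintegralT_sum// big1// => k _.
  by rewrite -Rintegral_indic_mul D_zero.
have intH : integrableR P (fun x => H x * D x).
  apply: (@integrableR_bounded_mul _ _ _ _ _ _ 1) => // x.
  by case/andP: (H01 x) => a0 a1; rewrite ger0_norm.
have HS n x : `|H x - n.+1%:R^-1 * S n x| <= n.+1%:R^-1.
  have n0 : 0 < n.+1%:R :> R by [].
  have -> : H x - n.+1%:R^-1 * S n x = n.+1%:R^-1 * (n.+1%:R * H x - S n x).
    by rewrite mulrBr mulKf// gt_eqF.
  rewrite normrM gtr0_norm ?invr_gt0// ler_piMr ?invr_ge0//.
  have -> : S n x = \sum_(0 <= k < n.+1) (k.+1%:R <= n.+1%:R * H x)%R%:R.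
    apply: eq_bigr => k _; rewrite indicE; congr ((nat_of_bool _)%:R).
    by apply/idP/idP; rewrite inE /A /= ler_pdivrMr// mulrC.
  apply: staircase; case/andP: (H01 x) => a0 a1.
  by rewrite mulr_ge0//= ler_piMr.
have key n : `|\int[P]_x (H x * D x)| <= n.+1%:R^-1 * \int[P]_x `|D x|.
  have intZ : integrableR P (fun x => n.+1%:R^-1 * (S n x * D x)) by exact: integrableRZ.
  have -> : \int[P]_x (H x * D x) =
      \int[P]_x (H x * D x - n.+1%:R^-1 * (S n x * D x)).
    by rewrite RintegralB// RintegralZl// ?S0 ?mulr0 ?subr0//; exact: intS.
  have intd : integrableR P (fun x => H x * D x - n.+1%:R^-1 * (S n x * D x)).
    exact: integrableRB.
  apply: (le_trans (le_normr_Rintegral measurableT intd)).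
  rewrite -RintegralZl//; last exact: integrable_norm.
  apply: le_Rintegral => //.
  - exact: integrable_norm.
  - by apply: integrableRZ; exact: integrable_norm.
  - by move=> x _; rewrite mulrA -mulrBl normrM ler_wpM2r.
set I := \int[P]_x (H x * D x); set C := \int[P]_x `|D x| in key.
apply/eqP; rewrite -normr_eq0 eq_le normr_ge0 andbT; apply/ler_addgt0Pr => e e0.
rewrite add0r; have C0 : 0 <= C by apply: Rintegral_ge0.
pose n := Num.truncn (C / e).
apply: (le_trans (key n)); rewrite mulrC ler_pdivrMr// -ler_pdivrMl// mulrC.
by apply: ltW; exact: truncnS_gt.
Qed.

Lemma Rintegral_mul_zero (H : T -> R) c : measurable_wrt G H ->
  (forall x, `|H x| <= c) -> \int[P]_x (H x * D x) = 0.
Proof.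
move=> mH Hc; pose c' := `|c| + 1.
have c'0 : 0 < c' by rewrite ltr_wpDl.
have Hc' x : `|H x| <= c'.
  by apply: (le_trans (Hc x)); apply: (le_trans (ler_norm _)); rewrite lerDl.
have h : \int[P]_x ((2 * c')^-1 * (H x + c') * D x) = 0.
  apply: Rintegral_mul_zero_unit.
    apply: measurable_wrtM => //; first exact: measurable_wrt_cst.
    by apply: measurable_wrtD => //; exact: measurable_wrt_cst.
  move=> x; have := Hc' x; rewrite ler_norml => /andP[a1 a2].
  rewrite mulr_ge0 ?invr_ge0 ?mulr_ge0 ?(ltW c'0)//=; last by move: a1; lra.
  by rewrite mulrC ler_pdivrMr ?mulr_gt0// mul1r; move: a2; lra.
have intH : integrableR P (fun x => H x * D x).
  by apply: integrableR_bounded_mul (measurable_wrt_fun Gm mH) Hc' D_int.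
have intc : integrableR P (fun x => c' * D x) by exact: integrableRZ.
have DT : \int[P]_x D x = 0 by apply: D_zero; case: sG => G0 GC _; rewrite -(setD0 setT); exact: GC.
have e : \int[P]_x ((2 * c')^-1 * (H x + c') * D x) =
    (2 * c')^-1 * \int[P]_x (H x * D x).
  transitivity (\int[P]_x ((2 * c')^-1 * (H x * D x + c' * D x))).
    by apply: eq_Rintegral => x _; ring.
  rewrite RintegralZl//; last exact: (integrableRD intH intc).
  by rewrite RintegralD// [X in _ + X]RintegralZl// DT mulr0 addr0.
move: h; rewrite e => /eqP.
by rewrite mulf_eq0 invr_eq0 gt_eqF ?mulr_gt0//= => /eqP.
Qed.

End conditional_expectations.

Section condexp_theory.
Context {d : measure_display} {T : measurableType d} {R : realType}.
Variables (P : probability T R) (G : set (set T)).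
Hypothesis sG : sigma_algebra [set: T] G.
Hypothesis Gm : G `<=` measurable.

Lemma condexp_mul_integral (Z Y H : T -> R) c : is_condexp P G Z Y ->
  measurable_wrt G H -> (forall x, `|H x| <= c) ->
  \int[P]_x (H x * Z x) = \int[P]_x (H x * Y x).
Proof.
move=> [iZ iY mY ZY] mH Hc; have mH' := measurable_wrt_fun Gm mH.
apply/eqP; rewrite -subr_eq0 -RintegralB//; last 2 first.
- exact: integrableR_bounded_mul mH' Hc iZ.
- exact: integrableR_bounded_mul mH' Hc iY.
under eq_Rintegral do rewrite -mulrBr.
rewrite (@Rintegral_mul_zero _ _ _ P G sG Gm _ _ _ H c)//.
  exact: integrableRB.
move=> A GA; rewrite RintegralB//; [|exact: Gm|exact: integrableS (Gm GA) _ iZ|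
  exact: integrableS (Gm GA) _ iY].
by rewrite /Rintegral ZY// subrr.
Qed.

Lemma condexp_mul (Z Y H : T -> R) c : is_condexp P G Z Y ->
  measurable_wrt G H -> (forall x, `|H x| <= c) ->
  is_condexp P G (fun x => H x * Z x) (fun x => H x * Y x).
Proof.
move=> ZY mH Hc; have [iZ iY mY _] := ZY; have mH' := measurable_wrt_fun Gm mH.
have iHZ := integrableR_bounded_mul mH' Hc iZ.
have iHY := integrableR_bounded_mul mH' Hc iY.
split => //; first exact: measurable_wrtM.
move=> A GA; have mA := Gm GA.
rewrite -[LHS]fineK; last by apply: integrable_fin_num => //; exact: integrableS iHY.
rewrite -[RHS]fineK; last by apply: integrable_fin_num => //; exact: integrableS iHZ.
congr (_%:E); have e (f : T -> R) :
    fine (\int[P]_(x in A) (f x)%:E)%E = \int[P]_x (\1_A x * f x).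
  exact: Rintegral_indic_mul.
rewrite (e (fun x => H x * Y x)) (e (fun x => H x * Z x)).
under eq_Rintegral do rewrite mulrA; under [RHS]eq_Rintegral do rewrite mulrA.
apply/esym; apply: (@condexp_mul_integral _ _ _ `|c|) => //.
  by apply: measurable_wrtM => //; exact: measurable_wrt_indic.
move=> x; rewrite normrM indicE; case: (_ \in _).
  by rewrite normr1 mul1r (le_trans (Hc x))// ler_norm.
by rewrite normr0 mul0r.
Qed.

Lemma condexpB (Z Y Z' Y' : T -> R) : is_condexp P G Z Y -> is_condexp P G Z' Y' ->
  is_condexp P G (fun x => Z x - Z' x) (fun x => Y x - Y' x).
Proof.
move=> [iZ iY mY ZY] [iZ' iY' mY' ZY']; split => //.
- exact: integrableRB.
- exact: integrableRB.
- exact: measurable_wrtB.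
move=> A GA; have mA := Gm GA.
have sub f : P.-integrable setT f -> P.-integrable A f by apply: integrableS.
rewrite !integralB_EFin//; try exact: sub.
by rewrite ZY// ZY'.
Qed.

Lemma condexp_id (Y : T -> R) : integrableR P Y -> measurable_wrt G Y ->
  is_condexp P G Y Y.
Proof. by move=> iY mY; split. Qed.

Lemma condexp_ge0 (Z Y : T -> R) : is_condexp P G Z Y -> (forall x, 0 <= Z x) ->
  {ae P, forall x, 0 <= Y x}.
Proof.
move=> [iZ iY mY ZY] Z0; pose A := [set x | Y x < 0].
have GA : G A by exact: wrt_ltr. have mA := Gm GA.
have iYA : P.-integrable A (EFin \o Y) by exact: integrableS iY.
have h : (\int[P]_(x in A) `|(EFin \o Y) x| = 0)%E.
  apply/eqP; rewrite eq_le; apply/andP; split; last first.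
    by apply: integral_ge0 => x _; exact: abse_ge0.
  rewrite (_ : (\int[P]_(x in A) _ = - \int[P]_(x in A) (Y x)%:E)%E); last first.
    rewrite -integralN/=; last first.
      by apply: integrable_add_def.
    by apply: eq_integral => x; rewrite inE /A /= => Yx; rewrite ltr0_norm.
  by rewrite ZY// leeNl oppe0; apply: integral_ge0 => x _; rewrite lee_fin.
have := (ae_eq_integral_abs P mA (measurable_int P iYA)).1 h.
apply: filterS => x /= hx; rewrite leNgt; apply/negP => Yx.
by have := hx Yx => -[] Y0; rewrite Y0 ltxx in Yx.
Qed.

End condexp_theory.

(** * Martingale convergence and laws of large numbers *)

Section martingale_convergence.
Context {d : measure_display} {T : measurableType d} {R : realType}.
Variables (P : probability T R) (F : nat -> set (set T)).
Hypothesis sF : forall n, sigma_algebra [set: T] (F n).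
Hypothesis Fm : forall n, F n `<=` measurable.
Hypothesis FS : forall n, F n `<=` F n.+1.

Lemma filtration_le n k : (n <= k)%N -> F n `<=` F k.
Proof.
by move=> /subnKC <-; elim: (k - n)%N => [|j IH]; rewrite ?addn0// addnS => A /IH /FS.
Qed.

Lemma measurable_wrt_lt (G : set (set T)) (f : T -> R) (c : R) :
  sigma_algebra setT G -> measurable_wrt G f ->
  measurable_wrt G (fun w => (`|f w| < c)%R%:R : R).
Proof.
move=> sG mf; rewrite (_ : (fun w => _) = \1_[set w | (`|f w| < c)%R] :> (T -> R)).
  by apply: measurable_wrt_indic => //; apply: wrt_ltr; exact: measurable_wrt_norm.
apply/funext => w; rewrite indicE; congr ((nat_of_bool _)%:R).
by apply/idP/idP; rewrite inE.
Qed.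

Section convergence.
Variable x : nat -> T -> R.
Hypothesis x_meas : forall l, measurable_wrt (F l.+1) (x l).
Hypothesis x_mean : forall l, is_condexp P (F l) (x l) (fun=> 0).
Hypothesis x_sq : forall l, integrableR P (fun w => x l w ^+ 2).

Let e l := \int[P]_w (x l w ^+ 2).

Let e_ge0 l : 0 <= e l. Proof. by apply: Rintegral_ge0 => w _; exact: sqr_ge0. Qed.

(** The partial sums from [N] on, frozen once they leave the open interval from
    [- eps] to [eps]. *)
Fixpoint stopped (N : nat) (eps : R) (j : nat) (w : T) : R :=
  if j is i.+1 then stopped N eps i w + x (N + i)%N w * (`|stopped N eps i w| < eps)%R%:R
  else 0.

Lemma measurable_stopped N eps j : measurable_wrt (F (N + j)%N) (stopped N eps j).
Proof.
elim: j => [|j IH] /=; first exact: measurable_wrt_cst.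
have m1 : measurable_wrt (F (N + j).+1) (stopped N eps j).
  exact: measurable_wrt_sub (@FS _) IH.
rewrite addnS; apply: measurable_wrtD => //.
by apply: measurable_wrtM => //; apply: measurable_wrt_lt.
Qed.

(** Only bounded multipliers of the next increment occur before the exit, so that
    the increments are orthogonal to what precedes without further integrability. *)
Lemma stopped_sq_le N eps j : integrableR P (fun w => stopped N eps j w ^+ 2) /\
  \int[P]_w (stopped N eps j w ^+ 2) <= \sum_(N <= l < N + j) e l.
Proof.
elim: j => [|j [IH1 IH2]].
  split; first by rewrite /= expr0n; exact: integrableR_cst.
  by rewrite /= expr0n /= addn0 big_geq// Rintegral_cst// mul0r.
pose s := stopped N eps j; pose b w : R := (`|s w| < eps)%R%:R.
have ms : measurable_wrt (F (N + j)%N) s by exact: measurable_stopped.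
have mb : measurable_wrt (F (N + j)%N) b by exact: measurable_wrt_lt.
have msb : measurable_wrt (F (N + j)%N) (fun w => 2 * (s w * b w)).
  by apply: measurable_wrtM => //; [exact: measurable_wrt_cst|exact: measurable_wrtM].
have sb w : `|2 * (s w * b w)| <= 2 * `|eps|.
  rewrite normrM normr_nat ler_wpM2l// /b; case: ltP => h /=.
    by rewrite mulr1; apply: (le_trans (ltW h)); exact: ler_norm.
  by rewrite mulr0 normr0.
have [ix _ _ _] := x_mean (N + j)%N.
have i2 : integrableR P (fun w => 2 * (s w * b w) * x (N + j)%N w).
  exact: integrableR_bounded_mul (measurable_wrt_fun (@Fm _) msb) sb ix.
have z2 : \int[P]_w (2 * (s w * b w) * x (N + j)%N w) = 0.
  rewrite (condexp_mul_integral (sF _) (@Fm _) (x_mean _) msb sb).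
  under eq_Rintegral do rewrite mulr0.
  by rewrite Rintegral_cst// mul0r.
have b1 w : `|b w| <= 1 by rewrite /b; case: (_ < _); rewrite ?normr1 ?normr0.
have i3 : integrableR P (fun w => b w * x (N + j)%N w ^+ 2).
  exact: integrableR_bounded_mul (measurable_wrt_fun (@Fm _) mb) b1 (x_sq _).
have E w : stopped N eps j.+1 w ^+ 2 =
    s w ^+ 2 + 2 * (s w * b w) * x (N + j)%N w + b w * x (N + j)%N w ^+ 2.
  have bb : b w ^+ 2 = b w by rewrite /b; case: (_ < _); rewrite ?expr1n ?expr0n.
  by rewrite /= -/s -/(b w) sqrrD exprMn bb; ring.
split.
  by under eq_fun do rewrite E; apply: integrableRD => //; exact: integrableRD.
under eq_Rintegral do rewrite E.
rewrite RintegralD//; last exact: integrableRD.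
rewrite RintegralD// z2 addr0 addnS big_nat_recr ?leq_addr//=; apply: lerD => //.
apply: le_Rintegral => // [|w _]; first exact: x_sq.
rewrite -[leRHS]mul1r ler_wpM2r ?sqr_ge0//.
by apply: le_trans (b1 w); exact: ler_norm.
Qed.

Lemma stopped_exit N eps j w : 0 < eps ->
  (forall i, (i <= j)%N -> `|\sum_(N <= l < N + i) x l w| < eps) /\
    stopped N eps j w = \sum_(N <= l < N + j) x l w \/
  eps <= `|stopped N eps j w|.
Proof.
move=> e0; elim: j => [|j [[h1 h2]|h]].
- left; split; last by rewrite addn0 big_geq.
  by move=> i; rewrite leqn0 => /eqP ->; rewrite addn0 big_geq// normr0.
- have E : stopped N eps j.+1 w = \sum_(N <= l < N + j.+1) x l w.
    by rewrite /= h2 h1// mulr1 addnS big_nat_recr ?leq_addr.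
  have [h|h] := ltP `|stopped N eps j.+1 w| eps; last by right.
  left; split => // i; rewrite leq_eqVlt => /predU1P[->|]; first by rewrite -E.
  by rewrite ltnS; exact: h1.
- by right; rewrite /= ltNge h /= mulr0 addr0.
Qed.

Let Q N eps j := [set w | (eps ^+ 2 <= stopped N eps j w ^+ 2)%R].

Let mQ N eps j : measurable (Q N eps j).
Proof.
apply: (@Fm (N + j)%N); apply: wrt_ger => //.
by apply: measurable_wrtX => //; exact: measurable_stopped.
Qed.

Let Q_mono N eps : 0 < eps -> {homo Q N eps : i j / (i <= j)%N >-> (i <= j)%O}.
Proof.
move=> e0 i j /subnKC <-; elim: (j - i)%N => [|k IH]; first by rewrite addn0.
apply: (le_trans IH); rewrite addnS; apply/subsetPset => w; rewrite /Q /= => h.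
rewrite (_ : (`|_| < _) = false) ?mulr0 ?addr0//.
apply/negbTE; rewrite -leNgt -ler_sqr ?nnegrE ?(ltW e0)//.
by rewrite real_normK// num_real.
Qed.

(** Once frozen beyond [eps] the sum stays there: the events increase with [j], and
    the Markov bound for each [j] passes to their union. *)
Lemma maximal_inequality N eps c : 0 < eps ->
  (forall j, \sum_(N <= l < N + j) e l <= c) ->
  (P (\bigcup_j Q N eps j) <= (c / eps ^+ 2)%:E)%E.
Proof.
move=> e0 hc; have mU : measurable (\bigcup_j Q N eps j) by exact: bigcup_measurable.
have := nondecreasing_cvg_mu (mu := P) (mQ N eps) mU (Q_mono N e0).
move=> /cvg_lim <-//; apply: lime_le.
  apply/cvg_ex; eexists; exact: nondecreasing_cvg_mu (mQ N eps) mU (Q_mono N e0).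
apply: nearW => j; have [i1 i2] := stopped_sq_le N eps j.
have h := markov_measure i1 (fun w => sqr_ge0 (stopped N eps j w)) (exprn_gt0 2 e0).
apply: (le_trans h).
by rewrite lee_fin ler_wpM2r ?invr_ge0 ?exprn_ge0 ?(ltW e0)// (le_trans i2).
Qed.

(** The maximal inequality for the tails of the series makes it Cauchy almost
    surely. *)
Theorem martingale_series_cvg (B : R) : (forall n, \sum_(0 <= l < n) e l <= B) ->
  {ae P, forall w, cvgn (series (x ^~ w))}.
Proof.
move=> hB; have ce : cvgn (series e).
  apply: nondecreasing_is_cvgn; first exact: nondecreasing_series.
  by exists B => _ [n _ <-]; rewrite /series/=; exact: hB.
have tail N j : \sum_(N <= l < N + j) e l <= limn (series e) - series e N.
  rewrite lerBrDr addrC.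
  have -> : series e N + \sum_(N <= l < N + j) e l = series e (N + j)%N.
    by rewrite /series/= [RHS](@big_cat_nat _ _ _ N)//= leq_addr.
  by apply: nondecreasing_cvgn_le => //; exact: nondecreasing_series.
have bad i : P (\bigcap_N \bigcup_j Q N (i.+1%:R^-1) j) = 0%E.
  have i0 : 0 < i.+1%:R^-1 :> R by rewrite invr_gt0.
  apply/eqP; rewrite eq_le measure_ge0 andbT.
  apply/lee_addgt0Pr => eps eps0; rewrite add0e.
  have /cvgrPdist_le := ce => /(_ (eps * i.+1%:R^-1 ^+ 2)) [].
    by rewrite mulr_gt0// exprn_gt0.
  move=> N _ hN; have {}hN := hN N (leqnn N).
  apply: (@le_trans _ _ (P (\bigcup_j Q N (i.+1%:R^-1) j))).
    apply: le_measure; rewrite ?inE.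
    - by apply: bigcap_measurable => // k _; exact: bigcup_measurable.
    - exact: bigcup_measurable.
    - by move=> w; apply.
  apply: (le_trans (maximal_inequality i0 (tail N))).
  rewrite lee_fin ler_pdivrMr ?exprn_gt0//.
  by apply: le_trans hN; exact: ler_norm.
have nb i : {ae P, forall w, ~ (\bigcap_N \bigcup_j Q N (i.+1%:R^-1) j) w}.
  exists (\bigcap_N \bigcup_j Q N (i.+1%:R^-1) j); split => //.
    by apply: bigcap_measurable => // k _; exact: bigcup_measurable.
  by move=> w /= /contrapT.
have := ae_foralln nb.
apply: filterS => w hw; apply/cauchy_cvgP/cauchy_seriesP => eps eps0.
pose i := Num.truncn (2 / eps).
have i_eps : i.+1%:R^-1 + i.+1%:R^-1 < eps.
  rewrite -mulr2n -[_ *+ 2]mulr_natl ltr_pdivrMr//.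
  by rewrite mulrC -ltr_pdivrMr//; exact: truncnS_gt.
have i0 : 0 < i.+1%:R^-1 :> R by rewrite invr_gt0.
have [N hN] : exists N, forall j, `|\sum_(N <= l < N + j) x l w| < i.+1%:R^-1.
  have := hw i; apply: contra_notP => /forallNP hn N _.
  have /existsNP [j hj] := hn N; exists j => //; rewrite /Q /=.
  have [[h1 h2]|h] := stopped_exit N j w i0; first by exfalso; apply: hj; exact: h1.
  rewrite -[stopped _ _ _ _ ^+ 2]real_normK ?num_real//.
  by rewrite ler_sqr ?nnegrE// ltW.
exists ([set n | (N <= n)%N], [set n | (N <= n)%N]).
  by split; exists N.
move=> [a b] /= [Na Nb]; have [ab|ba] := leqP a b; last first.
  by rewrite big_geq ?normr0// ltnW.
have -> : \sum_(a <= k < b) x k w = \sum_(N <= k < b) x k w - \sum_(N <= k < a) x k w.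
  by rewrite [X in _ = X - _](@big_cat_nat _ _ _ a N b)//= addrAC subrr add0r.
apply: (le_lt_trans (ler_normB _ _)); apply: lt_trans i_eps; apply: ltrD.
  by have := hN (b - N)%N; rewrite subnKC.
by have := hN (a - N)%N; rewrite subnKC.
Qed.

End convergence.

(** The weights [1 / w (l+1)], where [w n = 1 + \sum_(l < n) `|a l|], are
    predictable, and [\sum_l `|a l| / w (l+1) ^ 2] telescopes below 1: the weighted
    martingale is bounded in L2 whatever the size of its quadratic variation, so it
    converges, and [kronecker_le] removes the weights.  The absolute values only
    serve to have positive weights everywhere, as [a l] is a conditional
    expectation and thus nonnegative almost surely only. *)
Theorem martingale_slln (D a : nat -> T -> R) :
  (forall l, measurable_wrt (F l.+1) (D l)) ->
  (forall l, is_condexp P (F l) (D l) (fun=> 0)) ->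
  (forall l, is_condexp P (F l) (fun w => D l w ^+ 2) (a l)) ->
  {ae P, forall w, forall eps : R, 0 < eps -> exists C : R, forall n,
    `|\sum_(0 <= l < n) D l w| <= eps * (1 + \sum_(0 <= l < n) `|a l w|) + C}.
Proof.
move=> mD D0 Da; pose wt n w : R := 1 + \sum_(0 <= l < n) `|a l w|.
have wt_ge1 n w : 1 <= wt n w by rewrite lerDl sumr_ge0.
have wt_gt0 n w : 0 < wt n w by exact: lt_le_trans (wt_ge1 n w).
have wtS n w : wt n.+1 w = wt n w + `|a n w| by rewrite /wt big_nat_recr//= addrA.
have ma l : measurable_wrt (F l) (a l) by case: (Da l).
have mwt n : measurable_wrt (F n) (wt n.+1).
  rewrite /wt; apply: measurable_wrtD => //; first exact: measurable_wrt_cst.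
  under eq_fun do rewrite big_mkord; apply: measurable_wrt_sum => // i.
  apply: measurable_wrt_norm => //; apply: measurable_wrt_sub (ma i).
  by apply: filtration_le; rewrite -ltnS.
pose h l w := (wt l.+1 w)^-1.
have mh l : measurable_wrt (F l) (h l) by apply: measurable_wrt_inv.
have h_gt0 l w : 0 < h l w by rewrite invr_gt0.
have h1 l w : `|h l w| <= 1 by rewrite gtr0_norm// invf_le1.
pose x l w := h l w * D l w.
have x_meas l : measurable_wrt (F l.+1) (x l).
  by apply: measurable_wrtM => //; exact: measurable_wrt_sub (@FS _) (mh l).
have x_mean l : is_condexp P (F l) (x l) (fun=> 0).
  have := condexp_mul (sF l) (@Fm l) (D0 l) (mh l) (h1 l).
  by rewrite (_ : (fun w => h l w * 0) = fun=> 0)//; apply/funext => w; rewrite mulr0.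
have mh2 l : measurable_wrt (F l) (fun w => h l w ^+ 2) by exact: measurable_wrtX.
have h21 l w : `|h l w ^+ 2| <= 1 by rewrite normrX exprn_ile1.
have iD2 l : integrableR P (fun w => D l w ^+ 2) by case: (Da l).
have ia l : integrableR P (a l) by case: (Da l).
have x_sq l : integrableR P (fun w => x l w ^+ 2).
  under eq_fun do rewrite exprMn.
  exact: integrableR_bounded_mul (measurable_wrt_fun (@Fm _) (mh2 l)) (h21 l) (iD2 l).
have ih l : integrableR P (fun w => h l w ^+ 2 * `|a l w|).
  apply: integrableR_bounded_mul (measurable_wrt_fun (@Fm _) (mh2 l)) (h21 l) _.
  exact: (integrable_norm (ia l)).
have xe l : \int[P]_w (x l w ^+ 2) <= \int[P]_w (h l w ^+ 2 * `|a l w|).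
  under eq_Rintegral do rewrite exprMn.
  rewrite (condexp_mul_integral (sF l) (@Fm l) (Da l) (mh2 l) (h21 l)).
  apply: le_Rintegral => //; [|exact: ih|move=> w _].
    exact: integrableR_bounded_mul (measurable_wrt_fun (@Fm _) (mh2 l)) (h21 l) (ia l).
  by rewrite ler_wpM2l ?sqr_ge0// ler_norm.
have tel w n : \sum_(0 <= l < n) h l w ^+ 2 * `|a l w| <= 1 - (wt n w)^-1.
  elim: n => [|n IH]; first by rewrite big_geq// /wt big_geq// addr0 invr1 subrr.
  rewrite big_nat_recr//=; apply: (le_trans (lerD IH (lexx _))).
  suff : h n w ^+ 2 * `|a n w| <= (wt n w)^-1 - (wt n.+1 w)^-1 by lra.
  have -> : (wt n w)^-1 - (wt n.+1 w)^-1 = `|a n w| / (wt n w * wt n.+1 w).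
    have -> : `|a n w| = wt n.+1 w - wt n w by rewrite wtS addrC addKr.
    by field; rewrite !gt_eqF.
  rewrite /h exprVn mulrC ler_wpM2l// lef_pV2 ?posrE ?mulr_gt0 ?exprn_gt0//.
  by rewrite expr2 ler_wpM2r ?(ltW (wt_gt0 _ _))// wtS lerDl.
have hB n : \sum_(0 <= l < n) \int[P]_w (x l w ^+ 2) <= 1.
  apply: (@le_trans _ _ (\sum_(0 <= l < n) \int[P]_w (h l w ^+ 2 * `|a l w|))).
    by apply: ler_sum => l _; exact: xe.
  rewrite -RintegralT_sum//; apply: (@le_trans _ _ (\int[P]_w 1)).
    apply: le_Rintegral => //.
    - exact: integrableR_sum.
    - exact: integrableR_cst.
    - by move=> w _; apply: (le_trans (tel w n)); rewrite gerBl invr_ge0 ltW.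
  by rewrite Rintegral_cst// mul1r -[leRHS]/(fine 1%E) -(probability_setT P).
have := martingale_series_cvg x_meas x_mean x_sq hB.
apply: filterS => w cw eps e0.
have [||C hC] := @kronecker_le _ (wt ^~ w) (x ^~ w) _ _ cw eps e0.
- move=> i j /subnKC <-; elim: (j - i)%N => [|k IH]; first by rewrite addn0.
  by apply: (le_trans IH); rewrite addnS wtS lerDl.
- exact: ltW.
exists C => n; apply: le_trans (hC n); rewrite le_eqVlt; apply/orP; left; apply/eqP.
congr (`|_|); apply: eq_bigr => l _.
by rewrite /x /h mulVKf// gt_eqF.
Qed.

(** The transform need not be square integrable: cutting the multipliers at
    levels exceeded with summable probabilities changes finitely many terms only. *)
Theorem martingale_transform_slln (H D a : nat -> T -> R) :
  (forall l, measurable_wrt (F l) (H l)) ->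
  (forall l, integrableR P (fun w => H l w ^+ 2)) ->
  (forall l, measurable_wrt (F l.+1) (D l)) ->
  (forall l, is_condexp P (F l) (D l) (fun=> 0)) ->
  (forall l, is_condexp P (F l) (fun w => D l w ^+ 2) (a l)) ->
  {ae P, forall w, forall eps : R, 0 < eps -> exists C : R, forall n,
    `|\sum_(0 <= l < n) H l w * D l w| <=
    eps * (1 + \sum_(0 <= l < n) H l w ^+ 2 * `|a l w|) + C}.
Proof.
move=> mH iH mD D0 Da.
(* By the Markov inequality the level [c l] is exceeded with probability at most
   [2 ^ (- l)]; the added 1 keeps it positive. *)
pose c l : R := 2 ^+ l * (\int[P]_w (H l w ^+ 2) + 1).
have EH0 l : 0 <= \int[P]_w (H l w ^+ 2) by apply: Rintegral_ge0 => w _; exact: sqr_ge0.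
have c_gt0 l : 0 < c l by rewrite mulr_gt0 ?exprn_gt0// ltr_wpDl.
pose b l w : R := (`|H l w ^+ 2| < c l)%R%:R.
have mb l : measurable_wrt (F l) (b l).
  by apply: measurable_wrt_lt => //; exact: measurable_wrtX.
pose H' l w := b l w * H l w.
have mH' l : measurable_wrt (F l) (H' l) by exact: measurable_wrtM.
have bb l w : b l w ^+ 2 = b l w by rewrite /b; case: (_ < _); rewrite ?expr1n ?expr0n.
have H'2 l w : `|H' l w ^+ 2| <= c l.
  rewrite /H' exprMn bb /b; case: ltP => h /=; last by rewrite mul0r normr0 ltW.
  by rewrite mul1r ltW.
have H'1 l w : `|H' l w| <= c l + 1.
  have := sqr_ge0 (`|H' l w| - 1); have := H'2 l w.
  by rewrite normrX sqrrB1 => h1 h2; move: h1 h2; have := normr_ge0 (H' l w); nra.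
have mD' l : measurable_wrt (F l.+1) (fun w => H' l w * D l w).
  by apply: measurable_wrtM => //; exact: measurable_wrt_sub (@FS _) (mH' l).
have D'0 l : is_condexp P (F l) (fun w => H' l w * D l w) (fun=> 0).
  have := condexp_mul (sF l) (@Fm l) (D0 l) (mH' l) (H'1 l).
  by rewrite (_ : (fun w => H' l w * 0) = fun=> 0)//; apply/funext => w; rewrite mulr0.
have D'a l : is_condexp P (F l) (fun w => (H' l w * D l w) ^+ 2)
    (fun w => H' l w ^+ 2 * a l w).
  rewrite (_ : (fun w => (H' l w * D l w) ^+ 2) = fun w => H' l w ^+ 2 * D l w ^+ 2).
    apply: (condexp_mul (sF l) (@Fm l) (Da l) _ (H'2 l)).
    exact: measurable_wrtX.
  by apply/funext => w; rewrite exprMn.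
have main := martingale_slln mD' D'0 D'a.
have mE l : measurable [set w | (c l <= H l w ^+ 2)%R].
  by apply: (@Fm l); apply: wrt_ger => //; exact: measurable_wrtX.
have PE l : (P [set w | (c l <= H l w ^+ 2)%R] <= (1 * 2^-1 ^+ l)%:E)%E.
  apply: (le_trans (markov_measure (iH l) (fun w => sqr_ge0 (H l w)) (c_gt0 l))).
  rewrite lee_fin mul1r ler_pdivrMr// /c exprVn mulKf ?lerDl//.
have half : 0 <= (2^-1 : R) < 1 by rewrite invr_ge0 ler0n/= invf_lt1// ltr1n.
have BC := borel_cantelli_ae mE PE (fun n => sum_geometric_le n ler01 half).
apply: filterS2 main BC => w hw [N hN] eps e0.
have [C hC] := hw eps e0.
have same l : (N <= l)%N -> H' l w = H l w.
  move=> Nl; rewrite /H' /b ger0_norm ?sqr_ge0// ltNge.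
  by have /negP/negbTE -> := hN l Nl; rewrite mul1r.
pose K := \sum_(0 <= l < N) `|(H l w - H' l w) * D l w|.
exists (C + K) => n.
have -> : \sum_(0 <= l < n) H l w * D l w = \sum_(0 <= l < n) H' l w * D l w +
    \sum_(0 <= l < n) (H l w - H' l w) * D l w.
  by rewrite -big_split/=; apply: eq_bigr => l _; ring.
rewrite addrA; apply: (le_trans (ler_normD _ _)); apply: lerD.
  apply: (le_trans (hC n)); rewrite lerD2r ler_wpM2l ?(ltW e0)// lerD2l.
  apply: ler_sum => l _; rewrite normrM (ger0_norm (sqr_ge0 _)) ler_wpM2r//.
  rewrite /H' exprMn bb -[leRHS]mul1r ler_wpM2r ?sqr_ge0// /b.
  by case: (_ < _); rewrite ?lexx.
apply: (le_trans (ler_norm_sum _ _ _)); have [nN|Nn] := leqP n N.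
  rewrite /K (@big_cat_nat _ _ _ n 0 N)//= lerDl; exact: sumr_ge0.
rewrite (@big_cat_nat _ _ _ N 0 n)//= ?(ltnW Nn)// -[leRHS]addr0 lerD2l.
rewrite big_nat_cond big1// => l; rewrite andbT => /andP[Nl _].
by rewrite same// subrr mul0r normr0.
Qed.

End martingale_convergence.


(** * Growth under conditional moment bounds *)

Section powers.
Context {R : realType}.

Lemma powR_eventually_ge (eta A : R) : 0 < eta ->
  exists N : nat, forall n, (N <= n)%N -> A <= n%:R `^ eta.
Proof.
move=> eta0; pose B := `|A| + 1; have B0 : 0 < B by rewrite ltr_wpDl.
exists (Num.truncn (B `^ eta^-1)).+1 => n Nn.
have Bn : B `^ eta^-1 <= n%:R.
  by apply: ltW; apply: lt_le_trans (truncnS_gt _) _; rewrite ler_nat.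
apply: (@le_trans _ _ B); first by apply: (le_trans (ler_norm _)); rewrite lerDl.
apply: (@le_trans _ _ ((B `^ eta^-1) `^ eta)).
  by rewrite -powRrM mulVf ?gt_eqF// powRr1// ltW.
by apply: ge0_ler_powR; rewrite ?nnegrE ?powR_ge0// ltW.
Qed.

(** Comparison with the telescoping series of [s^-1 * (n ^ (- s) - (n+1) ^ (- s))]. *)
Lemma pseries_bounded (s : R) n : 0 < s ->
  \sum_(0 <= k < n) k.+1%:R `^ (- (1 + s)) <= 1 + s^-1.
Proof.
move=> s0; have s'0 : 0 < s^-1 by rewrite invr_gt0.
case: n => [|n]; first by rewrite big_geq// addr_ge0// ltW.
apply: (@le_trans _ _ (1 + s^-1 * (1 - n.+1%:R `^ (- s)))); last first.
  by rewrite lerD2l ler_piMr ?(ltW s'0)// gerBl powR_ge0.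
elim: n => [|n IH].
  by rewrite big_nat1 !powR1 subrr mulr0 addr0.
rewrite big_nat_recr//=; apply: (le_trans (lerD IH (lexx _))).
have n0 : 0 < n.+1%:R :> R by []. have n1 : 0 < n.+2%:R :> R by [].
set a := n.+1%:R `^ (- s); set b := n.+2%:R `^ (- s).
have b0 : 0 < b by exact: powR_gt0.
have e1 : n.+2%:R `^ (- (1 + s)) = b * n.+2%:R^-1.
  have -> : - (1 + s) = - s + -1 by ring.
  have nz : n.+2%:R != 0 :> R by [].
  by rewrite powRD ?nz ?implybT// powR_inv1.
have hln : ln n.+1%:R <= ln n.+2%:R - n.+2%:R^-1 :> R.
  have -> : ln n.+2%:R - n.+2%:R^-1 = ln (n.+2%:R * expR (- n.+2%:R^-1)) :> R.
    by rewrite lnM ?posrE ?expR_gt0// expRK.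
  rewrite ler_ln ?posrE ?mulr_gt0 ?expR_gt0//.
  apply: (@le_trans _ _ (n.+2%:R * (1 - n.+2%:R^-1))).
    by rewrite mulrBr mulr1 mulfV ?gt_eqF// -[n.+2%:R]natr1 addrK.
  by rewrite ler_wpM2l ?(ltW n1)// expR_ge1Dx.
have hab : b * (1 + s * n.+2%:R^-1) <= a.
  have -> : a = b * expR (s * (ln n.+2%:R - ln n.+1%:R)).
    by rewrite /a /b /powR !gt_eqF// -expRD; congr expR; ring.
  rewrite ler_wpM2l ?(ltW b0)//; apply: le_trans (expR_ge1Dx _).
  by rewrite lerD2l ler_wpM2l ?(ltW s0)// lerBrDl -lerBrDr.
rewrite e1; have : s^-1 * (b * (1 + s * n.+2%:R^-1)) <= s^-1 * a by rewrite ler_wpM2l// ltW.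
have -> : s^-1 * (b * (1 + s * n.+2%:R^-1)) = s^-1 * b + b * n.+2%:R^-1.
  by field; rewrite !gt_eqF.
by move: (n.+2%:R^-1) => y; lra.
Qed.

(** As [y] is nondecreasing, the bounds of the increments grow at least
    geometrically, and their sum is comparable to the last one. *)
Lemma geometric_increments (N y : nat -> R) (r : R) (N0 : nat) : 1 < r ->
  (forall n, 0 <= y n) -> (forall n, y n <= y n.+1) ->
  (forall n, (N0 <= n)%N -> `|N n.+1 - N n| <= y n.+1 * r ^+ n.+1) ->
  forall n, (N0 <= n)%N -> `|N n| <= `|N N0| + r / (r - 1) * (y n * r ^+ n).
Proof.
move=> r1 y0 yS hN n /subnKC <-; have r0 : 0 < r by exact: lt_trans r1.
have r10 : 0 < r - 1 by rewrite subr_gt0.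
elim: (n - N0)%N => [|k IH].
  by rewrite addn0 lerDl mulr_ge0 ?divr_ge0 ?mulr_ge0 ?exprn_ge0// ltW.
rewrite addnS; have h := hN _ (leq_addr k N0).
have -> : N (N0 + k).+1 = N (N0 + k)%N + (N (N0 + k).+1 - N (N0 + k)%N) by rewrite addrC subrK.
apply: (le_trans (ler_normD _ _)); apply: (le_trans (lerD IH h)); rewrite -addrA lerD2l.
have h2 : r / (r - 1) * (y (N0 + k)%N * r ^+ (N0 + k)) <=
    r / (r - 1) * (y (N0 + k).+1 * r ^+ (N0 + k)).
  by rewrite ler_wpM2l ?divr_ge0 ?(ltW r0) ?(ltW r10)// ler_wpM2r// exprn_ge0// ltW.
apply: (le_trans (lerD h2 (lexx _))).
by rewrite exprS le_eqVlt; apply/orP; left; apply/eqP; field; rewrite gt_eqF.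
Qed.

End powers.

Section conditional_moment_bound.
Context {d : measure_display} {T : measurableType d} {R : realType}.
Variables (P : probability T R) (F : nat -> set (set T)).
Hypothesis Fm : forall n, F n `<=` measurable.

(** Markov's inequality on the events where the conditional expectation is
    bounded by a given constant, which are known one step ahead. *)
Lemma condexp_markov (G : set (set T)) (U : T -> R) (C : T -> \bar R) (c lam : R) :
  G `<=` measurable -> is_condexp_ge0 P G (EFin \o U) C -> 0 <= c -> 0 < lam ->
  measurable ([set x | (C x <= c%:E)%E] `&` [set x | (lam <= U x)%R]) /\
  (P ([set x | (C x <= c%:E)%E] `&` [set x | (lam <= U x)%R]) <= (c / lam)%:E)%E.
Proof.
move=> Gm [mU U0 mC C0 CU] c0 lam0.
set A := [set x | (C x <= c%:E)%E]; set B := [set x | (lam <= U x)%R].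
have GA : G A.
  have := mC [set y | (y <= c%:E)%E]; apply.
  have -> : [set y | (y <= c%:E)%E] = `]-oo, c%:E]%classic.
    by apply/seteqP; split => y; rewrite /= in_itv.
  exact: emeasurable_itv.
have mA := Gm _ GA.
have mU' : measurable_fun setT U by exact/measurable_EFinP.
have mB : measurable B.
  by rewrite -[X in measurable X]setTI; apply: (measurable_fun_ler _ _) => //.
have mAB := measurableI _ _ mA mB.
split => //.
have h : (lam%:E * P (A `&` B) <= c%:E)%E.
  rewrite -integral_cst//.
  apply: (@le_trans _ _ (\int[P]_(x in A `&` B) (U x)%:E)%E).
    apply: ge0_le_integral => //.
    - by move=> x _; rewrite lee_fin ltW.
    - exact: measurable_funTS.
    - by move=> x [_ Bx]; rewrite lee_fin.
  apply: (@le_trans _ _ (\int[P]_(x in A) (U x)%:E)%E).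
    apply: ge0_subset_integral => //; first exact: measurable_funTS.
    by move=> x _; exact: U0.
  have := CU A GA => /= <-.
  apply: (@le_trans _ _ (\int[P]_(x in A) c%:E)%E).
    apply: ge0_le_integral => //.
    apply: measurable_funTS; exact: measurable_wrt_fun Gm mC.
  rewrite integral_cst// -[leRHS]mule1; apply: lee_pmul => //.
  exact: probability_le1.
have := fin_num_measure P _ mAB.
move=> /fineK pE; rewrite -pE in h *; move: h.
by rewrite -EFinM !lee_fin ler_pdivlMr// mulrC.
Qed.

(** On the event that the conditional expectations are at most [k], the
    probabilities of exceeding [n ^ q] are at most [k * n ^ (- q)], which is
    summable; these events exhaust the whole space as [k] grows. *)
Lemma conditional_moment_growth (U : nat -> T -> R) (C : nat -> T -> \bar R) (q : R) :
  (forall n, (0 < n)%N -> is_condexp_ge0 P (F n.-1) (EFin \o U n) (C n)) ->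
  {ae P, forall x, (ereal_sup [set C n x | n in [set n | (0 < n)%N]] < +oo)%E} ->
  1 < q ->
  {ae P, forall x, exists N, forall n, (N <= n)%N -> U n.+1 x < n.+1%:R `^ q}.
Proof.
move=> hC hsup q1.
have BC k : {ae P, forall x, exists N, forall n, (N <= n)%N ->
    ~ ([set x | (C n.+1 x <= k%:R%:E)%E] `&` [set x | (n.+1%:R `^ q <= U n.+1 x)%R]) x}.
  have n0 n : 0 < n.+1%:R `^ q :> R by exact: powR_gt0.
  have h n := @condexp_markov (F n) (U n.+1) (C n.+1) k%:R (n.+1%:R `^ q) (@Fm n)
    (hC n.+1 isT) (ler0n _ _) (n0 n).
  apply: (@borel_cantelli_ae _ _ _ P _ (fun n => k%:R * n.+1%:R `^ (- (1 + (q - 1))))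
    (k%:R * (1 + (q - 1)^-1))).
  - by move=> n; case: (h n).
  - by move=> n; have [_] := h n; rewrite addrC subrK powRN.
  - by move=> n; rewrite -mulr_sumr ler_wpM2l// pseries_bounded// subr_gt0.
apply: filterS2 hsup (ae_foralln BC) => x hx hBC.
pose s := ereal_sup [set C n x | n in [set n | (0 < n)%N]].
have Cs n : (C n.+1 x <= s)%E by apply: ereal_sup_ubound; exists n.+1.
have s0 : (0 <= s)%E.
  by apply: le_trans (Cs 0%N); have [] := hC 1%N isT.
have sfin : s \is a fin_num by rewrite ge0_fin_numE.
pose k := (Num.truncn (fine s)).+1.
have [N hN] := hBC k; exists N => n Nn; rewrite ltNge; apply/negP => hU.
apply: (hN n Nn); split => //=; apply: (le_trans (Cs n)).
by rewrite -(fineK sfin) lee_fin ltW// truncnS_gt.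
Qed.

End conditional_moment_bound.

(** * Limits of determinants and inverse matrices *)

Section matrix_limits.
Context {R : realType}.

Lemma cvg_bigsum (I : Type) (r : seq I) (u : I -> nat -> R) (l : I -> R) :
  (forall i, u i @ \oo --> l i) ->
  (fun n => \sum_(i <- r) u i n) @ \oo --> \sum_(i <- r) l i.
Proof.
move=> h; elim: r => [|i r IH].
  under eq_fun do rewrite big_nil; rewrite big_nil; exact: cvg_cst.
by under eq_fun do rewrite big_cons; rewrite big_cons; exact: cvgD.
Qed.

Lemma cvg_bigprod (I : Type) (r : seq I) (u : I -> nat -> R) (l : I -> R) :
  (forall i, u i @ \oo --> l i) ->
  (fun n => \prod_(i <- r) u i n) @ \oo --> \prod_(i <- r) l i.
Proof.
move=> h; elim: r => [|i r IH].
  under eq_fun do rewrite big_nil; rewrite big_nil; exact: cvg_cst.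
by under eq_fun do rewrite big_cons; rewrite big_cons; exact: cvgM.
Qed.

Lemma cvg_mx_entry p q (A : nat -> 'M[R]_(p, q)) (L : 'M[R]_(p, q)) i j :
  A @ \oo --> L -> (fun n => A n i j) @ \oo --> L i j.
Proof.
by move=> h; apply: (@cvg_comp _ _ _ A (fun M : 'M[R]_(p, q) => M i j) _ _ _ h); exact: coord_continuous.
Qed.

Lemma cvg_det p (A : nat -> 'M[R]_p) (L : 'M[R]_p) :
  (forall i j, (fun n => A n i j) @ \oo --> L i j) ->
  (fun n => \det (A n)) @ \oo --> \det L.
Proof.
move=> h; apply: cvg_bigsum => s; apply: cvgM; first exact: cvg_cst.
exact: cvg_bigprod.
Qed.

Lemma cvg_invmx p (A : nat -> 'M[R]_p) (L : 'M[R]_p) :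
  (forall i j, (fun n => A n i j) @ \oo --> L i j) ->
  (forall n, A n \in unitmx) -> L \in unitmx ->
  forall i j, (fun n => invmx (A n) i j) @ \oo --> invmx L i j.
Proof.
move=> h uA uL i j.
have dL : \det L != 0 by rewrite -unitfE -unitmxE.
under eq_fun do rewrite /invmx uA !mxE.
rewrite /invmx uL !mxE; apply: cvgM; first by apply: cvgV => //; exact: cvg_det.
rewrite /cofactor; apply: cvgM; first exact: cvg_cst.
by apply: cvg_det => k l; under eq_fun do rewrite !mxE; rewrite !mxE; exact: h.
Qed.

End matrix_limits.

(** * The observation filtration *)

Section observation_filtration.
Context {d : measure_display} {T : measurableType d} {R : realType}.
Variable P : probability T R.
Variable xi : nat -> {mfun T >-> (bool * bool)%type}.
Variable delta : nat -> T -> bool.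
Hypothesis hdelta : gw_tree xi delta.
Variable X : nat -> {RV P >-> R}.

Let F := obs_filtration delta (fun k => X k : T -> R).

Lemma mem_Tree n k : k \in Tree n -> (0 < k)%N.
Proof.
move=> /flatten_mapP [l _]; rewrite /Gen mem_index_iota => /andP[h _].
by apply: leq_trans h; rewrite expn_gt0.
Qed.

Lemma TreeS n : Tree n.+1 = Tree n ++ Gen n.+1.
Proof. by rewrite /Tree -(addn1 n.+1) iotaD map_cat flatten_cat /= cats0 add0n. Qed.

Lemma measurable_delta k (B : set bool) : (0 < k)%N -> measurable (delta k @^-1` B).
Proof.
move=> k0; pose n := trunc_log 2 k.
have kn : (2 ^ n <= k < 2 ^ n.+1)%N by rewrite trunc_logP//= trunc_log_ltn.
rewrite (_ : delta k @^-1` B = [set x | alive n (wordof xi (2 ^ n).-1 x) k \in B]).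
  exact: (measurable_wordof xi (2 ^ n).-1 (fun v => alive n v k \in B)).
apply/seteqP; split => x /=; rewrite (delta_alive hdelta x kn (leqnn _)).
  exact: mem_set.
exact: set_mem.
Qed.

Lemma obs_filtration_sigma n : sigma_algebra [set: T] (F n).
Proof. exact: smallest_sigma_algebra. Qed.

Lemma obs_filtration_measurable n : F n `<=` measurable.
Proof.
apply: smallest_sub; first exact: sigma_algebra_measurable.
move=> A [|].
  apply: smallest_sub; first exact: sigma_algebra_measurable.
  move=> B [k /= k0 [Y mY <-]]; rewrite setTI; exact: measurable_delta.
move=> [k /= kn [Y mY <-]].
have mf : measurable_fun setT (fun x => (delta k x)%:R * X k x : R).
  apply: measurable_funM; last exact: measurable_funP.
  rewrite (_ : (fun x => _) = \1_(delta k @^-1` [set true]) :> (T -> R)).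
    by apply: measurable_indic; apply: measurable_delta; exact: mem_Tree kn.
  apply/funext => x; rewrite indicE; congr ((nat_of_bool _)%:R).
  by apply/idP/idP; rewrite inE.
exact: mf.
Qed.

Lemma obs_filtrationS n : F n `<=` F n.+1.
Proof.
apply: sub_sigma_algebra2; apply: setUS => A [k /= kn h]; exists k => //=.
by rewrite TreeS mem_cat kn.
Qed.

Lemma obs_sigma_sub n : obs_sigma delta `<=` F n.
Proof. by move=> A hA; apply: sub_sigma_algebra; left. Qed.

Lemma size_TstarE n x : size (Tstar delta n x) = (\sum_(0 <= l < n.+1) size (Gstar delta l x))%N.
Proof.
elim: n => [|n IH]; first by rewrite big_nat1 /Tstar /Gstar /Tree /= ?cats0.
by rewrite big_nat_recr//= -IH /Tstar TreeS filter_cat size_cat.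
Qed.

Lemma size_Gstar0 x : size (Gstar delta 0 x) = 1%N.
Proof. by have [h _] := hdelta; rewrite /Gstar /Gen /index_iota /= h. Qed.

Lemma measurable_wrt_size_Tstar l n :
  measurable_wrt (F n) (fun x => (size (Tstar delta l x))%:R : R).
Proof.
pose b k x : R := (if (0 < k)%N then delta k x else false)%:R.
have -> : (fun x => (size (Tstar delta l x))%:R : R) = fun x => \sum_(k <- Tree l) b k x.
  apply/funext => x; rewrite /Tstar size_filter -sum1_count natr_sum big_mkcond/=.
  rewrite !big_seq; apply: eq_bigr => k kl; rewrite /b (mem_Tree kl).
  by case: (delta k x).
apply: measurable_wrt_sum; first exact: obs_filtration_sigma.
move=> k; rewrite /b; case: ltnP => k0; last first.
  by apply: measurable_wrt_cst; exact: obs_filtration_sigma.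
rewrite (_ : (fun x => _) = \1_(delta k @^-1` [set true]) :> (T -> R)); last first.
  apply/funext => x; rewrite indicE; congr ((nat_of_bool _)%:R).
  by apply/idP/idP; rewrite inE.
apply: measurable_wrt_indic; first exact: obs_filtration_sigma.
apply: obs_sigma_sub; apply: sub_sigma_algebra; exists k => //=.
by exists [set true]; rewrite ?setTI.
Qed.

End observation_filtration.


(** * Asymptotics of the bifurcating martingale *)

Section assembly.
Context {d : measure_display} {T : measurableType d} {R : realType}.
Variables (P : probability T R) (p0 p1 p01 : R).
Variable xi : nat -> {mfun T >-> (bool * bool)%type}.
Variable delta : nat -> T -> bool.
Hypothesis hxi : reproduction P p0 p1 p01 xi.
Hypothesis hdelta : gw_tree xi delta.
Variable X : nat -> {RV P >-> R}.
Let F := obs_filtration delta (fun k => X k : T -> R).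
Variable m : R.
Hypothesis hm : m = 2 * p01 + p0 + p1.
Hypothesis m_gt1 : 1 < m.
Variables (p : nat) (W : nat -> T -> 'cV[R]_p).
Let M := Mproc delta W.
Hypothesis M_martingale : martingale_mx P F M.
Variable Gam : nat -> T -> 'M[R]_p.
Hypothesis hGam : forall n, is_condexp_mx P (F n)
  (fun x => (M n.+1 x - M n x) *m (M n.+1 x - M n x)^T) (Gam n).
Hypothesis A1 : forall n, square_integrable_mx P (M n).

Let sF n : sigma_algebra [set: T] (F n).
Proof. exact: obs_filtration_sigma. Qed.

Let Fm n : F n `<=` measurable.
Proof. exact: obs_filtration_measurable hdelta X n. Qed.

Let FS n : F n `<=` F n.+1.
Proof. exact: obs_filtrationS. Qed.

Let t n x : R := (size (Tstar delta n x))%:R.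

Lemma tE n x : t n x = \sum_(0 <= l < n.+1) (size (Gstar delta l x))%:R.
Proof. by rewrite /t size_TstarE natr_sum. Qed.

Let t_ge1 n x : 1 <= t n x.
Proof.
rewrite tE big_ltn// (size_Gstar0 hdelta) lerDl.
by apply: sumr_ge0 => i _; rewrite ler0n.
Qed.

Let t_gt0 n x : 0 < t n x. Proof. exact: lt_le_trans (t_ge1 n x). Qed.

Let t_nd n x : t n x <= t n.+1 x.
Proof. by rewrite !tE [leRHS]big_nat_recr//= lerDl. Qed.

Let mt n l : measurable_wrt (F n) (t l).
Proof. exact: measurable_wrt_size_Tstar. Qed.

Let mtV n l : measurable_wrt (F n) (fun x => (t l x)^-1).
Proof. by apply: measurable_wrt_inv => // x. Qed.

Let tV1 l x : `|(t l x)^-1| <= 1.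
Proof. by rewrite gtr0_norm ?invr_gt0// invf_le1. Qed.

Let mM n i : measurable_wrt (F n) (fun x => M n x i 0).
Proof. by have [] := M_martingale n i 0. Qed.

Let iM n i : integrableR P (fun x => M n x i 0).
Proof. by have [] := M_martingale n i 0. Qed.

Let mMS n i : measurable_wrt (F n.+1) (fun x => M n x i 0).
Proof. exact: measurable_wrt_sub (@FS n) (@mM n i). Qed.

Let iM2 n i : integrableR P (fun x => M n x i 0 ^+ 2).
Proof. by have [] := A1 n i 0. Qed.

Let D n i x : R := M n.+1 x i 0 - M n x i 0.

Let mD n i : measurable_wrt (F n.+1) (D n i).
Proof. exact: (measurable_wrtB (sF n.+1) (@mM n.+1 i) (@mMS n i)). Qed.

Let D0 n i : is_condexp P (F n) (D n i) (fun=> 0).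
Proof.
have := condexpB (sF n) (@Fm n) (M_martingale n i 0) (condexp_id (iM n i) (@mM n i)).
by rewrite (_ : (fun x => M n x i 0 - M n x i 0) = fun=> 0)//; apply/funext => x; rewrite subrr.
Qed.

Let DGam n i j : is_condexp P (F n) (fun x => D n i x * D n j x) (fun x => Gam n x i j).
Proof.
have := hGam n i j; congr is_condexp; apply/funext => x.
by rewrite !mxE big_ord1 !mxE.
Qed.

(** [M l / t l] is known at time [l], so this is a martingale transform. *)
Lemma cross_martingale_slln i j : {ae P, forall x, forall eps : R, 0 < eps ->
  exists C : R, forall n, `|\sum_(0 <= l < n) M l x i 0 * D l j x / t l x| <=
    eps * (1 + \sum_(0 <= l < n) M l x i 0 ^+ 2 * `|Gam l x j j| / t l x ^+ 2) + C}.
Proof.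
pose H l x := (t l x)^-1 * M l x i 0.
have mH l : measurable_wrt (F l) (H l) by exact: measurable_wrtM.
have H2 l : integrableR P (fun x => H l x ^+ 2).
  apply: (integrableR_le _ (iM2 l i)).
    exact: measurable_wrt_fun (@Fm l) (measurable_wrtX (sF l) 2 (mH l)).
  move=> x; rewrite ger0_norm ?sqr_ge0// /H exprMn ler_piMl ?sqr_ge0//.
  by rewrite -[_ ^+ 2]ger0_norm ?sqr_ge0// normrX exprn_ile1.
have Da l : is_condexp P (F l) (fun x => D l j x ^+ 2) (fun x => Gam l x j j).
  exact: DGam.
have := martingale_transform_slln sF Fm FS mH H2 (fun l => @mD l j) (fun l => D0 l j) Da.
apply: filterS => x hx eps e0; have [C hC] := hx eps e0; exists C => n.
have -> : \sum_(0 <= l < n) M l x i 0 * D l j x / t l x = \sum_(0 <= l < n) H l x * D l j x.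
  by apply: eq_bigr => l _; rewrite /H; ring.
apply: (le_trans (hC n)); rewrite le_eqVlt; apply/orP; left; apply/eqP.
congr (_ * (_ + _) + _); apply: eq_bigr => l _.
by rewrite /H exprMn exprVn; ring.
Qed.

Hypothesis A3_pqv : forall i j : 'I_p, exists q : nat -> T -> R,
  is_pqv_incr P (fun n => F n.+1) (fun n x => Kproc delta W Gam n x i j) q /\
  as_survival P delta (fun x =>
    (fun n => \sum_(0 <= l < n) q l x) =O_\oo (fun n => n%:R : R)).

(** These sums are the entries of [Kproc], up to the term of index 0 that
    [Kproc] omits, and the quadratic variation of [Kproc] is linear. *)
Lemma square_martingale_slln i j : as_survival P delta (fun x =>
  sublinear (fun n => \sum_(0 <= l < n) (D l i x * D l j x - Gam l x i j) / t l x)).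
Proof.
have [q [hq qO]] := A3_pqv i j.
pose k l x := (t l x)^-1 * (D l i x * D l j x - Gam l x i j).
have KE n x : Kproc delta W Gam n.+1 x i j - Kproc delta W Gam n x i j = k n.+1 x.
  rewrite /Kproc big_nat_recr//= mxE [X in X - _]addrC addrK /k !mxE big_ord1.
  by rewrite /dMproc !mxE.
have mk l : measurable_wrt (F l.+1) (k l).
  apply: measurable_wrtM => //; apply: measurable_wrtB => //.
    exact: measurable_wrtM.
  by apply: measurable_wrt_sub (@FS l) _; case: (DGam l i j).
have k0 l : is_condexp P (F l) (k l) (fun=> 0).
  have [_ iG mG _] := DGam l i j.
  have := condexp_mul (sF l) (@Fm l)
    (condexpB (sF l) (@Fm l) (DGam l i j) (condexp_id iG mG)) (@mtV l l) (tV1 l).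
  by rewrite [X in is_condexp _ _ _ X](_ : _ = fun=> 0)//; apply/funext => x; rewrite subrr mulr0.
have kq l : is_condexp P (F l.+1) (fun x => k l.+1 x ^+ 2) (q l).
  by have := hq l; congr is_condexp; apply/funext => x; rewrite KE.
have slln := martingale_slln (fun n => sF n.+1) (fun n => @Fm n.+1) (fun n => @FS n.+1)
  (fun l => mk l.+1) (fun l => k0 l.+1) kq.
have q0 : {ae P, forall x, forall l, 0 <= q l x}.
  apply: ae_foralln => l; have := condexp_ge0 (@Fm l.+1) (kq l).
  by apply=> x; exact: sqr_ge0.
apply: filterS3 slln q0 qO => x hx q0x hO sx.
have /eqO_exP [c c0 [N _ hN]] := hO sx.
have [C qC] : exists C, forall n, \sum_(0 <= l < n) `|q l x| <= c * n%:R + C.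
  exists (\sum_(0 <= l < N) `|q l x|) => n.
  have [Nn|nN] := leqP N n.
    have := hN n Nn; rewrite /= normr_nat => h.
    apply: (@le_trans _ _ (c * n%:R)); last by rewrite lerDl sumr_ge0.
    apply: le_trans h; rewrite le_eqVlt; apply/orP; left; apply/eqP.
    rewrite ger0_norm ?sumr_ge0//; apply: eq_bigr => l _; exact: ger0_norm.
  apply: (@le_trans _ _ (\sum_(0 <= l < N) `|q l x|)); last first.
    by rewrite lerDr mulr_ge0// ltW.
  by rewrite [leRHS](@big_cat_nat _ _ _ n)//= ?(ltnW nN)// lerDl sumr_ge0.
have sub : sublinear (fun n => \sum_(0 <= l < n) k l.+1 x).
  move=> eps e0; have [B hB] := hx _ (divr_gt0 e0 c0).
  exists (eps / c * (1 + C) + B) => n; apply: (le_trans (hB n)).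
  have := ler_wpM2l (ltW (divr_gt0 e0 c0)) (qC n).
  have -> : eps / c * (c * n%:R + C) = eps * n%:R + eps / c * C.
    by rewrite mulrDr mulrA divfK// gt_eqF.
  set S := \sum_(_ <= _ < _) _; set u := eps / c; lra.
move=> eps e0; have [B hB] := sub eps e0; exists (`|B| + `|k 0%N x|) => n.
have -> : \sum_(0 <= l < n) (D l i x * D l j x - Gam l x i j) / t l x = \sum_(0 <= l < n) k l x.
  by apply: eq_bigr => l _; rewrite mulrC.
case: n => [|n].
  by rewrite big_geq// normr0 mulr0 add0r addr_ge0.
rewrite big_nat_recl//=; apply: (le_trans (ler_normD _ _)).
rewrite addrC addrA lerD2r; apply: (le_trans (hB n)); apply: lerD.
  by rewrite ler_wpM2l ?(ltW e0)// ler_nat.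
exact: ler_norm.
Qed.

Variable GamL : T -> 'M[R]_p.
Hypothesis A2 : as_survival P delta (fun x =>
  ((size (Tstar delta n.-1 x))%:R^-1 *: bracket Gam n x @[n --> \oo]
     --> GamL x) /\ psdmx (GamL x)).

Let s n i j x : R := M n x i 0 * M n x j 0 / t n.-1 x.

Let M0 x : M 0%N x = 0. Proof. by rewrite /M /Mproc big_geq. Qed.

(** The almost sure input of all conclusions, stated with the normalisation by
    the size of the observed tree.  The last part is conditional because, without
    a moment bound, the boundary term [s n] of the summed recursion is only known
    to be [O(n)]. *)
Lemma normalised_growth : as_survival P delta (fun x => [/\
  exists c C : R, 0 < c /\ forall n, c * m ^+ n <= t n x <= C * m ^+ n,
  exists C : R, forall n i, s n i i x <= C * n.+1%:R &
  (forall i, sublinear (fun n => s n i i x)) ->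
    forall i j, (exists C : R, forall n, \sum_(0 <= l < n) `|s l i j x| <= C * n.+1%:R) /\
    sublinear (fun n => \sum_(0 <= l < n) s l i j x - GamL x i j * n%:R)]).
Proof.
have cross : {ae P, forall x i j, forall eps : R, 0 < eps ->
  exists C : R, forall n, `|\sum_(0 <= l < n) M l x i 0 * D l j x / t l x| <=
    eps * (1 + \sum_(0 <= l < n) M l x i 0 ^+ 2 * `|Gam l x j j| / t l x ^+ 2) + C}.
  by apply: filter_forall => i; apply: filter_forall => j; exact: cross_martingale_slln.
have square : {ae P, forall x i j, survival delta x -> sublinear (fun n =>
   \sum_(0 <= l < n) (D l i x * D l j x - Gam l x i j) / t l x)}.
  by apply: filter_forall => i; apply: filter_forall => j; exact: square_martingale_slln.
have gw := gw_growth hxi hdelta hm m_gt1.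
move: A2; rewrite /as_survival; apply: filter_app; move: gw; apply: filter_app.
apply: filterS2 cross square => x hc hs hgw hA2 sx.
have [g0 [z [N [z01 hN]]]] := hgw sx; have [hG _] := hA2 sx.
have g0' n : 0 < (size (Gstar delta n x))%:R :> R by rewrite ltr0n.
have [] := quasi_geometric_growth m_gt1 z01 g0' hN.
have tE' : (fun n => \sum_(0 <= l < n.+1) (size (Gstar delta l x))%:R) = t ^~ x :> (nat -> R).
  by apply/funext => n; rewrite tE.
move=> [c [C [c0 hcC]]] ht.
have {}ht : (fun n => t n x / t n.+1 x) @ \oo --> m^-1.
  by move: ht; under eq_fun do rewrite -!tE.
have m0 : 0 < m by exact: lt_trans m_gt1.
have mV1 : m^-1 < 1 by rewrite invf_lt1.
have t0x n : 0 < t n x by [].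
have tndx n : t n x <= t n.+1 x by [].
have Gcv i j : (fun n => Gam n x i j / t n x) @ \oo --> (1 - m^-1) * GamL x i j.
  apply: (@bracket_incr_cvg _ (t ^~ x)) => //.
  have := @cvg_mx_entry _ _ _ _ _ i j hG; apply: cvg_trans; apply: near_eq_cvg.
  by apply: nearW => n; rewrite mxE /bracket summxE mulrC.
have [Cv Cv0 hCv] : exists2 Cv : R, 0 <= Cv & forall i n, `|Gam n x i i| <= Cv * t n x.
  have /choice [Cf hCf] : forall i, exists Ci : R, 0 <= Ci /\ forall n, `|Gam n x i i| <= Ci * t n x.
    move=> i; have [Ci Ci0 h] := bounded_of_cvg (Gcv i i); exists Ci; split => // n.
    by have := h n; rewrite normrM normfV (gtr0_norm (t0x n)) ler_pdivrMr.
  exists (\sum_i Cf i); first by apply: sumr_ge0 => i _; case: (hCf i).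
  move=> i n; have [_ h] := hCf i; apply: (le_trans (h n)).
  rewrite ler_wpM2r ?(ltW (t0x n))// (bigD1 i)//= lerDl.
  by apply: sumr_ge0 => j _; case: (hCf j).
have M0x i : M 0%N x i 0 = 0 by rewrite M0 mxE.
have [Cd hCd] : exists C : R, forall i n, M n x i 0 ^+ 2 / t n.-1 x <= C * n.+1%:R /\
    \sum_(0 <= l < n) M l x i 0 ^+ 2 / t l.-1 x <= C * n.+1%:R.
  have /choice [Cf hCf] : forall i, exists Ci : R, forall n,
     M n x i 0 ^+ 2 / t n.-1 x <= Ci * n.+1%:R /\
     \sum_(0 <= l < n) M l x i 0 ^+ 2 / t l.-1 x <= Ci * n.+1%:R.
    move=> i; apply: (@normalised_square_bound _ (t ^~ x) _ t0x tndx mV1 ht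
      (fun n => M n x i 0) (fun n => Gam n x i i) Cv (M0x i) (hCv i)).
      by have := hs i i sx; apply: eq_sublinear => n; apply: eq_bigr => l _; rewrite expr2.
    exact: hc.
  exists (\sum_i `|Cf i|) => i n; have [h1 h2] := hCf i n.
  have le : Cf i * n.+1%:R <= (\sum_i `|Cf i|) * n.+1%:R.
    rewrite ler_wpM2r// (bigD1 i)//= (le_trans (ler_norm _))// lerDl.
    exact: sumr_ge0.
  by split; [exact: le_trans h1 le|exact: le_trans h2 le].
split.
- exists c, C; split => // n; rewrite tE; exact: hcC.
- by exists Cd => n i; rewrite /s -expr2; case: (hCd i n).
move=> hsub i j.
have [h1 h2] := @normalised_product_average _ (t ^~ x) _ t0x tndx mV1 ht
  (fun n => M n x i 0) (fun n => M n x j 0) (fun n => Gam n x i j)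
  (fun n => Gam n x i i) (fun n => Gam n x j j) (GamL x i j) Cv Cd (M0x i)
  (hCv i) (hCv j) (fun n => (hCd i n).2) (fun n => (hCd j n).2) (hsub i) (hsub j)
  (Gcv i j) (hs i j sx) (hc i j) (hc j i).
by split => //; exists Cd.
Qed.

Lemma extinct_after x n k : size (Gstar delta n x) = 0%N -> (n <= k)%N ->
  size (Gstar delta k x) = 0%N.
Proof.
move=> h0 /subnKC <-; elim: (k - n)%N => [|j IH]; first by rewrite addn0.
rewrite addnS; move: IH; set l := (n + j)%N.
have ll : ((2 ^ l).-1 <= (2 ^ l.+1).-1)%N by rewrite -!subn1 leq_sub2r// leq_exp2l.
rewrite (size_Gstar hdelta x ll) (size_Gstar hdelta x (leqnn _)) => h.
rewrite gsizeS big1// => i _; move/eqP: h.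
by rewrite sum_nat_eq0 => /forallP /(_ i); rewrite eqb0 => /negbTE ->.
Qed.

Let DE n x i : D n i x = \sum_(k <- Gstar delta n.+1 x) W k x i 0.
Proof. by rewrite /D /M /Mproc big_nat_recr//= mxE [X in X - _]addrC addrK summxE. Qed.

Let m_gt0 : 0 < m. Proof. exact: lt_trans m_gt1. Qed.

(** On survival this is the linear bound on [s n]; on extinction the martingale is
    eventually constant. *)
Lemma squared_norm_bigO : {ae P, forall x,
  (fun n => sqnorm (M n x)) =O_\oo (fun n => n%:R * m ^+ n : R)}.
Proof.
move: normalised_growth; rewrite /as_survival; apply: filterS => x hx.
apply/eqO_exP; have [sx|nsx] := pselect (survival delta x).
  have [[c [C [c0 hC]]] [B hB] _] := hx sx.
  have B0 : 0 <= p%:R * (`|B| * `|C|) by rewrite !mulr_ge0.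
  exists (p%:R * (`|B| * `|C|) * 2 + 1); first by rewrite ltr_wpDl// mulr_ge0.
  exists 1%N => // n /= n1.
  have n0 : 1 <= n%:R :> R by rewrite ler1n.
  have mn : 0 < m ^+ n by rewrite exprn_gt0.
  rewrite ger0_norm; last by apply: sumr_ge0 => i _; exact: sqr_ge0.
  rewrite [X in _ <= _ * X]ger0_norm; last by rewrite mulr_ge0// ltW.
  apply: (@le_trans _ _ (p%:R * (`|B| * `|C|) * 2 * (n%:R * m ^+ n))); last first.
    by rewrite ler_wpM2r ?mulr_ge0 ?(ltW mn)// lerDl.
  rewrite /sqnorm; apply: (@le_trans _ _ (\sum_(i < p) (`|B| * `|C|) * 2 * (n%:R * m ^+ n))).
    apply: ler_sum => i _; have := hB n i; rewrite /s -expr2 ler_pdivrMr// => h.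
    apply: (le_trans h); apply: (@le_trans _ _ (`|B| * n.+1%:R * (`|C| * m ^+ n))).
      apply: ler_pM => //.
      - have := le_trans (sqr_ge0 _) h; rewrite pmulr_lge0//.
      - by rewrite ler_wpM2r// ler_norm.
      - have /andP[_ h2] := hC n.-1; apply: (le_trans h2); apply: ler_pM.
        + have := le_trans (ltW (t_gt0 n.-1 x)) h2; rewrite pmulr_lge0//.
          by rewrite exprn_gt0.
        + by rewrite exprn_ge0// ltW.
        + exact: ler_norm.
        + by rewrite ler_weXn2l ?(ltW m_gt1)// leq_pred.
    have -> : `|B| * `|C| * 2 * (n%:R * m ^+ n) = `|B| * (2 * n%:R) * (`|C| * m ^+ n) by ring.
    rewrite ler_wpM2r ?mulr_ge0 ?(ltW mn)// ler_wpM2l// -natr1; move: n0; lra.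
  by rewrite sumr_const card_ord -mulr_natl; rewrite le_eqVlt; apply/orP; left; apply/eqP; ring.
have [N hN] : exists n, size (Gstar delta n x) = 0%N.
  by apply: contrapT => h; apply: nsx => -[n _ hn]; apply: h; exists n.
have MN n : (N <= n)%N -> M n x = M N x.
  move=> /subnKC <-; elim: (n - N)%N => [|k IH]; first by rewrite addn0.
  rewrite addnS -IH /M /Mproc [LHS]big_nat_recr//=.
  have -> : Gstar delta (N + k).+1 x = [::].
    by apply/size0nil; apply: extinct_after hN _; rewrite leqW// leq_addr.
  by rewrite big_nil addr0.
have q0 : 0 <= sqnorm (M N x) by apply: sumr_ge0 => i _; exact: sqr_ge0.
exists (sqnorm (M N x) + 1); first by rewrite ltr_wpDl.
exists (maxn N 1) => // n; rewrite /= geq_max => /andP[Nn n1].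
rewrite MN// ger0_norm// ger0_norm ?mulr_ge0 ?exprn_ge0 ?(ltW m_gt0)//.
apply: (@le_trans _ _ (sqnorm (M N x) + 1)); first by rewrite lerDl.
rewrite ler_peMr ?addr_ge0// -[leLHS]mul1r ler_pM// ?ler1n//.
by rewrite exprn_ege1// ltW.
Qed.

Variables (Xi : nat -> T -> 'M[R]_p) (XiL : T -> 'M[R]_p).
Hypothesis Xi_unit : forall n x, Xi n x \in unitmx.
Hypothesis A4 : as_survival P delta (fun x =>
  ((size (Tstar delta n x))%:R^-1 *: Xi n x @[n --> \oo] --> XiL x) /\
  XiL x \in unitmx).

Let V n x : R := ((M n x)^T *m invmx (Xi n.-1 x) *m M n x) 0 0.

(** [V] is a bilinear form in the normalised products [s] with these coefficients,
    which converge to the entries of [invmx XiL]. *)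
Let c n i j x : R := t n.-1 x * invmx (Xi n.-1 x) i j.

Let VE n x : V n x = \sum_i \sum_j c n i j x * s n i j x.
Proof.
rewrite /V !mxE exchange_big; apply: eq_bigr => j _.
rewrite !mxE mulr_suml; apply: eq_bigr => i _; rewrite !mxE /c /s.
by field; exact: lt0r_neq0 (t_gt0 _ _).
Qed.

Let c_cvg : as_survival P delta (fun x =>
  forall i j, (fun n => c n i j x) @ \oo --> invmx (XiL x) i j).
Proof.
move: A4; rewrite /as_survival; apply: filterS => x hx sx i j.
have [hA uL] := hx sx; rewrite -cvg_shiftS /c /=.
have tV n : (t n x)^-1 \is a GRing.unit by rewrite unitfE invr_eq0 gt_eqF.
have uA n : (t n x)^-1 *: Xi n x \in unitmx by rewrite unitmxZ.
have := @cvg_invmx _ p (fun n => (t n x)^-1 *: Xi n x) (XiL x)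
  (fun i j => @cvg_mx_entry _ _ _ _ _ i j hA) uA uL i j.
apply: cvg_trans; apply: near_eq_cvg; apply: nearW => n.
by rewrite invmxZ// mxE invrK.
Qed.

Lemma quadratic_form_bigO :
  as_survival P delta (fun x => V^~ x =O_\oo (fun n => n%:R : R)).
Proof.
move: normalised_growth c_cvg; rewrite /as_survival; apply: filterS2 => x hg hc sx.
have [_ [B hB] _] := hg sx.
have /choice [Cf hCf] : forall ij : 'I_p * 'I_p, exists C : R, 0 <= C /\
    forall n, `|c n ij.1 ij.2 x| <= C.
  by move=> [i j]; have [C C0 h] := bounded_of_cvg (hc sx i j); exists C.
have B0 n i : s n i i x <= `|B| * n.+1%:R.
  by apply: (le_trans (hB n i)); rewrite ler_wpM2r// ler_norm.
pose K := \sum_i \sum_j Cf (i, j) * `|B|.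
have K0 : 0 <= K.
  by apply: sumr_ge0 => i _; apply: sumr_ge0 => j _; rewrite mulr_ge0//; case: (hCf (i, j)).
apply/eqO_exP; exists (K * 2 + 1); first by rewrite ltr_wpDl// mulr_ge0.
exists 1%N => // n /= n1; have n0 : 1 <= n%:R :> R by rewrite ler1n.
rewrite normr_nat; apply: (@le_trans _ _ (K * n.+1%:R)); last first.
  by rewrite -natr1; have := ler_wpM2l K0 n0; move: n0; lra.
rewrite VE /K mulr_suml; apply: (le_trans (ler_norm_sum _ _ _)); apply: ler_sum => i _.
rewrite mulr_suml; apply: (le_trans (ler_norm_sum _ _ _)); apply: ler_sum => j _.
have [C0 hC] := hCf (i, j); rewrite normrM -mulrA; apply: ler_pM => //.
apply: (le_trans (normalised_product_le _ _ (t_gt0 n.-1 x))).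
by have := B0 n i; have := B0 n j; rewrite /s -!expr2; lra.
Qed.

Hypothesis A6 : forall i : 'I_p, exists C : nat -> T -> \bar R,
  (forall n, (0 < n)%N -> is_condexp_ge0 P (F n.-1)
    (fun x => ((m `^ (- (n%:R / 2)) *
       \sum_(k <- Gstar delta n x) W k x i 0) ^+ 4)%:E) (C n)) /\
  {ae P, forall x, (ereal_sup [set C n x | n in [set n | (0 < n)%N]] < +oo)%E}.

(** Bounded conditional fourth moments make the [n]-th increment at most
    [n ^ (q / 4) * m ^ (n / 2)] eventually, for every [q > 1]; the martingale is
    then dominated by its last increments.  The choice [q = 2 * del'], with [del']
    strictly between [2^-1] and [del], leaves a power of [n] to beat constants. *)
Lemma coordinate_growth (del : R) i : 2^-1 < del ->
  {ae P, forall x, forall eps : R, 0 < eps ->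
    \forall n \near \oo, M n x i 0 ^+ 2 <= eps * (n%:R `^ del * m ^+ n)}.
Proof.
move=> hdel; pose del' := (del + 2^-1) / 2.
have d1 : 2^-1 < del' by rewrite /del'; move: hdel; lra.
have d2 : 0 < del - del' by rewrite /del'; move: hdel; lra.
have d'0 : 0 < del' by apply: lt_trans d1; rewrite invr_gt0.
have q1 : 1 < 2 * del' by move: d1; lra.
have [C [hC hsup]] := A6 i.
have := conditional_moment_growth Fm hC hsup q1.
apply: filterS => x [N hN].
pose y n : R := n%:R `^ (del' / 2); pose r := Num.sqrt m.
have r0 : 0 < r by rewrite sqrtr_gt0.
have r2 : r ^+ 2 = m by rewrite sqr_sqrtr// ltW.
have r1 : 1 < r.
  by rewrite ltNge; apply/negP => h; move: m_gt1; rewrite -r2 ltNge exprn_ile1// ltW.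
have y0 n : 0 <= y n by exact: powR_ge0.
have yS n : y n <= y n.+1.
  by apply: ge0_ler_powR; rewrite ?nnegrE ?ler_nat// divr_ge0// ltW.
have yX n k : y n ^+ k = n%:R `^ (del' / 2 * k%:R).
  by rewrite powRrM powR_mulrn// powR_ge0.
have aE n : m `^ (- (n%:R / 2)) = (r ^+ n)^-1.
  rewrite powRN; congr (_^-1); rewrite mulrC powRrM powR_mulrn ?powR_ge0//.
  by rewrite powR12_sqrt// ltW.
have incr n : (N <= n)%N -> `|M n.+1 x i 0 - M n x i 0| <= y n.+1 * r ^+ n.+1.
  move=> Nn; have := hN n Nn; rewrite aE -DE -/(D n i x); set S := D n i x.
  have rn : 0 < r ^+ n.+1 by rewrite exprn_gt0.
  have -> : n.+1%:R `^ (2 * del') = y n.+1 ^+ 4.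
    by rewrite yX; congr (_ `^ _); field.
  have -> : ((r ^+ n.+1)^-1 * S) ^+ 4 = `|(r ^+ n.+1)^-1 * S| ^+ 4.
    by rewrite -normrX ger0_norm// exprn_even_ge0.
  move=> /ltW; rewrite ler_pXn2r ?nnegrE//.
  by rewrite normrM gtr0_norm ?invr_gt0// ler_pdivrMl// mulrC.
have hM := geometric_increments r1 y0 yS incr.
set K := `|M N x i 0| in hM; set b := r / (r - 1) in hM.
move=> eps e0.
have [N1 hN1] := powR_eventually_ge (4 * K ^+ 2 / eps) (lt_trans d'0 (ltac:(by rewrite -subr_gt0) : del' < del)).
have [N2 hN2] := powR_eventually_ge (4 * b ^+ 2 / eps) d2.
exists (maxn N (maxn N1 (maxn N2 1))) => // n /=.
rewrite !geq_max => /and4P[nN nN1 nN2 n1].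
have h := hM n nN; have n0 : 0 < n%:R :> R by rewrite ltr0n.
have mn1 : 1 <= m ^+ n by rewrite exprn_ege1// ltW.
have rm : r ^+ n ^+ 2 = m ^+ n by rewrite exprAC r2.
have yy : y n ^+ 2 = n%:R `^ del' by rewrite yX; congr (_ `^ _); field.
have nd : n%:R `^ del = n%:R `^ del' * n%:R `^ (del - del') :> R.
  have nz : n%:R != 0 :> R by rewrite gt_eqF.
  by rewrite -powRD ?nz ?implybT// addrC subrK.
have h1 : 2 * K ^+ 2 <= eps / 2 * n%:R `^ del.
  by have := hN1 n nN1; rewrite ler_pdivrMr//; lra.
have h2 : 2 * b ^+ 2 <= eps / 2 * n%:R `^ (del - del').
  by have := hN2 n nN2; rewrite ler_pdivrMr//; lra.
have sq : M n x i 0 ^+ 2 <= 2 * K ^+ 2 + 2 * (b * (y n * r ^+ n)) ^+ 2.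
  rewrite -[leLHS]real_normK ?num_real//.
  have : `|M n x i 0| ^+ 2 <= (K + b * (y n * r ^+ n)) ^+ 2.
    by rewrite lerXn2r ?nnegrE// (le_trans (normr_ge0 _) h).
  by have := sqr_ge0 (K - b * (y n * r ^+ n)); rewrite sqrrB sqrrD; lra.
apply: (le_trans sq).
have e1 : 2 * (b * (y n * r ^+ n)) ^+ 2 = 2 * b ^+ 2 * (n%:R `^ del' * m ^+ n).
  by rewrite !exprMn yy rm; ring.
have dm0 : 0 <= n%:R `^ del' * m ^+ n by rewrite mulr_ge0 ?powR_ge0// (le_trans _ mn1).
have h3 := ler_wpM2r dm0 h2.
have h4 : eps / 2 * n%:R `^ del <= eps / 2 * n%:R `^ del * m ^+ n.
  by rewrite ler_peMr// mulr_ge0 ?powR_ge0// divr_ge0// ltW.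
have h5 : eps / 2 * n%:R `^ (del - del') * (n%:R `^ del' * m ^+ n) =
   eps / 2 * n%:R `^ del * m ^+ n by rewrite nd; ring.
rewrite e1; move: h1 h3 h4; rewrite h5.
set u := 2 * K ^+ 2; set v := 2 * b ^+ 2 * _; rewrite mulrA.
have -> : eps * n%:R `^ del * m ^+ n =
  eps / 2 * n%:R `^ del * m ^+ n + eps / 2 * n%:R `^ del * m ^+ n by field.
set w := eps / 2 * _; set w' := w * m ^+ n; lra.
Qed.

Lemma squared_norm_littleo (del : R) : 2^-1 < del -> {ae P, forall x,
  (fun n => sqnorm (M n x)) =o_\oo (fun n => n%:R `^ del * m ^+ n : R)}.
Proof.
move=> hdel; have h : {ae P, forall x, forall i, forall eps : R, 0 < eps ->
    \forall n \near \oo, M n x i 0 ^+ 2 <= eps * (n%:R `^ del * m ^+ n)}.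
  by apply: filter_forall => i; exact: coordinate_growth.
apply: filterS h => x hx; apply/eqoP => eps e0.
have p0' : 0 < (p.+1%:R : R) by [].
have h : \forall n \near \oo, forall i, M n x i 0 ^+ 2 <=
    eps / p.+1%:R * (n%:R `^ del * m ^+ n).
  by apply: filter_forall => i; apply: hx; exact: divr_gt0.
apply: filterS h => n hn.
have g0 : 0 <= n%:R `^ del * m ^+ n by rewrite mulr_ge0 ?powR_ge0// exprn_ge0// ltW.
rewrite ger0_norm; last by apply: sumr_ge0 => i _; exact: sqr_ge0.
rewrite (ger0_norm g0); apply: (le_trans (ler_sum _ (fun i _ => hn i))).
rewrite sumr_const card_ord -[leLHS]mulr_natl mulrA ler_wpM2r//.
rewrite mulrCA ler_piMr ?(ltW e0)// ler_pdivrMr// mul1r ler_nat //.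
Qed.

(** By [coordinate_growth] the normalised squares are sublinear, hence the averages
    of [s n i j] tend to [GamL i j]; as [\sum_(l < n) `|s l i j|] is [O(n)], the
    coefficients [c] may be replaced by their limits. *)
Lemma quadratic_form_average : {ae P, forall x,
  (0 < size (Gstar delta n x))%N%:R *
    (n%:R^-1 * \sum_(1 <= l < n.+1) V l x) @[n --> \oo] -->
  \tr (GamL x *m invmx (XiL x)) * \1_(survival delta) x}.
Proof.
have hgrow : {ae P, forall x, forall i, forall eps : R, 0 < eps ->
    \forall n \near \oo, M n x i 0 ^+ 2 <= eps * (n%:R `^ 1 * m ^+ n)}.
  by apply: filter_forall => i; apply: coordinate_growth; rewrite invf_lt1// ltr1n.
move: A2 c_cvg; rewrite /as_survival => A2' c_cvg'.
move: A2'; apply: filter_app; move: c_cvg'; apply: filter_app.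
move: normalised_growth; rewrite /as_survival; apply: filter_app.
apply: filterS hgrow => x hM hg hc hA2.
have [sx|nsx] := pselect (survival delta x); last first.
  rewrite indicE memNset// mulr0.
  have [N hN] : exists n, size (Gstar delta n x) = 0%N.
    by apply: contrapT => h; apply: nsx => -[n _ hn]; apply: h; exists n.
  apply: (@cvg_trans _ ((fun=> 0 : R) @ \oo)); last exact: cvg_cst.
  apply: near_eq_cvg; exists N => // n /= Nn.
  by rewrite (extinct_after hN Nn) mul0r.
rewrite indicE mem_set// mulr1.
have [[k [C [k0 hC]]] [B hB] havg] := hg sx.
have ssub i : sublinear (fun n => s n i i x).
  move=> eps e0; have e1 : 0 < eps * k / m by rewrite divr_gt0// mulr_gt0.
  have [N _ hN] := hM i _ e1.
  exists (\sum_(0 <= l < N) `|s l i i x| + `|s 0%N i i x|) => n.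
  case: n => [|n].
    by rewrite mulr0 add0r lerDr sumr_ge0.
  have [nN|Nn] := ltnP n.+1 N.
    rewrite (bigD1_seq n.+1) ?iota_uniq ?mem_index_iota//=.
    set S := \sum_(_ <- _ | _) _; have S0 : 0 <= S by apply: sumr_ge0.
    have := mulr_ge0 (ltW e0) (ler0n R n.+1); have := normr_ge0 (s 0%N i i x).
    by move: (eps * n.+1%:R) => u; lra.
  apply: (@le_trans _ _ (eps * n.+1%:R)); last by rewrite lerDl addr_ge0// sumr_ge0.
  have := hN _ Nn; rewrite powRr1// => h.
  rewrite /s -expr2 ger0_norm ?divr_ge0 ?sqr_ge0 ?(ltW (t_gt0 _ _))// ler_pdivrMr//=.
  apply: (le_trans h); have /andP[h2 _] := hC n.
  have -> : eps * k / m * (n.+1%:R * m ^+ n.+1) = eps * n.+1%:R * (k * m ^+ n).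
    by rewrite exprS; field; rewrite gt_eqF.
  by rewrite ler_wpM2l// mulr_ge0// ltW.
have {}havg := havg ssub; have [_ [GT _]] := hA2 sx.
pose kap i j := invmx (XiL x) i j; pose L := \sum_i \sum_j kap i j * GamL x i j.
have LE : L = \tr (GamL x *m invmx (XiL x)).
  rewrite /L /mxtrace exchange_big; apply: eq_bigr => j _; rewrite mxE.
  by apply: eq_bigr => i _; rewrite /kap -[in LHS]GT mxE mulrC.
have main : sublinear (fun n => \sum_(0 <= l < n) V l x - L * n%:R).
  have sub : sublinear (fun n => \sum_i \sum_j (\sum_(0 <= l < n) (c l i j x - kap i j) * s l i j x
      + kap i j * (\sum_(0 <= l < n) s l i j x - GamL x i j * n%:R))).
    apply: sublinear_sum => i; apply: sublinear_sum => j.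
    have [[K hK] hs] := havg i j.
    apply: sublinearD; last exact: sublinearZ.
    apply: (@sublinear_weighted _ _ _ K) => //.
    by rewrite -(subrr (kap i j)); apply: cvgB; [exact: hc|exact: cvg_cst].
  apply: eq_sublinear sub => n; rewrite /L mulr_suml.
  under [X in _ = X - _]eq_bigr do rewrite VE.
  rewrite [X in _ = X - _]exchange_big /= -sumrB; apply: eq_bigr => i _.
  rewrite [X in _ = X - _]exchange_big /= mulr_suml -sumrB; apply: eq_bigr => j _.
  rewrite mulrBr mulr_sumr addrA -big_split /=; congr (_ - _); last by rewrite mulrA.
  by apply: eq_bigr => l _; ring.
have hlim : (fun n => n%:R^-1 * \sum_(1 <= l < n.+1) V l x) @ \oo --> L.
  have sub0 := sublinear_cvg main.
  have V0 : V 0%N x = 0 by rewrite /V M0 mulmx0 mxE.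
  have h1 : (fun n => (\sum_(0 <= l < n.+1) V l x - L * n.+1%:R) / n.+1%:R * (1 + n%:R^-1) + L * (1 + n%:R^-1)) @ \oo --> (0 * (1 + 0) + L * (1 + 0) : R).
    have inv0 : (fun n => n%:R^-1 : R) @ \oo --> (0 : R).
      by rewrite -cvg_shiftS; exact: cvg_harmonic.
    have one : (fun n => 1 + n%:R^-1 : R) @ \oo --> (1 + 0 : R).
      by apply: cvgD => //; exact: cvg_cst.
    apply: cvgD; apply: cvgM => //; last exact: cvg_cst.
    by rewrite -cvg_shiftS in sub0.
  rewrite mul0r add0r addr0 mulr1 in h1.
  apply: cvg_trans h1; apply: near_eq_cvg; exists 1%N => // n /= n1.
  have n0 : n%:R != 0 :> R by rewrite pnatr_eq0 -lt0n.
  rewrite [in LHS]big_ltn// V0 add0r.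
  set S := \sum_(_ <= _ < _) _; rewrite -natr1; field.
  by rewrite n0 natr1 pnatr_eq0.
rewrite LE in hlim; apply: cvg_trans hlim; apply: near_eq_cvg.
apply: nearW => n; case: posnP => [g0|_]; last by rewrite mul1r.
by exfalso; apply: sx; exists n.
Qed.

End assembly.

Theorem theorem5p1 (d : measure_display) (T : measurableType d) (R : realType)
  (P : probability T R)
  (p0 p1 p01 : R) (xi : nat -> {mfun T >-> (bool * bool)%type})
  (delta : nat -> T -> bool)
  (hxi : reproduction P p0 p1 p01 xi) (hdelta : gw_tree xi delta)
  (a b c e : R) (X eps eta : nat -> {RV P >-> R})
  (hX : rcbar a b c e (fun k => X k : T -> R) (fun k => eps k : T -> R)
          (fun k => eta k : T -> R))
  (F : nat -> set (set T))
  (hF : F = obs_filtration delta (fun k => X k : T -> R))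
  (m : R) (hm : m = 2 * p01 + p0 + p1) (m_gt1 : 1 < m)
  (p : nat) (W : nat -> T -> 'cV[R]_p) (hW : forall k, (0 < k)%N -> random_mx (W k))
  (M : nat -> T -> 'cV[R]_p) (hM : M = Mproc delta W)
  (M_martingale : martingale_mx P F M)
  (Gam : nat -> T -> 'M[R]_p)
  (hGam : forall n, is_condexp_mx P (F n)
     (fun x => (M n.+1 x - M n x) *m (M n.+1 x - M n x)^T) (Gam n))
  (A1 : forall n, square_integrable_mx P (M n))
  (GamL : T -> 'M[R]_p)
  (A2 : as_survival P delta (fun x =>
     ((size (Tstar delta n.-1 x))%:R^-1 *: bracket Gam n x @[n --> \oo]
        --> GamL x) /\ psdmx (GamL x)))
  (A3_sq : forall n, square_integrable_mx P (Kproc delta W Gam n))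
  (A3_pqv : forall i j : 'I_p, exists q : nat -> T -> R,
     is_pqv_incr P (fun n => F n.+1)
       (fun n x => Kproc delta W Gam n x i j) q /\
     as_survival P delta (fun x =>
       (fun n => \sum_(0 <= l < n) q l x) =O_\oo (fun n => n%:R : R)))
  (Xi : nat -> T -> 'M[R]_p) (hXi : forall n, random_mx (Xi n))
  (Xi_sym : forall n x, (Xi n x)^T = Xi n x)
  (Xi_unit : forall n x, Xi n x \in unitmx)
  (XiL : T -> 'M[R]_p)
  (A4 : as_survival P delta (fun x =>
     ((size (Tstar delta n x))%:R^-1 *: Xi n x @[n --> \oo] --> XiL x) /\
     XiL x \in unitmx))
  (alpha : R) (alpha_gt0 : 0 < alpha)
  (A5 : as_survival P delta (fun x => forall n, (0 < n)%N ->
     psdmx (alpha *: (invmx (Xi n.-1 x) - invmx (Xi n x)) -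
            invmx (Xi n x) *m Gam n x *m invmx (Xi n x)))) :
  let V n x : R := ((M n x)^T *m invmx (Xi n.-1 x) *m M n x) 0 0 in
  [/\ as_survival P delta (fun x => V^~ x =O_\oo (fun n => n%:R : R)),
      as_survival P delta (fun x => posdefmx (XiL x)) ->
        {ae P, forall x, (fun n => sqnorm (M n x)) =O_\oo
                         (fun n => n%:R * m ^+ n : R)} &
      (forall i : 'I_p, exists C : nat -> T -> \bar R,
         (forall n, (0 < n)%N -> is_condexp_ge0 P (F n.-1)
            (fun x => ((m `^ (- (n%:R / 2)) *
               \sum_(k <- Gstar delta n x) W k x i 0) ^+ 4)%:E) (C n)) /\
         {ae P, forall x,
           (ereal_sup [set C n x | n in [set n | (0 < n)%N]] < +oo)%E}) ->
      (forall del : R, 2^-1 < del ->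
         {ae P, forall x, (fun n => sqnorm (M n x)) =o_\oo
                          (fun n => n%:R `^ del * m ^+ n : R)}) /\
      {ae P, forall x,
         (0 < size (Gstar delta n x))%N%:R *
           (n%:R^-1 * \sum_(1 <= l < n.+1) V l x) @[n --> \oo] -->
         \tr (GamL x *m invmx (XiL x)) * \1_(survival delta) x}].
Proof.
move=> V; rewrite hF in M_martingale hGam A3_pqv *.
rewrite hM in M_martingale hGam A1 V *.
split.
- by apply: quadratic_form_bigO; eassumption.
- by move=> _; apply: squared_norm_bigO; eassumption.
move=> A6; split.
  by move=> del hdel; apply: squared_norm_littleo; eassumption.
by apply: quadratic_form_average; eassumption.
Qed.
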